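(* The following decision problem is coNP-complete: given a matrix $A \in \mathbb{Q}^{m\times n}$ and a positive integer $k$, decide whether $A$ satisfies the nullspace property of order $k$ with some constant $\alpha_k < 1$.
   Context: $A$ satisfies the nullspace property (NSP) of order $k$ with constant $\alpha_k$ if $\|x\|_{k,1} \le \alpha_k \|x\|_1$ for all $x\in\mathbb{R}^n$ with $Ax = 0$, where $\|x\|_{k,1}$ denotes the sum of the $k$ largest absolute values of entries of $x$ and $\|x\|_1 = \sum_i |x_i|$. Input size is measured by binary encoding length. *)

(* Defs.v *)
From HB Require Import structures.
From mathcomp Require Import all_boot all_order all_algebra.
From mathcomp Require Import reals.
Set Implicit Arguments.
Unset Strict Implicit.
Unset Printing Implicit Defensive.
Import Order.TTheory GRing.Theory Num.Theory.

(* tape symbols: Some b = bit b, None = blank *)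
Definition sym := option bool.

Inductive move := MoveL | MoveR | Stay.

(* tape: cells to the left of the head (nearest first), the scanned cell,
   cells to the right of the head (nearest first); unlisted cells are blank *)
Record tape := Tape { tleft : seq sym; thead : sym; tright : seq sym }.

Definition write (s : sym) (t : tape) : tape := Tape (tleft t) s (tright t).

Definition move_tape (d : move) (t : tape) : tape :=
  match d with
  | MoveL => match tleft t with
             | [::] => Tape [::] None (thead t :: tright t)
             | a :: l => Tape l a (thead t :: tright t)
             end
  | MoveR => match tright t with
             | [::] => Tape (thead t :: tleft t) None [::]
             | a :: r => Tape (thead t :: tleft t) a r
             end
  | Stay => t
  end.

(* A deterministic Turing machine with states 'I_(tm_states.+1), start state
   ord0; it halts when the transition function returns None. *)
Record TM := MkTM {
  tm_states : nat;
  tm_delta : 'I_tm_states.+1 -> sym -> option ('I_tm_states.+1 * sym * move)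
}.

Definition config (M : TM) := ('I_(tm_states M).+1 * tape)%type.

Definition step (M : TM) (c : config M) : config M :=
  match tm_delta c.1 (thead c.2) with
  | None => c
  | Some (q, s, d) => (q, move_tape d (write s c.2))
  end.

Definition halted (M : TM) (c : config M) : bool :=
  if tm_delta c.1 (thead c.2) is None then true else false.

Definition run (M : TM) (t : nat) (c : config M) : config M := iter t (step (M:=M)) c.

Definition init (M : TM) (x : seq bool) : config M :=
  (ord0, match x with
         | [::] => Tape [::] None [::]
         | b :: r => Tape [::] (Some b) (map Some r)
         end).

Fixpoint read_word (s : seq sym) : seq bool :=
  match s with
  | Some b :: s' => b :: read_word s'
  | _ => [::]
  end.

Definition output (M : TM) (c : config M) : seq bool :=
  read_word (thead c.2 :: tright c.2).

Definition poly_bound (c n : nat) : nat := c * n ^ c + c.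

Definition FP (f : seq bool -> seq bool) : Prop :=
  exists (M : TM) (c : nat), forall x : seq bool,
    exists t, t <= poly_bound c (size x) /\
      halted (run t (init M x)) /\ output (run t (init M x)) = f x.

Definition language := seq bool -> Prop.

Definition inP (L : language) : Prop :=
  exists f, FP f /\ forall x, L x <-> f x = [:: true].

(* self-delimiting pairing of words *)
Definition pair_enc (x y : seq bool) : seq bool :=
  flatten [seq [:: true; b] | b <- x] ++ [:: false; false] ++ y.

Definition inNP (L : language) : Prop :=
  exists V : language, inP V /\ exists c : nat, forall x,
    L x <-> exists y, size y <= poly_bound c (size x) /\ V (pair_enc x y).

Definition inCoNP (L : language) : Prop := inNP (fun x => ~ L x).

Definition karp_reducible (L1 L2 : language) : Prop :=
  exists f, FP f /\ forall x, L1 x <-> L2 (f x).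

Definition coNP_complete (L : language) : Prop :=
  inCoNP L /\ forall L' : language, inCoNP L' -> karp_reducible L' L.

(* little-endian binary digits of n (no trailing zero; [::] for 0) *)
Fixpoint bits_aux (fuel n : nat) : seq bool :=
  match fuel with
  | 0 => [::]
  | fuel'.+1 => if n == 0 then [::] else odd n :: bits_aux fuel' n./2
  end.
Definition bits (n : nat) : seq bool := bits_aux n n.

(* self-delimiting binary code of a natural number *)
Definition enc_nat (n : nat) : seq bool :=
  flatten [seq [:: true; b] | b <- bits n] ++ [:: false; false].

Definition enc_int (z : int) : seq bool := ((z < 0)%R :: enc_nat `|z|%N).

Definition enc_rat (q : rat) : seq bool := enc_int (numq q) ++ enc_nat `|denq q|%N.

Definition enc_instance (m n : nat) (A : 'M[rat]_(m, n)) (k : nat) : seq bool :=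
  enc_nat m ++ enc_nat n
  ++ flatten [seq enc_rat (A i j) | i <- enum 'I_m, j <- enum 'I_n]
  ++ enc_nat k.

Local Open Scope ring_scope.

Definition l1norm (R : realType) (n : nat) (x : 'cV[R]_n) : R :=
  \sum_(i < n) `|x i 0|.

(* ||x||_{k,1}: sum of the k largest absolute values of the entries of x
   (all of them if k >= n) *)
Definition topk_norm (R : realType) (n k : nat) (x : 'cV[R]_n) : R :=
  \sum_(a <- take k (sort (fun a b : R => b <= a) [seq `|x i 0| | i <- enum 'I_n])) a.

Definition NSP (R : realType) (m n : nat) (A : 'M[rat]_(m, n)) (k : nat) (alpha : R) : Prop :=
  forall x : 'cV[R]_n, map_mx (@ratr R) A *m x = 0 ->
    topk_norm k x <= alpha * l1norm x.

Definition NSP_language (R : realType) : language :=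
  fun w => exists (m n : nat) (A : 'M[rat]_(m, n)) (k : nat),
    (0 < k)%N /\ w = enc_instance A k /\ exists alpha : R, alpha < 1 /\ NSP A k alpha.

(* Main.v *)
Require Import Defs.
From HB Require Import structures.
From mathcomp Require Import all_boot all_order all_algebra perm.
From mathcomp Require Import boolp reals zify ring.
Import Defs.
Set Implicit Arguments.
Unset Strict Implicit.
Unset Printing Implicit Defensive.
Import Order.TTheory GRing.Theory Num.Theory.

(* The nullspace property of order k holds with a constant below 1 iff no nonzero
   rational kernel vector has at most k nonzero entries. By Cramer's rule a sparse
   kernel vector can be taken integral of polynomial size, hence membership.

   For hardness, a run of the verifier on an unknown certificate is a tableau whose
   rows, read one after another, form a single sequence in which each cell is
   constrained by the W-th cell before it and the neighbours of the latter.
   Choosing a tile (left, cell, right, above) for every cell is an exact k-subset-sum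
   instance: in base B the digits check that neighbouring tiles agree. Distinct
   numbers a_1, ..., a_n have k of them summing to T iff the matrix with columns
   (1, a_j, ..., a_j^k) and the extra column (0, ..., 0, 1, T) has k + 1 dependent
   columns: a polynomial of degree k vanishing at k of the a_j is a multiple of
   X^k - (sum of these a_j) X^(k-1) + ....

   Polynomial-time functions are closed under composition, pairing, branching and
   size-bounded folds when viewed on binary trees; a tree is kept in prefix notation
   on a stack, and a single tape simulates five stacks by interleaving. *)

(** * Tapes as functions on the integers *)

(** The complement of the language also contains the malformed words, so a certificate refutes the
    syntax, the lowest terms of a fraction, or the nullspace property. Lowest terms are refuted by a
    common factor; the verifier multiplies and compares but computes no gcd. Dimensions are written
    in binary and a matrix without rows has no entries, so n can be exponential in the length of the
    word; that case is decided without listing a vector.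

    For hardness, the numbers become nodes of a Vandermonde matrix, so their digits must also keep
    them distinct. Powers up to k are affordable because k, the number of tableau cells, is
    polynomial in the input. The exact count k is used twice: it fixes the size of the support and
    it bounds the carries in base B.

    Every polynomial-time claim needs a program. Trees are the universal data because their prefix
    code is self-delimiting: a program acts on the top of a stack and ignores what lies below, so
    programs compose. Counters are unary, large numbers are lists of bits. *)

Definition fupd (f : int -> sym) (p : int) (s : sym) : int -> sym :=
  fun z => if z == p then s else f z.

Lemma fupd_id f p : fupd f p (f p) = f.
Proof. by apply/funext => z; rewrite /fupd; case: eqP => [->|]. Qed.

(** Reading both lists with default [None] forgets trailing blanks; only the content and the head
    position remain. *)
Definition trep (t : tape) (f : int -> sym) (p : int) : Prop :=
  [/\ thead t = f p,
      forall i : nat, nth None (tleft t) i = f (p - 1 - i%:Z)%R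
    & forall i : nat, nth None (tright t) i = f (p + 1 + i%:Z)%R].

Definition move_delta (d : move) : int :=
  match d with MoveL => (-1)%R | MoveR => 1%R | Stay => 0%R end.

Lemma trep_move t f p s d : trep t f p ->
  trep (move_tape d (write s t)) (fupd f p s) (p + move_delta d)%R.
Proof.
case: t => l h r [/= Hh Hl Hr].
have E (z z' : int) : z = z' -> f z = f z' by move=> ->.
have U (z : int) : z <> p -> fupd f p s z = f z by rewrite /fupd; case: eqP.
have P : fupd f p s p = s by rewrite /fupd eqxx.
case: d => /=.
- case: l Hl => [|a l] Hl; split => [|i|i] /=.
  + rewrite U; last lia. by rewrite -[LHS](nth_nil None 0) Hl; apply: E; lia.
  + rewrite U; last lia. rewrite nth_nil.
    by rewrite -[LHS](nth_nil None i.+1) Hl; apply: E; lia.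
  + case: i => [|i] /=; last by rewrite Hr U; [apply: E|]; lia.
    by rewrite -[LHS]P; congr (fupd _ _ _); lia.
  + rewrite U; last lia. by have /= -> := Hl 0%N; apply: E; lia.
  + rewrite U; last lia. by have /= -> := Hl i.+1; apply: E; lia.
  + case: i => [|i] /=; last by rewrite Hr U; [apply: E|]; lia.
    by rewrite -[LHS]P; congr (fupd _ _ _); lia.
- case: r Hr => [|a r] Hr; split => [|i|i] /=.
  + rewrite U; last lia. by rewrite -[LHS](nth_nil None 0) Hr; apply: E; lia.
  + case: i => [|i] /=; last by rewrite Hl U; [apply: E|]; lia.
    by rewrite -[LHS]P; congr (fupd _ _ _); lia.
  + rewrite U; last lia. rewrite nth_nil.
    by rewrite -[LHS](nth_nil None i.+1) Hr; apply: E; lia.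
  + rewrite U; last lia. by have /= -> := Hr 0%N; apply: E; lia.
  + case: i => [|i] /=; last by rewrite Hl U; [apply: E|]; lia.
    by rewrite -[LHS]P; congr (fupd _ _ _); lia.
  + rewrite U; last lia. by have /= -> := Hr i.+1; apply: E; lia.
- rewrite addr0; split => [|i|i] /=; first by rewrite P.
  + by rewrite Hl U //; lia.
  + by rewrite Hr U //; lia.
Qed.

Definition wtape (x : seq bool) (z : int) : sym :=
  match z with Posz n => onth x n | Negz _ => None end.

Lemma onth_map_some (x : seq bool) i : nth None (map Some x) i = onth x i.
Proof. by elim: x i => [|b x IH] [|i] //=. Qed.

Lemma trep_init (M : TM) x : trep (init M x).2 (wtape x) 0.
Proof.
have L i : nth None [::] i = wtape x (0 - 1 - i%:Z)%R.
  by rewrite nth_nil; have -> : (0 - 1 - i%:Z)%R = Negz i by lia.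
have R i : wtape x (0 + 1 + i%:Z)%R = onth x i.+1.
  by have -> : (0 + 1 + i%:Z)%R = Posz i.+1 by lia.
case: x L R => [|b x] L R; split => // i; rewrite R /=.
  by rewrite nth_nil.
by rewrite onth_map_some.
Qed.

(** The index i = [size y], where [onth] gives [None], supplies the blank at which [read_word]
    stops. *)
Lemma read_word_output (M : TM) (c : config M) f p y : trep c.2 f p ->
  (forall i : nat, (i <= size y)%N -> f (p + i%:Z)%R = onth y i) ->
  output c = y.
Proof.
case: c => q [l h r] [/= Hh _ Hr] Hy; rewrite -[output _]/(read_word (h :: r)).
have {Hh Hr} : forall i, nth None (h :: r) i = f (p + i%:Z)%R.
  case=> [|i] /=; first by rewrite Hh; congr f; lia.
  by rewrite Hr; congr f; lia.
move: (h :: r) => s; elim: y s p Hy => [|b y IH] s p Hy Hs.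
  case: s Hs => //= a s /(_ 0%N) /=; rewrite Hy //=.
  by move=> ->.
have := Hs 0%N; rewrite Hy //; case: s Hs => //= a s Hs -> /=.
congr cons; apply: (IH s (p + 1)%R) => i.
  by move=> Hi; have := Hy i.+1 Hi => /= <-; congr f; lia.
by have /= -> := Hs i.+1; congr f; lia.
Qed.

(** * Machines with long moves *)

(* A transition may move the head by up to 8 cells; [true] means to the right. *)
Definition wdelta (Q : Type) := Q -> sym -> option (Q * sym * bool * nat).

Definition wshift (d : bool) (n : nat) : int := if d then Posz n else (- Posz n)%R.

Inductive wreach (Q : Type) (wd : wdelta Q) :
  nat -> Q -> (int -> sym) -> int -> Q -> (int -> sym) -> int -> Prop :=
| wreach0 q f p : wreach wd 0 q f p q f p
| wreachS n q f p q1 s d k q' f' p' :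
    wd q (f p) = Some (q1, s, d, k) ->
    wreach wd n q1 (fupd f p s) (p + wshift d k)%R q' f' p' ->
    wreach wd n.+1 q f p q' f' p'.

Lemma wreach_trans Q (wd : wdelta Q) n m q f p q1 f1 p1 q2 f2 p2 :
  wreach wd n q f p q1 f1 p1 -> wreach wd m q1 f1 p1 q2 f2 p2 ->
  wreach wd (n + m) q f p q2 f2 p2.
Proof.
elim=> // {q f p q1 f1 p1 n} n q f p q1 s d k q' f' p' H _ IH /IH.
exact: wreachS.
Qed.

Section Wide.
Variables (Q : finType) (q0 : Q) (wd : wdelta Q).
Hypothesis wdP : forall q s q' s' d n, wd q s = Some (q', s', d, n) -> n <= 8.

(** A state, the number of unit moves still due (at most 8, hence ['I_9]), and their direction. *)
Definition wstate : finType := (Q * 'I_9 * bool)%type.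
Definition wstart : wstate := (q0, ord0, false).
(** Machines start in [ord0], so [wstart] is sent there and all other states are shifted up by
    one. *)
Definition wenc (s : wstate) : 'I_#|wstate|.+1 :=
  if s == wstart then ord0 else lift ord0 (enum_rank s).
Definition wdec (i : 'I_#|wstate|.+1) : wstate :=
  if unlift ord0 i is Some j then enum_val j else wstart.

Lemma wencK : cancel wenc wdec.
Proof.
move=> s; rewrite /wenc /wdec; case: eqP => [->|_]; first by rewrite unlift_none.
by rewrite liftK enum_rankK.
Qed.

Definition wideTM : TM := @MkTM #|wstate| (fun i s =>
  let: (q, r, d) := wdec i in
  if r == 0 :> nat then
    match wd q s with
    | None => None
    | Some (q', s', d', n) =>
        Some (wenc (q', inord n.-1, d'), s',
              if n == 0 then Stay else if d' then MoveR else MoveL)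
    end
  else Some (wenc (q, inord r.-1, d), s, if d then MoveR else MoveL)).

Definition wrep (c : config wideTM) q f p :=
  trep c.2 f p /\ exists d, wdec c.1 = (q, ord0, d).

Lemma wrep_init x : wrep (init wideTM x) q0 (wtape x) 0.
Proof.
split; first exact: trep_init.
by exists false; rewrite /wdec unlift_none.
Qed.

Lemma wide_move (c : config wideTM) q d k f p : k <= 8 -> trep c.2 f p ->
  wdec c.1 = (q, inord k, d) ->
  exists t, t <= 8 /\ wrep (run t c) q f (p + wshift d k)%R.
Proof.
move=> k8 Hc Hd.
suff: exists t, t <= k /\ wrep (run t c) q f (p + wshift d k)%R.
  by case=> t [Ht H]; exists t; split => //; apply: leq_trans Ht _.
elim: k k8 c p Hc Hd => [|k IH] k8 c p Hc Hd.
  exists 0; split => //; split => /=; first by case: d {Hd}; rewrite /wshift ?oppr0 addr0.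
  exists d; rewrite Hd; congr (_, _, _); apply: val_inj; by rewrite /= inordK.
have Hc' : trep (step c).2 f (p + wshift d 1)%R.
  case: c Hc Hd => i tp /= Hc Hd; rewrite /step /= Hd inordK //=.
  have Hh : thead tp = f p by case: Hc.
  rewrite -[f](fupd_id f p) -Hh.
  by case: d {IH} Hd => Hd; [apply: (trep_move _ MoveR)|apply: (trep_move _ MoveL)].
have Hd' : wdec (step c).1 = (q, inord k, d).
  case: c {Hc Hc'} Hd => i tp /= Hd; rewrite /step /= Hd inordK //=.
  by rewrite wencK.
have [t [Ht Hw]] := IH (ltnW k8) _ _ Hc' Hd'.
exists t.+1; split => //; rewrite /run iterSr -/(run t (step c)).
move: Hw; congr wrep; rewrite -addrA; congr (_ + _)%R.
by rewrite /wshift; case: (d); lia.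
Qed.

(** A wide transition costs one step and at most eight further unit moves, hence the factor 9. *)
Lemma wide_reach n q f p q' f' p' (c : config wideTM) :
  wreach wd n q f p q' f' p' -> wrep c q f p ->
  exists t, t <= 9 * n /\ wrep (run t c) q' f' p'.
Proof.
move=> H; elim: H c => {n q f p q' f' p'} [q f p|n q f p q1 s d k q' f' p' Hs _ IH] c Hc.
  by exists 0.
have k8 := wdP Hs.
case: Hc => Ht [d0 Hd].
have Hh : thead c.2 = f p by case: Ht.
have [t [t8 Hw]]: exists t, t <= 9 /\ wrep (run t c) q1 (fupd f p s) (p + wshift d k)%R.
  have Hst : wdec (step c).1 = (q1, inord k.-1, d).
    by rewrite /step /= Hd /= Hh Hs /= wencK.
  have Htt : (step c).2 = move_tape (if k == 0 then Stay else if d then MoveR else MoveL) (write s c.2).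
    by rewrite /step /= Hd /= Hh Hs.
  have := trep_move s (if k == 0 then Stay else if d then MoveR else MoveL) Ht.
  rewrite -Htt => Ht'.
  have [|t [t8 Hw]] := wide_move _ Ht' Hst; first by lia.
  exists t.+1; split => //; rewrite /run iterSr -/(run t (step c)).
  move: Hw; congr wrep; rewrite -addrA; congr (_ + _)%R.
  by rewrite /wshift; case: (k) => [|k']; case: (d) => /=; lia.
have [t' [Ht' Hw']] := IH _ Hw.
exists (t' + t); split; first by lia.
by rewrite /run iterD -/(run t c).
Qed.

Lemma wide_halted (c : config wideTM) q f p :
  wrep c q f p -> wd q (f p) = None -> halted c.
Proof.
move=> [Ht [d Hd]] Hn; rewrite /halted /= Hd /=.
by have -> : thead c.2 = f p by [case: Ht]; rewrite Hn.
Qed.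
End Wide.

(** * Stack machines *)

(** [Main] is the evaluation stack of serialized trees, [Save] holds trees put aside, [Tmp] reversed
    bits in transit, [Cnt] a unary counter or loop flag, [IO] the input and later the output. *)
Inductive stack := Main | Save | Tmp | Cnt | IO.

Record store := Store { sMain : seq bool; sSave : seq bool; sTmp : seq bool;
  sCnt : seq bool; sIO : seq bool }.

Definition get (k : stack) (s : store) : seq bool :=
  match k with Main => sMain s | Save => sSave s | Tmp => sTmp s
  | Cnt => sCnt s | IO => sIO s end.

Definition put (k : stack) (v : seq bool) (s : store) : store :=
  let: Store m a t c i := s in
  match k with
  | Main => Store v a t c i | Save => Store m v t c i | Tmp => Store m a v c i
  | Cnt => Store m a t v i | IO => Store m a t c v
  end.

Inductive cmd :=
| Skip
| Push (k : stack) (b : bool)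
| Seq (c d : cmd)
| Pop (k : stack) (cT cF cE : cmd)
| Loop (k : stack) (cT cF : cmd).

(* [Pop] branches on the popped bit, its last branch being taken on an empty
   stack; [Loop] pops and branches until the stack is empty. *)
Inductive exec : cmd -> store -> store -> nat -> Prop :=
| exec_skip s : exec Skip s s 0
| exec_push k b s : exec (Push k b) s (put k (b :: get k s) s) 1
| exec_seq c d s1 s2 s3 n m : exec c s1 s2 n -> exec d s2 s3 m ->
    exec (Seq c d) s1 s3 (n + m)
| exec_popT k cT cF cE s s' r n : get k s = true :: r ->
    exec cT (put k r s) s' n -> exec (Pop k cT cF cE) s s' n.+2
| exec_popF k cT cF cE s s' r n : get k s = false :: r ->
    exec cF (put k r s) s' n -> exec (Pop k cT cF cE) s s' n.+2
| exec_popE k cT cF cE s s' n : get k s = [::] ->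
    exec cE s s' n -> exec (Pop k cT cF cE) s s' n.+2
| exec_loopT k cT cF s s' s'' r n m : get k s = true :: r ->
    exec cT (put k r s) s' n -> exec (Loop k cT cF) s' s'' m ->
    exec (Loop k cT cF) s s'' (n.+2 + m)
| exec_loopF k cT cF s s' s'' r n m : get k s = false :: r ->
    exec cF (put k r s) s' n -> exec (Loop k cT cF) s' s'' m ->
    exec (Loop k cT cF) s s'' (n.+2 + m)
| exec_loopE k cT cF s : get k s = [::] -> exec (Loop k cT cF) s s 1.

Inductive instr :=
| IPush (k : stack) (b : bool)
| IPop (k : stack) (tT tF tE : nat)
| IJmp (t : nat).

Definition fstep (code : seq instr) (c : nat * store) : nat * store :=
  match onth code c.1 with
  | None => c
  | Some (IPush k b) => (c.1.+1, put k (b :: get k c.2) c.2)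
  | Some (IPop k tT tF tE) =>
      match get k c.2 with
      | [::] => (tE, c.2)
      | b :: r => (if b then tT else tF, put k r c.2)
      end
  | Some (IJmp t) => (t, c.2)
  end.

Fixpoint clen (c : cmd) : nat :=
  match c with
  | Skip => 0
  | Push _ _ => 1
  | Seq c d => clen c + clen d
  | Pop _ cT cF cE => (clen cT).+1 + (clen cF).+1 + (clen cE).+2
  | Loop _ cT cF => (clen cT).+1 + (clen cF).+2
  end.

Fixpoint compile (c : cmd) (a : nat) : seq instr :=
  match c with
  | Skip => [::]
  | Push k b => [:: IPush k b]
  | Seq c d => compile c a ++ compile d (a + clen c)
  | Pop k cT cF cE =>
      let aT := a.+1 in
      let aF := aT + (clen cT).+1 in
      let aE := aF + (clen cF).+1 in
      let e := aE + (clen cE).+1 in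
      IPop k aT aF aE :: compile cT aT ++ IJmp e :: compile cF aF ++
      IJmp e :: compile cE aE ++ [:: IJmp e]
  | Loop k cT cF =>
      let aT := a.+1 in
      let aF := aT + (clen cT).+1 in
      let e := aF + (clen cF).+1 in
      IPop k aT aF e :: compile cT aT ++ IJmp a :: compile cF aF ++ [:: IJmp a]
  end.

Lemma size_compile c a : size (compile c a) = clen c.
Proof.
elim: c a => //= [c IHc d IHd|k cT IHT cF IHF cE IHE|k cT IHT cF IHF] a;
  rewrite ?size_cat /= ?size_cat /= ?size_cat /= ?IHc ?IHd ?IHT ?IHF ?IHE //; lia.
Qed.

Fixpoint code_at (code : seq instr) (a : nat) (l : seq instr) : Prop :=
  if l is i :: l' then onth code a = Some i /\ code_at code a.+1 l' else True.

Lemma code_at_cat code a l1 l2 :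
  code_at code a (l1 ++ l2) <-> code_at code a l1 /\ code_at code (a + size l1) l2.
Proof.
elim: l1 a => [|i l IH] a /=; first by rewrite addn0; tauto.
by rewrite IH addSnnS; tauto.
Qed.

Lemma code_at_self l : code_at l 0 l.
Proof.
suff H l1 l2 : code_at (l1 ++ l2) (size l1) l2 by have := H [::] l.
elim: l2 l1 => [|i l2 IH] l1 //=; split.
  by elim: l1.
by rewrite -cat_rcons -(size_rcons l1 i); apply: IH.
Qed.

Lemma fstep_jmp code a s t : onth code a = Some (IJmp t) ->
  fstep code (a, s) = (t, s).
Proof. by rewrite /fstep => ->. Qed.

(** The cost index of [exec] counts flat steps exactly: a branch taken pays two for the pop and the
    closing jump, the end of a loop pays one. So this is an equation, and the flat code needs no
    time analysis of its own. *)
Lemma compile_correct code c s s' n : exec c s s' n ->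
  forall a, code_at code a (compile c a) ->
  iter n (fstep code) (a, s) = (a + clen c, s').
Proof.
elim=> {c s s' n}.
- by move=> s a _; rewrite addn0.
- by move=> k b s a /= [Ha _]; rewrite /fstep /= Ha addn1.
- move=> c d s1 s2 s3 n m _ IH1 _ IH2 a /= /code_at_cat [H1 H2].
  rewrite size_compile in H2.
  by rewrite addnC iterD IH1 // IH2 ?addnA.
- move=> k cT cF cE s s' r n Hg _ IH a /= [Ha] /code_at_cat [H1 [H2 _]].
  have E : fstep code (a, s) = (a.+1, put k r s) by rewrite /fstep /= Ha Hg.
  rewrite size_compile in H2.
  by rewrite -iterS iterSr E IH // (fstep_jmp _ H2); congr pair; lia.
- move=> k cT cF cE s s' r n Hg _ IH a /= [Ha] /code_at_cat [H1 [H2]] /code_at_cat [H3 [H4 _]].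
  have E : fstep code (a, s) = (a.+1 + (clen cT).+1, put k r s).
    by rewrite /fstep /= Ha Hg.
  move: H3 H4; rewrite !size_compile -!addnS => H3 H4.
  by rewrite -iterS iterSr E IH // (fstep_jmp _ H4); congr pair; lia.
- move=> k cT cF cE s s' n Hg _ IH a /= [Ha] /code_at_cat [H1 [H2]] /code_at_cat [H3 [H4]] /code_at_cat [H5 [H6 _]].
  have E : fstep code (a, s) = (a.+1 + (clen cT).+1 + (clen cF).+1, s).
    by rewrite /fstep /= Ha Hg.
  move: H5 H6; rewrite !size_compile -!addnS => H5 H6.
  by rewrite -iterS iterSr E IH // (fstep_jmp _ H6); congr pair; lia.
- move=> k cT cF s s' s'' r n m Hg _ IH _ IH2 a Hc; case: (Hc) => Ha /code_at_cat [H1 [H2 _]].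
  rewrite size_compile in H2.
  have E : fstep code (a, s) = (a.+1, put k r s) by rewrite /fstep /= Ha Hg.
  rewrite addnC iterD (_ : iter n.+2 _ _ = (a, s')) ?IH2 //.
  by rewrite iterS iterSr E IH // (fstep_jmp _ H2).
- move=> k cT cF s s' s'' r n m Hg _ IH _ IH2 a Hc; case: (Hc) => Ha /code_at_cat [H1 [H2]] /code_at_cat [H3 [H4 _]].
  have E : fstep code (a, s) = (a.+1 + (clen cT).+1, put k r s).
    by rewrite /fstep /= Ha Hg.
  move: H3 H4; rewrite !size_compile -!addnS => H3 H4.
  rewrite addnC iterD (_ : iter n.+2 _ _ = (a, s')) ?IH2 //.
  by rewrite iterS iterSr E IH // (fstep_jmp _ H4).
- by move=> k cT cF s Hg a /= [Ha _]; rewrite /fstep /= Ha Hg; congr pair; lia.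
Qed.

(* Stack [k] occupies the cells [cell k h] with [h > 0], bottom first; the cell
   [cell k 0] stays blank. *)
Definition cell (k : stack) (h : nat) : int :=
  match k with
  | IO => h%:Z
  | Main => - 1 - 4 * h%:Z
  | Save => - 2 - 4 * h%:Z
  | Tmp => - 3 - 4 * h%:Z
  | Cnt => - 4 - 4 * h%:Z
  end%R.

Lemma cell_inj k h k' h' : cell k h = cell k' h' -> k = k' /\ h = h'.
Proof. by case: k k' => [] [] /= ?; split => //; lia. Qed.

Definition updir (k : stack) : bool := if k is IO then true else false.
Definition stride (k : stack) : nat := if k is IO then 1 else 4.
(** [enter] leads from 0 to the cell of height 1, [leave] from the blank cell of height 0 back to 0.
    The 8 for [Cnt] is the longest move that occurs. *)
Definition enter (k : stack) : nat :=
  match k with IO => 1 | Main => 5 | Save => 6 | Tmp => 7 | Cnt => 8 end.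
Definition leave (k : stack) : nat :=
  match k with IO => 0 | Main => 1 | Save => 2 | Tmp => 3 | Cnt => 4 end.

Definition srep (st : store) (f : int -> sym) : Prop :=
  forall k h, f (cell k h) = if h is h'.+1 then onth (rev (get k st)) h' else None.

Lemma get_put k k' v st : get k' (put k v st) =
  match k, k' with
  | Main, Main | Save, Save | Tmp, Tmp | Cnt, Cnt | IO, IO => v
  | _, _ => get k' st
  end.
Proof. by case: st; case: k; case: k'. Qed.

Lemma fupd_idN f p : f p = None -> fupd f p None = f.
Proof. by move=> E; rewrite -[RHS](fupd_id f p) E. Qed.

Lemma onth_rcons_neq (T : Type) (l : seq T) b h :
  h <> size l -> onth (rcons l b) h = onth l h.
Proof.
elim: l h => [|a l IH] [|h] //= Hn; first by case: h {Hn}.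
by apply: IH => E; apply: Hn; rewrite E.
Qed.

Lemma srep_push st f k b : srep st f ->
  srep (put k (b :: get k st) st) (fupd f (cell k (size (get k st)).+1) (Some b)).
Proof.
move=> Hf k' h; rewrite /fupd; case: eqP => [/cell_inj [-> ->]|Hn].
  have E : onth (rev (b :: get k st)) (size (get k st)) = Some b.
    by rewrite rev_cons -size_rev; elim: (rev _).
  by rewrite get_put -{}E; case: k.
rewrite Hf; case: h Hn => // h Hn; rewrite get_put.
have E : k' = k -> onth (rev (get k st)) h = onth (rev (b :: get k st)) h.
  move=> Hk; have : h <> size (rev (get k st)).
    by rewrite size_rev => Hh; apply: Hn; rewrite Hk Hh.
  by move=> ?; rewrite rev_cons onth_rcons_neq.
by case: k k' {Hn} E => [] [] E //; rewrite E.
Qed.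

Lemma srep_pop st f k b r : srep st f -> get k st = b :: r ->
  srep (put k r st) (fupd f (cell k (size r).+1) None).
Proof.
move=> Hf Hk k' h; rewrite /fupd; case: eqP => [/cell_inj [-> ->]|Hn].
  have E : onth (rev r) (size r) = None by rewrite -size_rev; elim: (rev _).
  by rewrite get_put -{}E; case: k {Hk}.
rewrite Hf; case: h Hn => // h Hn; rewrite get_put.
have E : k' = k -> onth (rev (get k st)) h = onth (rev r) h.
  move=> Hk'; have : h <> size (rev r).
    by rewrite size_rev => Hh; apply: Hn; rewrite Hk' Hh.
  by move=> ?; rewrite Hk rev_cons onth_rcons_neq.
by case: k k' {Hn Hk} E => [] [] E //; rewrite E.
Qed.

Lemma wreach_walk Q (wd : wdelta Q) q d n f j p :
  (forall b, wd q (Some b) = Some (q, Some b, d, n)) ->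
  (forall i, (i < j)%N -> f (p + i%:Z * wshift d n)%R <> None) ->
  wreach wd j q f p q f (p + j%:Z * wshift d n)%R.
Proof.
move=> Hw; elim: j p => [|j IH] p Hf.
  by rewrite mul0r addr0; apply: wreach0.
have := Hf 0%N isT; rewrite mul0r addr0; case E: (f p) => [b|] // _.
apply: (@wreachS _ _ _ _ _ _ q (Some b) d n); first by rewrite E.
rewrite -E fupd_id (_ : _ + _ = p + wshift d n + j%:Z * wshift d n)%R; last lia.
apply: IH => i Hi.
by rewrite -addrA -{1}[wshift d n]mul1r -mulrDl; apply: (Hf i.+1).
Qed.

(** * Stack code on a tape with long moves *)

Local Notation ph_start := (false, false, false).
Local Notation ph_up := (true, false, false).
Local Notation ph_back := (false, true, false).
Local Notation ph_look := (true, true, false).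
Local Notation ph_ret b := (b, false, true).
Local Notation ph_init := (false, true, true).
Local Notation ph_fin := (true, true, true).

Section StackMachine.
Variable code : seq instr.
Let P := size code.

Let phase : finType := (bool * bool * bool)%type.
Let Q : finType := ('I_P.+1 * phase)%type.

(** All addresses past the end are identified with [P], where no instruction stands; this makes the
    state set finite. *)
Definition pcst (t : nat) : 'I_P.+1 := inord (minn t P).

(** Every instruction starts and ends with the head at 0: [ph_up] runs to the first blank above the
    stack, the top is written or erased there, and the way back ends at the blank cell of height 0.
    A popped bit is remembered in the phase [ph_ret]. The bottom of [IO] is in cell 1, so [ph_init]
    steps left from the first input letter, and the step into [ph_fin] goes right onto the first
    output letter. *)
Definition smdelta : wdelta Q := fun q s =>
  let: (pc, ph) := q in
  if ph == ph_init then Some ((pc, ph_start), s, false, 1) else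
  match onth code pc with
  | None => if ph == ph_start then Some ((pc, ph_fin), s, true, 1) else None
  | Some (IJmp t) => Some ((pcst t, ph_start), s, true, 0)
  | Some (IPush k b) =>
      match ph with
      | ph_start => Some ((pc, ph_up), s, updir k, enter k)
      | ph_up => if s is Some _ then Some (q, s, updir k, stride k)
                 else Some ((pc, ph_back), Some b, ~~ updir k, stride k)
      | _ => if s is Some _ then Some (q, s, ~~ updir k, stride k)
             else Some ((pcst pc.+1, ph_start), s, true, leave k)
      end
  | Some (IPop k tT tF tE) =>
      match ph with
      | ph_start => Some ((pc, ph_up), s, updir k, enter k)
      | ph_up => if s is Some _ then Some (q, s, updir k, stride k)
                 else Some ((pc, ph_look), s, ~~ updir k, stride k)
      | ph_look => if s is Some b then Some ((pc, ph_ret b), None, ~~ updir k, stride k)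
                   else Some ((pcst tE, ph_start), s, true, leave k)
      | (b, _, _) => if s is Some _ then Some (q, s, ~~ updir k, stride k)
                     else Some ((pcst (if b then tT else tF), ph_start), s, true, leave k)
      end
  end.

Lemma smdelta_bound q s q' s' d n : smdelta q s = Some (q', s', d, n) -> n <= 8.
Proof.
case: q => pc [[a b] c]; rewrite /smdelta.
case: eqP => _; first by case=> _ _ _ <-.
case: (onth code pc) => [[k v|k tT tF tE|t]|].
- by case: a b c => [] [] []; case: s => [?|] [_ _ _ <-]; case: k.
- by case: a b c => [] [] []; case: s => [?|] [_ _ _ <-]; case: k.
- by case=> _ _ _ <-.
- by case: eqP => // _ [_ _ _ <-].
Qed.

Lemma pcstK t : onth code (pcst t) = onth code t.
Proof.
rewrite /pcst inordK; last by rewrite ltnS geq_minr.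
case: (leqP t P) => // /ltnW; rewrite /P.
by elim: (code) t => [|i l IH] [|t] //=; exact: IH.
Qed.

Lemma pcstS t i : onth code t = Some i -> pcst (pcst t).+1 = pcst t.+1.
Proof.
move=> H; have Ht : t < P.
  by rewrite /P; elim: (code) t H => [|j l IH] [|t] //= /IH.
by congr pcst; rewrite /pcst inordK ?ltnS ?geq_minr // (minn_idPl (ltnW Ht)).
Qed.

Lemma up_shift k h n : (cell k h + n%:Z * wshift (updir k) (stride k))%R = cell k (h + n).
Proof. by case: k => /=; rewrite /wshift /=; lia. Qed.

Lemma down_shift k h n : n <= h ->
  (cell k h + n%:Z * wshift (~~ updir k) (stride k))%R = cell k (h - n).
Proof. by move=> ?; case: k => /=; rewrite /wshift /=; lia. Qed.

Lemma down_shift1 k h :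
  (cell k h.+1 + wshift (~~ updir k) (stride k))%R = cell k h.
Proof. by case: k => /=; rewrite /wshift /=; lia. Qed.

Lemma enter_shift k : (0 + wshift (updir k) (enter k))%R = cell k 1.
Proof. by case: k => /=; rewrite /wshift /=; lia. Qed.

Lemma leave_shift k : (cell k 0 + wshift true (leave k))%R = 0%R.
Proof. by case: k => /=; rewrite /wshift /=; lia. Qed.

Lemma up_reach pc k f st : srep st f ->
  smdelta (pc, ph_start) (f 0%R) = Some ((pc, ph_up), f 0%R, updir k, enter k) ->
  (forall b, smdelta (pc, ph_up) (Some b) = Some ((pc, ph_up), Some b, updir k, stride k)) ->
  wreach smdelta (size (get k st)).+1 (pc, ph_start) f 0%R
    (pc, ph_up) f (cell k (size (get k st)).+1).
Proof.
move=> Hf H0 Hu; apply: (wreachS H0); rewrite fupd_id enter_shift.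
have <- := up_shift k 1 (size (get k st)).
apply: wreach_walk => // i Hi; rewrite up_shift add1n Hf.
by rewrite -size_rev in Hi; elim: (rev _) i Hi => [|b l IH] [|i] //= /IH.
Qed.

Lemma down_reach q k f h t : f (cell k 0) = None ->
  (forall i, (0 < i <= h)%N -> f (cell k i) <> None) ->
  (forall b, smdelta q (Some b) = Some (q, Some b, ~~ updir k, stride k)) ->
  smdelta q None = Some ((pcst t, ph_start), None, true, leave k) ->
  wreach smdelta h.+1 q f (cell k h) (pcst t, ph_start) f 0%R.
Proof.
move=> H0 Hf Hd He; rewrite -addn1; apply: (@wreach_trans _ _ _ _ _ _ _ q f (cell k 0)).
  rewrite -[in cell k 0](subnn h) -down_shift //; apply: wreach_walk => // i Hi.
  by rewrite down_shift ?(ltnW Hi) //; apply: Hf; lia.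
apply: (wreachS (q1 := (pcst t, ph_start)) (s := None) (d := true) (k := leave k)).
  by rewrite H0.
by rewrite leave_shift -H0 fupd_id; apply: wreach0.
Qed.

Lemma srep_some st f k i : srep st f -> (0 < i <= size (get k st))%N ->
  f (cell k i) <> None.
Proof.
move=> Hf; rewrite Hf; case: i => // i /andP [_].
by rewrite -size_rev; elim: (rev _) i => [|b l IH] [|i] //= /IH.
Qed.

Lemma fstep_sim m pc st f i : srep st f -> onth code pc = Some i ->
  (forall k, size (get k st) <= m) ->
  exists N f', [/\ N <= 2 * m + 4, srep (fstep code (pc, st)).2 f' &
    wreach smdelta N (pcst pc, ph_start) f 0%R
      (pcst (fstep code (pc, st)).1, ph_start) f' 0%R].
Proof.
move=> Hf Hi Hm; have Hi' := Hi; rewrite -pcstK in Hi'; rewrite /fstep [(pc, st).1]/= Hi.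
case: i Hi Hi' => [k b|k tT tF tE|t] Hi Hi' /=.
- have Hmk := Hm k.
  exists (((size (get k st)).+1 + 1) + (size (get k st)).+1), (fupd f (cell k (size (get k st)).+1) (Some b)).
  split; [lia|exact: srep_push|].
  apply: wreach_trans; [apply: wreach_trans|].
  + by apply: up_reach => //; rewrite /smdelta /= Hi'.
  + apply: wreachS; last exact: wreach0.
    rewrite Hf -size_rev /smdelta /= Hi'.
    by rewrite (_ : onth _ _ = None) //; elim: (rev _).
  + rewrite -(pcstS Hi) down_shift1.
    apply: down_reach => [||b'|]; rewrite ?/smdelta /= ?Hi' //.
      by rewrite /fupd; case: eqP => [/cell_inj []|_] //; rewrite Hf.
    move=> j Hj; rewrite /fupd; case: eqP => // _.
    exact: srep_some Hf Hj.
- have Hmk := Hm k.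
  case Hg: (get k st) => [|b r] /=.
    exists (((size (get k st)).+1 + 1) + 1), f; split; [by rewrite Hg /=; lia|by []|].
    apply: wreach_trans; [apply: wreach_trans|].
    + by apply: (up_reach (k := k)) => //; rewrite /smdelta /= Hi'.
    + apply: wreachS; last exact: wreach0.
      by rewrite Hg Hf Hg /smdelta /= Hi'.
    + rewrite Hg down_shift1 fupd_idN; last by rewrite Hf Hg.
      apply: (wreachS (s := None) (d := true) (k := leave k)).
        by rewrite Hf /smdelta /= Hi'.
      by rewrite leave_shift fupd_idN ?Hf //; apply: wreach0.
  have Etop : f (cell k (size (get k st)).+1) = None.
    by rewrite Hf -size_rev; elim: (rev _).
  exists (((size (get k st)).+1 + 1 + 1) + (size r).+1), (fupd f (cell k (size r).+1) None).
  split; [by move: Hmk; rewrite Hg /=; lia|exact: srep_pop Hg|].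
  apply: wreach_trans; [apply: wreach_trans; [apply: wreach_trans|]|].
  + by apply: (up_reach (k := k)) => //; rewrite /smdelta /= Hi'.
  + apply: wreachS; last exact: wreach0.
    rewrite Hf -[X in onth _ X](size_rev (get k st)) /smdelta /= Hi'.
    by rewrite (_ : onth _ _ = None) //; elim: (rev _).
  + apply: wreachS; last exact: wreach0.
    rewrite (fupd_idN Etop) down_shift1 Hg (_ : f _ = Some b).
      by rewrite /smdelta /= Hi'.
    by rewrite Hf Hg /= rev_cons -(size_rev r); elim: (rev r).
  + rewrite (fupd_idN Etop) !down_shift1 Hg /= ?down_shift1.
    apply: down_reach => [||b'|]; rewrite ?/smdelta /= ?Hi' //; try by case: (b).
      by rewrite /fupd; case: eqP => [/cell_inj []|_] //; rewrite Hf.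
    move=> j Hj; rewrite /fupd; case: eqP => [/cell_inj [_]|_]; first lia.
    by apply: (srep_some Hf); rewrite Hg /=; lia.
- exists 1, f; split => //; first lia.
  apply: wreachS; first by rewrite /smdelta /= Hi'.
  by rewrite fupd_id /wshift addr0; apply: wreach0.
Qed.

Lemma size_fstep c m : (forall k, size (get k c.2) <= m) ->
  forall k, size (get k (fstep code c).2) <= m.+1.
Proof.
move=> Hm k; rewrite /fstep; case: (onth code c.1) => [[k' b|k' tT tF tE|t]|] /=;
  try exact: leqW.
- by rewrite get_put; move: (Hm k); case: k' k => [] [] Hk; rewrite /= ?ltnS //; apply: leqW.
- have := Hm k'; case Hg: (get k' c.2) => [|b r] /= Hr; first exact: leqW.
  by rewrite get_put; move: (Hm k) Hr; case: k' k {Hg} => [] [] /=; lia.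
Qed.

(** A flat step raises a stack by at most one, so every sweep has length at most about m + n; hence
    the quadratic cost. *)
Lemma flat_sim n m c f : srep c.2 f -> (forall k, size (get k c.2) <= m) ->
  exists N f', [/\ N <= n * (2 * (m + n) + 4), srep (iter n (fstep code) c).2 f' &
    wreach smdelta N (pcst c.1, ph_start) f 0%R
      (pcst (iter n (fstep code) c).1, ph_start) f' 0%R].
Proof.
elim: n m c f => [|n IH] m c f Hf Hm.
  by exists 0, f; split => //; apply: wreach0.
case Hi: (onth code c.1) => [i|]; last first.
  have E j : iter j (fstep code) c = c.
    by elim: j => //= j ->; rewrite /fstep Hi.
  by rewrite E; exists 0, f; split => //; apply: wreach0.
case: c Hf Hm Hi => pc st /= Hf Hm Hi.
have [N [f1 [HN Hf1 H1]]] := fstep_sim Hf Hi Hm.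
have Hm1 := size_fstep (c := (pc, st)) Hm.
have [N' [f' [HN' Hf' H']]] := IH _ _ _ Hf1 Hm1.
exists (N + N'), f'; rewrite -iterS iterSr; split => //; last exact: wreach_trans H1 H'.
by move: HN HN'; nia.
Qed.
End StackMachine.

(** * From stack programs to the class [FP] *)

Lemma trep_shift t f p d : trep t f p -> trep t (fun z => f (z - d)%R) (p + d)%R.
Proof.
case=> Hh Hl Hr; split=> [|i|i]; first by rewrite Hh addrK.
  by rewrite Hl; congr f; lia.
by rewrite Hr; congr f; lia.
Qed.

(** On the tape [IO] lies bottom first, so a word written from left to right is a stack whose top is
    its last letter: hence [rev] on both sides. *)
Definition cmd_computes (c : cmd) (f : seq bool -> seq bool) (e : nat) : Prop :=
  forall x, exists s' t, [/\ t <= (size x + 2) ^ e,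
    exec c (Store [::] [::] [::] [::] (rev x)) s' t & sIO s' = rev (f x)].

Lemma leq_expl m n e : m <= n -> m ^ e <= n ^ e.
Proof. by case: e => // e; rewrite leq_exp2r. Qed.

(** Bounds have the form (n + 2)^e because a base of at least 2 absorbs any constant factor into the
    exponent. *)
Lemma leq_exp_bound C n k e : C <= 2 ^ k -> C * (n + 2) ^ e <= (n + 2) ^ (e + k).
Proof.
move=> HC; rewrite expnD mulnC leq_mul2l; apply/orP; right.
by apply: leq_trans HC _; apply: leq_expl; lia.
Qed.

(** For n > 0 use n + 2 <= 3n; for n = 0 the additive constant alone has to dominate 2^e. The same
    number must also be an exponent of at least e. *)
Lemma leq_poly_bound e n : (n + 2) ^ e <= poly_bound (3 ^ e.+1) n.
Proof.
have He : e <= 3 ^ e.+1 by apply: leq_trans (ltnW (ltn_expl e.+1 (isT : 1 < 3))).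
rewrite /poly_bound; case: n => [|n].
  rewrite add0n exp0n ?expn_gt0 // muln0 add0n.
  by apply: leq_trans (leq_expl _ (isT : 2 <= 3)) _; rewrite leq_pexp2l.
apply: leq_trans (leq_addr _ _).
apply: (@leq_trans ((3 * n.+1) ^ e)); first by apply: leq_expl; lia.
by rewrite expnMn leq_mul ?leq_pexp2l.
Qed.

Lemma cmd_FP c f e : cmd_computes c f e -> FP f.
Proof.
move=> Hc; pose code := compile c 0.
pose q0 : 'I_(size code).+1 * (bool * bool * bool) := (ord0, ph_init).
(* With X = [size x] + 2, the stacks have height at most 2 X^(e+1) during X^e flat steps, which
   gives at most 108 X^(2e+1) steps; and 108 <= 2^7. *)
pose e' := e.+1 + e + 7.
exists (wideTM q0 (smdelta (code := code))), (3 ^ e'.+1) => x.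
have [s' [t [Ht Hex Hio]]] := Hc x.
pose f1 (z : int) : sym := wtape x (z - 1)%R.
have Hf1 : srep (Store [::] [::] [::] [::] (rev x)) f1.
  have Hneg z : (z < 0)%R -> wtape x z = None by case: z.
  have N h : onth (rev [::] : seq bool) h = None by case: h.
  case=> [] [|h]; rewrite /f1 /get /= ?N //; try by rewrite Hneg //; lia.
  by rewrite revK subn1.
have Hsz k : size (get k (Store [::] [::] [::] [::] (rev x))) <= size x.
  by case: k => //=; rewrite size_rev.
have [N [f' [HN Hf' HR]]] := @flat_sim code t _ (0, _) f1 Hf1 Hsz.
rewrite (compile_correct Hex (code_at_self code)) add0n /= in Hf' HR.
have Hend : onth code (clen c) = None.
  by rewrite -(size_compile c 0) -/code; elim: (code).
have Hlast : wreach (smdelta (code := code)) (1 + (N + 1)) q0 f1 1%R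
    (pcst code (clen c), ph_fin) f' 1%R.
  apply: wreach_trans; last apply: wreach_trans HR _.
    apply: wreachS; first by rewrite /smdelta.
    rewrite fupd_id (_ : (1 + _)%R = 0%R) //.
    rewrite (_ : (ord0, _) = (pcst code 0, ph_start)); first exact: wreach0.
    by congr pair; apply: val_inj; rewrite /pcst min0n /= inordK.
  apply: wreachS; first by rewrite /smdelta /= pcstK Hend.
  by rewrite fupd_id (_ : (0 + _)%R = 1%R) //; apply: wreach0.
have Hi : wrep (init (wideTM q0 (smdelta (code := code))) x) q0 f1 1%R.
  have [Htr Hd] := wrep_init q0 (smdelta (code := code)) x; split => //.
  by have := trep_shift 1 Htr; rewrite add0r.
have [T [HT Hw]] := wide_reach (@smdelta_bound code) Hlast Hi.
exists T; split; last split.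
- apply: leq_trans HT _; apply: leq_trans (leq_poly_bound _ _).
  pose X := size x + 2; rewrite -/X in Ht *.
  have HX : size x <= X ^ e.+1.
    apply: leq_trans (_ : X <= _); first by rewrite /X leq_addr.
    by rewrite -{1}[X]expn1 leq_pexp2l // /X addn2.
  have HX1 : X ^ e <= X ^ e.+1 by rewrite leq_pexp2l // /X addn2.
  have HX2 : 0 < X ^ e by rewrite expn_gt0 /X addn2.
  apply: (@leq_trans (108 * (X ^ e.+1 * X ^ e))).
    apply: (@leq_trans (9 * (X ^ e * (2 * (X ^ e.+1 + X ^ e.+1) + 4) + 2))).
      rewrite leq_mul2l /= !addnA add1n; have := leq_mul Ht (leqnn (2 * (size x + t) + 4)).
      have : X ^ e * (2 * (size x + t) + 4) <= X ^ e * (2 * (X ^ e.+1 + X ^ e.+1) + 4).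
        by rewrite leq_mul2l; apply/orP; right; lia.
      lia.
    move: HX1 HX2; move: (X ^ e) (X ^ e.+1) => a b; nia.
  rewrite -expnD /e' /X; apply: leq_exp_bound; lia.
- apply: (wide_halted Hw); first by rewrite /smdelta /= pcstK Hend.
- apply: (read_word_output Hw.1) => i _.
  by have := Hf' IO i.+1; rewrite /= Hio revK => <-; congr f'; lia.
Qed.

(** * Polynomial-time functions on trees *)

Inductive tree := Leaf | Node (l r : tree).

(* In prefix notation, consing two serialized trees is pushing one bit. *)
Fixpoint ser (t : tree) : seq bool :=
  match t with Leaf => [:: false] | Node l r => true :: ser l ++ ser r end.

Definition ex (c : cmd) (s s' : store) (n : nat) : Prop :=
  exists2 t, exec c s s' t & t <= n.

Lemma ex_le c s s' n m : n <= m -> ex c s s' n -> ex c s s' m.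
Proof. by move=> Hn [t H Ht]; exists t => //; apply: leq_trans Hn. Qed.

Lemma ex_seq c d s1 s2 s3 n m : ex c s1 s2 n -> ex d s2 s3 m ->
  ex (Seq c d) s1 s3 (n + m).
Proof.
move=> [t H Ht] [t' H' Ht']; exists (t + t'); last exact: leq_add.
exact: exec_seq H H'.
Qed.

Lemma ex_push k b s : ex (Push k b) s (put k (b :: get k s) s) 1.
Proof. by exists 1 => //; apply: exec_push. Qed.

Lemma ex_skip s : ex Skip s s 0.
Proof. by exists 0 => //; apply: exec_skip. Qed.

Lemma ex_popT k cT cF cE s s' r n : get k s = true :: r ->
  ex cT (put k r s) s' n -> ex (Pop k cT cF cE) s s' n.+2.
Proof. by move=> Hg [t H Ht]; exists t.+2 => //; apply: exec_popT Hg H. Qed.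

Lemma ex_popF k cT cF cE s s' r n : get k s = false :: r ->
  ex cF (put k r s) s' n -> ex (Pop k cT cF cE) s s' n.+2.
Proof. by move=> Hg [t H Ht]; exists t.+2 => //; apply: exec_popF Hg H. Qed.

Lemma ex_loopT k cT cF s s' s'' r n m : get k s = true :: r ->
  ex cT (put k r s) s' n -> ex (Loop k cT cF) s' s'' m ->
  ex (Loop k cT cF) s s'' (n.+2 + m).
Proof.
move=> Hg [t H Ht] [t' H' Ht']; exists (t.+2 + t'); last by apply: leq_add.
exact: exec_loopT Hg H H'.
Qed.

Lemma ex_loopF k cT cF s s' s'' r n m : get k s = false :: r ->
  ex cF (put k r s) s' n -> ex (Loop k cT cF) s' s'' m ->
  ex (Loop k cT cF) s s'' (n.+2 + m).
Proof.
move=> Hg [t H Ht] [t' H' Ht']; exists (t.+2 + t'); last by apply: leq_add.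
exact: exec_loopF Hg H H'.
Qed.

Lemma ex_loopE k cT cF s : get k s = [::] -> ex (Loop k cT cF) s s 1.
Proof. by move=> Hg; exists 1 => //; apply: exec_loopE. Qed.

Definition src (k : bool) : stack := if k then Main else Save.

Definition St (k : bool) (x y t c r : seq bool) : store :=
  if k then Store x y t c r else Store y x t c r.

(* Cnt holds, in unary, the number of trees still to be read. *)
Definition scan_body (k : bool) : cmd :=
  Pop (src k) (Seq (Seq (Push Cnt true) (Push Cnt true)) (Push Tmp true))
              (Push Tmp false) Skip.

Definition scan (k : bool) : cmd :=
  Seq (Push Cnt true) (Loop Cnt (scan_body k) Skip).

(** Stated for a forest, since after a node bit the unread word is a forest with one more tree. A
    node bit costs most: five for the body, two for the loop. *)
Lemma scan_loop k ts x y t r :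
  ex (Loop Cnt (scan_body k) Skip)
    (St k (flatten (map ser ts) ++ x) y t (nseq (size ts) true) r)
    (St k x y (rev (flatten (map ser ts)) ++ t) [::] r)
    (7 * size (flatten (map ser ts)) + 1).
Proof.
have [n] := ubnP (size (flatten (map ser ts))).
elim: n ts t => // n IH [|[|a b] ts] t Hn /=.
- by apply: ex_loopE; case: (k).
- apply: ex_le (_ : 3.+2 + (7 * size (flatten (map ser ts)) + 1) <= _) _; first lia.
  apply: (@ex_loopT _ _ _ _ (St k (flatten (map ser ts) ++ x) y (false :: t) (nseq (size ts) true) r) _ (nseq (size ts) true)); first by case: (k).
    rewrite /scan_body.
    apply: (@ex_popF _ _ _ _ _ _ (flatten (map ser ts) ++ x)); first by case: (k).
    by case: (k); apply: ex_push.
  rewrite rev_cons cat_rcons; apply: IH.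
  by move: Hn => /=; lia.
- rewrite -!catA; have := IH [:: a, b & ts] (true :: t); rewrite /= -!catA => {}IH.
  apply: ex_le (_ : 5.+2 + (7 * size (ser a ++ ser b ++ flatten (map ser ts)) + 1) <= _) _; first by rewrite /= !size_cat; lia.
  apply: (@ex_loopT _ _ _ _ (St k (ser a ++ ser b ++ flatten (map ser ts) ++ x) y (true :: t) (nseq (size ts).+2 true) r) _ (nseq (size ts) true)); first by case: (k).
    rewrite /scan_body.
    apply: (@ex_popT _ _ _ _ _ _ (ser a ++ ser b ++ flatten (map ser ts) ++ x)); first by case: (k).
    by clear IH; case: (k); exact: (ex_seq (ex_seq (ex_push _ _ _) (ex_push _ _ _)) (ex_push _ _ _)).
  rewrite rev_cons cat_rcons; apply: IH.
  by move: Hn => /=; rewrite !size_cat; lia.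
Qed.

Lemma ex_scan k t x y r :
  ex (scan k) (St k (ser t ++ x) y [::] [::] r)
    (St k x y (rev (ser t)) [::] r) (7 * size (ser t) + 2).
Proof.
have := scan_loop k [:: t] x y [::] r; rewrite /= !cats0 => H.
apply: ex_le (ex_seq (ex_push Cnt true _) _); last by case: (k) H => H; apply: H.
by lia.
Qed.

Definition move_tree (k : bool) : cmd :=
  Seq (scan k) (Loop Tmp (Push (src (~~ k)) true) (Push (src (~~ k)) false)).

Definition drop_tree (k : bool) : cmd := Seq (scan k) (Loop Tmp Skip Skip).

Definition copy_tree : cmd :=
  Seq (scan true) (Loop Tmp (Seq (Push Main true) (Push Save true))
                            (Seq (Push Main false) (Push Save false))).

Lemma ex_move_tree k t x y r :
  ex (move_tree k) (St k (ser t ++ x) y [::] [::] r)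
    (St k x (ser t ++ y) [::] [::] r) (10 * size (ser t) + 3).
Proof.
have H l z : ex (Loop Tmp (Push (src (~~ k)) true) (Push (src (~~ k)) false))
    (St k x z l [::] r) (St k x (rev l ++ z) [::] [::] r) (3 * size l + 1).
  elim: l z => [|b l IH] z; first by apply: ex_loopE; case: (k).
  rewrite rev_cons cat_rcons; apply: ex_le (_ : 1.+2 + (3 * size l + 1) <= _) _; first by rewrite /=; lia.
  by case: b; [apply: ex_loopT (IH _)|apply: ex_loopF (IH _)]; (try by case: (k));
     clear IH; case: (k) => /=; apply: ex_push.
have := H (rev (ser t)) y; rewrite revK size_rev => {}H.
by apply: ex_le (ex_seq (ex_scan k t x y r) H); lia.
Qed.

Lemma ex_drop_tree k t x y r :
  ex (drop_tree k) (St k (ser t ++ x) y [::] [::] r)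
    (St k x y [::] [::] r) (10 * size (ser t) + 3).
Proof.
have H l : ex (Loop Tmp Skip Skip) (St k x y l [::] r) (St k x y [::] [::] r) (2 * size l + 1).
  elim: l => [|b l IH]; first by apply: ex_loopE; case: (k).
  apply: ex_le (_ : 0.+2 + (2 * size l + 1) <= _) _; first by rewrite /=; lia.
  by case: b; [apply: ex_loopT IH|apply: ex_loopF IH]; (try by case: (k));
     case: (k) => /=; apply: ex_skip.
have := H (rev (ser t)); rewrite size_rev => {}H.
by apply: ex_le (ex_seq (ex_scan k t x y r) H); lia.
Qed.

Lemma ex_copy_tree t x y r :
  ex copy_tree (Store (ser t ++ x) y [::] [::] r)
    (Store (ser t ++ x) (ser t ++ y) [::] [::] r) (11 * size (ser t) + 3).
Proof.
have H l z w : ex (Loop Tmp (Seq (Push Main true) (Push Save true))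
      (Seq (Push Main false) (Push Save false)))
    (Store z w l [::] r) (Store (rev l ++ z) (rev l ++ w) [::] [::] r) (4 * size l + 1).
  elim: l z w => [|b l IH] z w; first exact: ex_loopE.
  rewrite rev_cons !cat_rcons; apply: ex_le (_ : 2.+2 + (4 * size l + 1) <= _) _; first by rewrite /=; lia.
  case: b; [apply: ex_loopT (IH _ _)|apply: ex_loopF (IH _ _)] => //;
    exact: (ex_seq (ex_push _ _ _) (ex_push _ _ _)).
have := H (rev (ser t)) x y; rewrite revK size_rev => {}H.
by apply: ex_le (ex_seq (ex_scan true t x y r) H); lia.
Qed.

Fixpoint pushes (k : stack) (l : seq bool) : cmd :=
  if l is b :: l' then Seq (pushes k l') (Push k b) else Skip.

Lemma ex_pushes l x y r : ex (pushes Main l) (Store x y [::] [::] r)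
  (Store (l ++ x) y [::] [::] r) (size l).
Proof.
elim: l => [|b l IH] /=; first exact: ex_skip.
by rewrite -addn1; apply: ex_seq IH (ex_push _ _ _).
Qed.

(** * Encoded data and the functions computed on them by stack programs *)

Class encodable (A : Type) := enc : A -> tree.

Definition code_of {A} `{encodable A} (a : A) : seq bool := ser (enc a).
Definition esize {A} `{encodable A} (a : A) : nat := size (code_of a).

Definition pbd {A} `{encodable A} (h : A -> nat) : Prop :=
  exists e, forall a, h a <= (esize a + 2) ^ e.

Section PolyBound.
Context {A : Type} `{encodable A}.
Implicit Types h g : A -> nat.

Lemma pbd_le h g : pbd g -> (forall a, h a <= g a) -> pbd h.
Proof. by case=> e He Hg; exists e => a; apply: leq_trans (Hg a) _. Qed.

Lemma pbd_const n : pbd (fun _ => n).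
Proof.
exists n => a; apply: leq_trans (ltnW (ltn_expl n (isT : 1 < 2))) _.
by apply: leq_expl; lia.
Qed.

Lemma pbd_esize : pbd (fun a => esize a).
Proof. by exists 1 => a; rewrite expn1 leq_addr. Qed.

Lemma pbd_mul h g : pbd h -> pbd g -> pbd (fun a => h a * g a).
Proof.
by case=> e He [e' He']; exists (e + e') => a; rewrite expnD leq_mul.
Qed.

Lemma pbd_add h g : pbd h -> pbd g -> pbd (fun a => h a + g a).
Proof.
case=> e He [e' He']; exists ((e + e') + 1) => a.
apply: leq_trans (@leq_exp_bound 2 (esize a) 1 (e + e') isT).
rewrite mul2n -addnn; apply: leq_add; [apply: leq_trans (He a) _|apply: leq_trans (He' a) _];
  by rewrite leq_pexp2l ?leq_addr ?leq_addl // addn2.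
Qed.

Lemma pbd_exp h e : pbd h -> pbd (fun a => h a ^ e).
Proof. by case=> e' He; exists (e' * e) => a; rewrite expnM leq_expl. Qed.
End PolyBound.

Lemma pbd_comp {A B} `{encodable A} `{encodable B} (h : B -> nat) (f : A -> B) :
  pbd h -> pbd (fun a => esize (f a)) -> pbd (fun a => h (f a)).
Proof.
case=> e He [e' He']; exists (e'.+2 * e) => a; rewrite expnM.
apply: leq_trans (He _) _; apply: leq_expl; rewrite !expnSr.
have := He' a; have : 0 < (esize a + 2) ^ e' by rewrite expn_gt0 addn2.
have : 2 <= esize a + 2 by rewrite leq_addl.
move: (esize a + 2) ((esize a + 2) ^ e') => Y X HY HX HE.
have : X * (2 * 2) <= X * (Y * Y) by rewrite leq_mul // leq_mul.
by rewrite mulnA; lia.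
Qed.

(** The rest [m] of [Main], all of [Save] and all of [IO] are arbitrary and preserved, while [Tmp]
    and [Cnt] are empty at both ends; this frame is what lets programs be nested. The bound on the
    size of the result feeds the time bound of the next program in a composition. *)
Definition pf {A B} `{encodable A} `{encodable B} (f : A -> B) : Prop :=
  exists c T, [/\ pbd T, pbd (fun a => esize (f a)) & forall a m s r,
    ex c (Store (code_of a ++ m) s [::] [::] r)
         (Store (code_of (f a) ++ m) s [::] [::] r) (T a)].

#[global] Instance enc_tree : encodable tree := id.
#[global] Instance enc_unit : encodable unit := fun _ => Leaf.
(** Both codes have five bits, so sizes do not depend on values; they differ in the second bit, on
    which [pf_if] branches. *)
#[global] Instance enc_bool : encodable bool :=
  fun b => if b then Node (Node Leaf Leaf) Leaf else Node Leaf (Node Leaf Leaf).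
#[global] Instance enc_prod A B `{encodable A} `{encodable B} : encodable (A * B) :=
  fun p => Node (enc p.1) (enc p.2).
#[global] Instance enc_seq A `{encodable A} : encodable (seq A) :=
  foldr (fun a t => Node (enc a) t) Leaf.
(** Natural numbers are unary: they serve as counters, indices and lengths. Binary numbers are
    values of type [seq bool]. *)
#[global] Instance enc_unary : encodable nat := fun n => enc (nseq n tt).
#[global] Instance enc_option A `{encodable A} : encodable (option A) :=
  fun o => if o is Some a then Node (enc a) Leaf else Leaf.

Lemma pf_size {A X : Type} {eA : encodable A} {eX : encodable X} (f : X -> A) : pf f -> pbd (fun x => esize (f x)).
Proof. by case=> c [T []]. Qed.

(** Equal codes are computed by the same program, so passing from a pair to a cons, or from a list
    of units to a number, costs nothing. *)
Lemma pf_cast {A B X : Type} {eA : encodable A} {eB : encodable B} {eX : encodable X} 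
    (f : X -> A) (g : X -> B) :
  pf f -> (forall x, enc (g x) = enc (f x)) -> pf g.
Proof.
case=> c [T [HT Hs Hc]] E; exists c, T; split => // [|a m s r].
  by apply: pbd_le Hs _ => x; rewrite /esize /code_of E.
by have := Hc a m s r; rewrite /code_of E.
Qed.

Lemma pf_ext {A X : Type} {eA : encodable A} {eX : encodable X} (f g : X -> A) : pf f -> g =1 f -> pf g.
Proof. by move=> Hf E; apply: pf_cast Hf _ => x; rewrite E. Qed.

Lemma pf_id {X : Type} {eX : encodable X} : pf (fun x : X => x).
Proof.
exists Skip, (fun=> 0); split; [exact: pbd_const|exact: pbd_esize|].
by move=> *; apply: ex_skip.
Qed.

Lemma pf_comp {A B X : Type} {eA : encodable A} {eB : encodable B} {eX : encodable X} 
    (g : A -> B) (f : X -> A) :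
  pf g -> pf f -> pf (fun x => g (f x)).
Proof.
case=> c [T [HT Hs Hc]] [c' [T' [HT' Hs' Hc']]].
exists (Seq c' c), (fun x => T' x + T (f x)); split.
- by apply: pbd_add => //; apply: pbd_comp.
- exact: (pbd_comp (h := fun b => esize (g b))).
- by move=> a m s r; apply: ex_seq (Hc' _ _ _ _) (Hc _ _ _ _).
Qed.

Lemma pf_const {B X : Type} {eB : encodable B} {eX : encodable X} (b : B) : pf (fun _ : X => b).
Proof.
exists (Seq (drop_tree true) (pushes Main (code_of b))), (fun x => 10 * esize x + 3 + esize b).
split.
- apply: pbd_add; last exact: pbd_const; apply: pbd_add; last exact: pbd_const.
  by apply: pbd_mul; [exact: pbd_const|exact: pbd_esize].
- exact: pbd_const.
- by move=> a m s r; apply: ex_seq (ex_drop_tree true _ _ _ _) (ex_pushes _ _ _ _).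
Qed.

(** The argument is duplicated into [Save]. [g] is evaluated first so that its value ends up below
    that of [f]. *)
Lemma pf_pair {A B X : Type} {eA : encodable A} {eB : encodable B} {eX : encodable X} 
    (f : X -> A) (g : X -> B) :
  pf f -> pf g -> pf (fun x => (f x, g x)).
Proof.
case=> c [T [HT Hs Hc]] [c' [T' [HT' Hs' Hc']]].
exists (Seq copy_tree (Seq c' (Seq (move_tree false) (Seq c (Push Main true))))),
  (fun x => (11 * esize x + 3) + (T' x + ((10 * esize x + 3) + (T x + 1)))).
split.
- do !(apply: pbd_add || apply: pbd_mul || exact: pbd_const || exact: pbd_esize || by []).
- apply: pbd_le (pbd_add (pbd_const 1) (pbd_add Hs Hs')) _ => x.
  by rewrite /esize /code_of /= size_cat; lia.
- move=> a m s r; apply: ex_seq (ex_copy_tree _ _ _ _) _.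
  apply: ex_seq (Hc' _ _ _ _) _; apply: ex_seq (ex_move_tree false _ _ _ _) _.
  apply: ex_seq (Hc _ _ _ _) _; have := ex_push Main true.
  move=> /(_ (Store (code_of (f a) ++ code_of (g a) ++ m) s [::] [::] r)) /=.
  by rewrite /code_of /= catA.
Qed.

Lemma pf_fst0 {A B : Type} {eA : encodable A} {eB : encodable B} : pf (fun p : A * B => p.1).
Proof.
exists (Pop Main (Seq (move_tree true) (Seq (drop_tree true) (move_tree false))) Skip Skip),
  (fun p => 30 * esize p + 11); split.
- by do !(apply: pbd_add || apply: pbd_mul || exact: pbd_const || exact: pbd_esize).
- by apply: pbd_le pbd_esize _ => x; rewrite /esize /code_of /= size_cat; lia.
- move=> [a b] m s r /=.
  pose ta := @enc A eA a; pose tb := @enc B eB b.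
  have H := ex_seq (ex_move_tree true ta (ser tb ++ m) s r)
     (ex_seq (ex_drop_tree true tb m _ r) (ex_move_tree false ta s m r)).
  apply: ex_le; last first.
    apply: (@ex_popT Main _ _ _ (Store (code_of (a, b) ++ m) s [::] [::] r) _ _ _ _ H).
    by rewrite /code_of /= catA.
  have -> : esize (a, b) = (size (ser ta) + size (ser tb)).+1.
    by rewrite /esize /code_of /= size_cat.
  by lia.
Qed.

Lemma pf_snd0 {A B : Type} {eA : encodable A} {eB : encodable B} : pf (fun p : A * B => p.2).
Proof.
exists (Pop Main (drop_tree true) Skip Skip), (fun p => 30 * esize p + 11); split.
- by do !(apply: pbd_add || apply: pbd_mul || exact: pbd_const || exact: pbd_esize).
- by apply: pbd_le pbd_esize _ => x; rewrite /esize /code_of /= size_cat; lia.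
- move=> [a b] m s r /=.
  pose ta := @enc A eA a; pose tb := @enc B eB b.
  have H := ex_drop_tree true ta (ser tb ++ m) s r.
  apply: ex_le; last first.
    apply: (@ex_popT Main _ _ _ (Store (code_of (a, b) ++ m) s [::] [::] r) _ _ _ _ H).
    by rewrite /code_of /= catA.
  have -> : esize (a, b) = (size (ser ta) + size (ser tb)).+1.
    by rewrite /esize /code_of /= size_cat.
  by lia.
Qed.

Lemma esize_pair {A B : Type} {eA : encodable A} {eB : encodable B} (a : A) (b : B) :
  esize (a, b) = (esize a + esize b).+1.
Proof. by rewrite /esize /code_of /= size_cat. Qed.

Lemma esize_cons {A : Type} {eA : encodable A} (a : A) l :
  esize (a :: l) = (esize a + esize l).+1.
Proof. by rewrite /esize /code_of /= size_cat. Qed.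

Lemma esize_nil {A : Type} {eA : encodable A} : esize ([::] : seq A) = 1.
Proof. by []. Qed.

Lemma esize_bool (b : bool) : esize b = 5.
Proof. by case: b. Qed.

Lemma esize_unary (n : nat) : esize n = 2 * n + 1.
Proof.
rewrite /esize /code_of /enc /enc_unary.
by elim: n => //= n IH; rewrite -[LHS]/((size (ser (enc (nseq n tt)))).+2) IH; lia.
Qed.

Lemma esize_bits (l : seq bool) : esize l = 6 * size l + 1.
Proof.
by elim: l => // b l IH; rewrite esize_cons esize_bool IH /=; lia.
Qed.

Lemma esize_size {A : Type} {eA : encodable A} (l : seq A) : size l < esize l.
Proof. by elim: l => // a l IH; rewrite esize_cons /=; lia. Qed.

Lemma pf_fst {A B X : Type} {eA : encodable A} {eB : encodable B} {eX : encodable X}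
  (f : X -> A * B) : pf f -> pf (fun x => (f x).1).
Proof. exact: pf_comp pf_fst0. Qed.

Lemma pf_snd {A B X : Type} {eA : encodable A} {eB : encodable B} {eX : encodable X}
  (f : X -> A * B) : pf f -> pf (fun x => (f x).2).
Proof. exact: pf_comp pf_snd0. Qed.

Lemma pf_if {B X : Type} {eB : encodable B} {eX : encodable X}
    (b : X -> bool) (f g : X -> B) :
  pf b -> pf f -> pf g -> pf (fun x => if b x then f x else g x).
Proof.
move=> Hb [cf [Tf [HTf Hsf Hf]]] [cg [Tg [HTg Hsg Hg]]].
have [cp [Tp [HTp Hsp Hp]]] := pf_pair Hb pf_id.
pose pop c := Pop Main c c Skip.
have Hpop c s s' z n : ex c (put Main (behead (get Main s)) s) s' n ->
    get Main s = z :: behead (get Main s) -> ex (pop c) s s' n.+2.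
  by move=> H E; case: z E => E; [apply: ex_popT E H|apply: ex_popF E H].
exists (Seq cp (pop (pop (Pop Main (pop (pop (pop cf))) (pop (pop (pop cg))) Skip)))),
  (fun x => Tp x + (Tf x + Tg x + 12)); split.
- by do !(apply: pbd_add || exact: pbd_const || by []).
- by apply: pbd_le (pbd_add Hsf Hsg) _ => x; case: (b x); lia.
- move=> x m s r; apply: ex_seq (Hp _ _ _ _) _; rewrite /code_of [enc (b x, x)]/=.
  case: (b x) => /=.
    apply: ex_le (_ : (((((((Tf x).+2).+2).+2).+2).+2).+2) <= _) _; first lia.
    by do 2!(apply: (Hpop) => //=); apply: ex_popT => //=; do 3!(apply: (Hpop) => //=); apply: Hf.
  apply: ex_le (_ : (((((((Tg x).+2).+2).+2).+2).+2).+2) <= _) _; first lia.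
  by do 2!(apply: (Hpop) => //=); apply: ex_popF => //=; do 3!(apply: (Hpop) => //=); apply: Hg.
Qed.

Lemma pf_match {A B X : Type} {eA : encodable A} {eB : encodable B} {eX : encodable X}
    (l : X -> seq A) (f : X -> B) (g : X -> A -> seq A -> B) :
  pf l -> pf f -> pf (fun p : X * (A * seq A) => g p.1 p.2.1 p.2.2) ->
  pf (fun x => match l x with [::] => f x | a :: s => g x a s end).
Proof.
move=> Hl [cf [Tf [HTf Hsf Hf]]] Hg0.
have [cp [Tp [HTp Hsp Hp]]] := pf_pair Hl pf_id.
have : pf (fun p : (A * seq A) * X => g p.2 p.1.1 p.1.2).
  apply: (pf_comp (f := fun p : (A * seq A) * X => (p.2, p.1)) Hg0).
  by apply: pf_pair; [exact: pf_snd0|exact: pf_fst0].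
case=> [cg [Tg [HTg Hsg Hg]]].
pose T x := Tf x + (if l x is a :: s then Tg ((a, s), x) else 0).
have HT : pbd T.
  apply: pbd_add => //; case: HTg => e He; case: Hsp => e' He'.
  have : pbd (fun x => (esize (l x, x) + 2) ^ e).
    by apply: (pbd_comp (h := fun p : seq A * X => (esize p + 2) ^ e)); [exists e|exists e'].
  move=> H; apply: pbd_le H _ => x; case E: (l x) => [|a s] //.
have Hs : pbd (fun x => esize (match l x with [::] => f x | a :: s => g x a s end)).
  case: Hsg => e He; case: Hsp => e' He'.
  have : pbd (fun x => (esize (l x, x) + 2) ^ e).
    by apply: (pbd_comp (h := fun p : seq A * X => (esize p + 2) ^ e)); [exists e|exists e'].
  move=> H; apply: pbd_le (pbd_add Hsf H) _ => x; case E: (l x) => [|a s]; first exact: leq_addr.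
  by apply: leq_trans _ (leq_addl _ _); apply: (He ((a, s), x)).
(* The two node bits popped to tell a cons from the empty list are pushed back, which turns the
   stack into the code of ((a, s), x). *)
exists (Seq cp (Pop Main (Pop Main (Seq (Push Main true) (Seq (Push Main true) cg)) cf Skip) Skip Skip)),
  (fun x => Tp x + (T x + 6)); split => //.
  exact: pbd_add HTp (pbd_add HT (pbd_const 6)).
move=> x m s r; apply: ex_seq (Hp _ _ _ _) _; rewrite /T /code_of.
case: (l x) => [|a w] /=.
  apply: ex_le (_ : (Tf x).+4 <= _) _; first lia.
  by apply: ex_popT => //=; apply: ex_popF => //=; apply: Hf.
apply: ex_le (_ : (1 + (1 + Tg (a, w, x))).+4 <= _) _; first lia.
apply: ex_popT => //=; apply: ex_popT => //=.
apply: ex_seq (ex_push _ _ _) _; apply: ex_seq (ex_push _ _ _) _.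
by move: (Hg (a, w, x) m s r); rewrite /code_of /= -!catA.
Qed.

(** The list waits in [Save], the accumulator is on [Main]. [Cnt] is a flag of one bit: a cons bit
    read from [Save] raises it again, the final leaf bit leaves it empty. It is down while [c] runs,
    as [pf] requires. *)
Definition fold_cmd (c : cmd) : cmd :=
  Pop Main (Seq (move_tree true) (Seq (Push Cnt true)
    (Loop Cnt (Pop Save (Seq (move_tree false) (Seq (Push Main true)
      (Seq c (Push Cnt true)))) Skip Skip) Skip))) Skip Skip.

(** Bounded recursion: a fold of polynomial-time steps may double its accumulator each time, so a
    polynomial bound on all intermediate accumulators is a hypothesis. *)
Lemma pf_fold {A B X : Type} {eA : encodable A} {eB : encodable B} {eX : encodable X}
    (g : A * B -> B) (l : X -> seq A) (i : X -> B) (bnd : X -> nat) :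
  pf g -> pf l -> pf i -> pbd bnd ->
  (forall x j, esize (foldl (fun b a => g (a, b)) (i x) (take j (l x))) <= bnd x) ->
  pf (fun x => foldl (fun b a => g (a, b)) (i x) (l x)).
Proof.
move=> [c [T [[e He] _ Hc]]] Hl Hi Hb Hbnd.
have [cp [Tp [HTp Hsp Hp]]] := pf_pair Hl Hi.
have Hsl := pf_size Hl.
pose (M := fun x : X => esize (l x) + bnd x + 3).
have HM : pbd M by apply: pbd_add (pbd_const 3); apply: pbd_add.
pose W (x : X) := 10 * M x + 20 + M x ^ e.
have HW : pbd W.
  apply: pbd_add; first exact: pbd_add (pbd_mul (pbd_const 10) HM) (pbd_const 20).
  exact: pbd_exp.
exists (Seq cp (fold_cmd c)), (fun x => Tp x + (10 * esize (l x) + 20 + esize (l x) * W x)).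
split.
- apply: pbd_add => //; apply: pbd_add; last exact: pbd_mul.
  exact: pbd_add (pbd_mul (pbd_const 10) Hsl) (pbd_const 20).
- by apply: pbd_le Hb _ => x; have := Hbnd x (size (l x)); rewrite take_size.
move=> x m s r; apply: ex_seq (Hp _ _ _ _) _.
have Hloop w b : (exists v, v ++ w = l x /\ b = foldl (fun b a => g (a, b)) (i x) v) ->
   ex (Loop Cnt (Pop Save (Seq (move_tree false) (Seq (Push Main true)
      (Seq c (Push Cnt true)))) Skip Skip) Skip)
   (Store (code_of b ++ m) (code_of w ++ s) [::] [:: true] r)
   (Store (code_of (foldl (fun b a => g (a, b)) b w) ++ m) s [::] [::] r)
   (size w * W x + 5).
  elim: w b => [|a w IH] b [v [Hv Hbv]].
    apply: ex_le (_ : 2.+2 + 1 <= _) _ => //.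
    apply: ex_loopT => //=; last exact: ex_loopE.
    by apply: ex_popF => //=; apply: ex_skip.
  have Hab : esize (a, b) + 2 <= M x.
    have H1 : esize a <= esize (l x).
      by rewrite -Hv; elim: v {Hv Hbv} => [|a' v IHv] /=; rewrite esize_cons; lia.
    have H2 := Hbnd x (size v); rewrite -Hv take_size_cat // -Hbv in H2.
    by rewrite esize_pair /M; lia.
  have HT : T (a, b) <= M x ^ e by apply: leq_trans (He _) (leq_expl _ Hab).
  have Ha : esize a <= M x by move: Hab; rewrite esize_pair; lia.
  rewrite /=.
  apply: ex_le (_ : (((10 * esize a + 3) + (1 + (T (a, b) + 1))).+2).+2 + (size w * W x + 5) <= _) _.
    by rewrite mulSn /W; lia.
  apply: (@ex_loopT _ _ _ _ _ _ [::]); first by [].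
    apply: (@ex_popT _ _ _ _ _ _ (ser (eA a) ++ (code_of w ++ s))); first by rewrite /code_of /= -catA.
    apply: ex_seq; first exact: (ex_move_tree false (eA a) (code_of w ++ s) (code_of b ++ m)).
    apply: ex_seq; first exact: ex_push.
    have := Hc (a, b) m (code_of w ++ s) r; rewrite /code_of /= -!catA => H.
    by apply: ex_seq; [exact: H|exact: ex_push].
  by apply: IH; exists (rcons v a); rewrite cat_rcons foldl_rcons -Hbv.
rewrite /fold_cmd.
apply: ex_le (_ : ((10 * esize (l x) + 3) + (1 + (size (l x) * W x + 5))).+2 <= _) _.
  have : size (l x) * W x <= esize (l x) * W x by rewrite leq_mul2r (ltnW (esize_size _)) orbT.
  lia.
apply: (@ex_popT _ _ _ _ _ _ (ser (enc (l x)) ++ (code_of (i x) ++ m))).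
  by rewrite /code_of /= -catA.
apply: ex_seq; first exact: (ex_move_tree true (enc (l x)) (code_of (i x) ++ m) s).
apply: ex_seq; first exact: ex_push.
by apply: Hloop; exists [::].
Qed.

Lemma pbd_bits (h : seq bool -> nat) : pbd h -> exists e, forall x, h x <= (size x + 2) ^ e.
Proof.
case=> e He; exists (4 * e) => x; apply: leq_trans (He x) _; rewrite expnM leq_expl //.
rewrite esize_bits -addnA; have : 2 ^ 3 * (size x + 2) ^ 1 <= (size x + 2) ^ 4.
  exact: leq_exp_bound.
by rewrite expn1; lia.
Qed.

(** * Reading the input and writing the output *)

Definition read_cmd : cmd :=
  Seq (Push Main false)
    (Loop IO (Seq (pushes Main (code_of true)) (Push Main true))
             (Seq (pushes Main (code_of false)) (Push Main true))).

Lemma ex_read x : ex read_cmd (Store [::] [::] [::] [::] (rev x))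
  (Store (code_of x ++ [::]) [::] [::] [::] [::]) (8 * size x + 2).
Proof.
have H l z : ex (Loop IO (Seq (pushes Main (code_of true)) (Push Main true))
             (Seq (pushes Main (code_of false)) (Push Main true)))
   (Store (code_of z) [::] [::] [::] l)
   (Store (code_of (catrev l z)) [::] [::] [::] [::]) (8 * size l + 1).
  elim: l z => [|b l IH] z /=; first exact: ex_loopE.
  apply: ex_le (_ : 6.+2 + (8 * size l + 1) <= _) _; first lia.
  have Hb : ex (Seq (pushes Main (code_of b)) (Push Main true)) (Store (code_of z) [::] [::] [::] l)
      (Store (code_of (b :: z)) [::] [::] [::] l) 6.
    have -> : 6 = size (code_of b) + 1 by case: (b).
    by apply: ex_seq; [exact: ex_pushes|exact: ex_push].
  case: b Hb => Hb.
    exact: (@ex_loopT IO _ _ (Store (code_of z) [::] [::] [::] (true :: l)) _ _ l _ _ erefl Hb (IH _)).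
  exact: (@ex_loopF IO _ _ (Store (code_of z) [::] [::] [::] (false :: l)) _ _ l _ _ erefl Hb (IH _)).
have := H (rev x) [::]; rewrite -/(rev _) revK size_rev cats0 => {}H.
by apply: ex_le; last (apply: ex_seq; [exact: ex_push|exact: H]); lia.
Qed.

Definition pop1 (c : cmd) : cmd := Pop Main c c Skip.

Lemma ex_pop1 c s s' z n : ex c (put Main (behead (get Main s)) s) s' n ->
  get Main s = z :: behead (get Main s) -> ex (pop1 c) s s' n.+2.
Proof. by move=> H E; case: z E => E; [apply: ex_popT E H|apply: ex_popF E H]. Qed.

Definition write_bit (b : bool) : cmd :=
  pop1 (pop1 (pop1 (Seq (Push IO b) (Push Cnt true)))).

Definition write_cmd : cmd :=
  Seq (Push Cnt true)
    (Loop Cnt (Pop Main (pop1 (Pop Main (write_bit true) (write_bit false) Skip)) Skip Skip) Skip).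

Lemma ex_write y : ex write_cmd (Store (code_of y ++ [::]) [::] [::] [::] [::])
  (Store [::] [::] [::] [::] (rev y)) (17 * size y + 6).
Proof.
have H l z : ex (Loop Cnt (Pop Main (pop1 (Pop Main (write_bit true) (write_bit false) Skip)) Skip Skip) Skip)
  (Store (code_of l) [::] [::] [:: true] z)
   (Store [::] [::] [::] [::] (catrev l z)) (17 * size l + 5).
  elim: l z => [|b l IH] z /=.
    apply: ex_le (_ : 2.+2 + 1 <= _) _ => //.
    apply: (@ex_loopT _ _ _ _ _ _ [::]) => //=; last exact: ex_loopE.
    by apply: ex_popF => //=; apply: ex_skip.
  apply: ex_le (_ : 14.+2 + (17 * size l + 5) <= _) _; first lia.
  apply: (@ex_loopT Cnt _ _ _ (Store (code_of l) [::] [::] [:: true] (b :: z)) _ [::]) => //.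
  case: b; apply: ex_popT => //=; apply: ex_pop1 => //=; [apply: ex_popT|apply: ex_popF] => //=;
    do 3!(apply: ex_pop1 => //=); apply: (@ex_seq _ _ _ _ _ 1 1); exact: ex_push.
by rewrite cats0; apply: ex_le; last (apply: ex_seq; [exact: ex_push|exact: (H y [::])]); lia.
Qed.

Lemma pf_FP (f : seq bool -> seq bool) : pf f -> FP f.
Proof.
case=> c [T [HT Hs Hc]].
have : pbd (fun x => (8 * size x + 2) + (T x + (17 * size (f x) + 6))).
  have Hz : pbd (fun x : seq bool => size x).
    by apply: pbd_le pbd_esize _ => x; apply: ltnW (esize_size x).
  apply: pbd_add; [|apply: pbd_add => //]; apply: pbd_add (pbd_const _); apply: pbd_mul (pbd_const _) _ => //.
  by apply: pbd_le Hs _ => x; apply: ltnW (esize_size _).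
move=> /pbd_bits [e He].
apply: (cmd_FP (c := Seq read_cmd (Seq c write_cmd)) (e := e)) => x.
have [t Ht Hle] := ex_seq (ex_read x) (ex_seq (Hc x [::] [::] [::]) (ex_write (f x))).
exists (Store [::] [::] [::] [::] (rev (f x))), t; split => //.
by apply: leq_trans Hle (He x).
Qed.

(** The step may depend on [x], which therefore travels inside the accumulator. *)
Lemma pf_foldl {A B X : Type} {eA : encodable A} {eB : encodable B} {eX : encodable X}
    (bnd : X -> nat) (step : X -> B -> A -> B) (i : X -> B) (l : X -> seq A) :
  pf (fun p : X * B * A => step p.1.1 p.1.2 p.2) -> pf i -> pf l -> pbd bnd ->
  (forall x j, esize (foldl (step x) (i x) (take j (l x))) <= bnd x) ->
  pf (fun x => foldl (step x) (i x) (l x)).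
Proof.
move=> Hs Hi Hl Hb Hbnd.
pose g (p : A * (X * B)) := (p.2.1, step p.2.1 p.2.2 p.1).
have E x b v : foldl (fun xb a => g (a, xb)) (x, b) v = (x, foldl (step x) b v).
  by elim: v b => //= a v IH b; rewrite IH.
apply: (pf_ext (f := fun x => (foldl (fun xb a => g (a, xb)) (x, i x) (l x)).2)); last first.
  by move=> x; rewrite E.
apply: pf_snd; apply: (pf_fold (bnd := fun x => (esize x + bnd x).+1)) => //.
- apply: pf_pair; first by apply: pf_fst; apply: pf_snd; apply: pf_id.
  apply: (pf_comp (f := fun p : A * (X * B) => (p.2.1, p.2.2, p.1)) Hs).
  by apply: pf_pair; [apply: pf_pair; [apply: pf_fst|apply: pf_snd]; apply: pf_snd|apply: pf_fst]; apply: pf_id.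
- by apply: pf_pair => //; apply: pf_id.
- by apply: pbd_le (pbd_add (pbd_add pbd_esize Hb) (pbd_const 1)) _ => x; rewrite addn1.
- by move=> x j; rewrite E esize_pair ltnS leq_add2l.
Qed.

(** The old accumulator enters the new size with coefficient 1, so growth is additive along the list
    and the bound asked for by [pf_foldl] comes for free. *)
Lemma pf_foldl_grow {A B X : Type} {eA : encodable A} {eB : encodable B} {eX : encodable X}
    (k : nat) (d : X -> nat) (step : X -> B -> A -> B) (i : X -> B) (l : X -> seq A) :
  pf (fun p : X * B * A => step p.1.1 p.1.2 p.2) -> pf i -> pf l -> pbd d ->
  (forall x b a, esize (step x b a) <= esize b + k * esize a + d x) ->
  pf (fun x => foldl (step x) (i x) (l x)).
Proof.
move=> Hs Hi Hl Hd Hg.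
apply: (pf_foldl (bnd := fun x => esize (i x) + k * esize (l x) + esize (l x) * d x)) => //.
  have HL := pf_size Hl.
  exact: pbd_add (pbd_add (pf_size Hi) (pbd_mul (pbd_const k) HL)) (pbd_mul HL Hd).
move=> x j; have H b v : esize (foldl (step x) b v) <= esize b + k * esize v + esize v * d x.
  elim: v b => [|a v IH] b /=; first by rewrite esize_nil; lia.
  apply: leq_trans (IH _) _; have := Hg x b a; rewrite esize_cons.
  move: (esize a) (esize v) (d x) (esize b) (esize (step x b a)) => p q y w z; nia.
apply: leq_trans (H _ _) _.
have Ht : esize (take j (l x)) <= esize (l x).
  by elim: (l x) j => [|a v IH] [|j] //=; rewrite !esize_cons ltnS leq_add2l.
by rewrite -addnA -addnA leq_add2l leq_add // leq_mul.
Qed.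

(** * Closure properties: lists, options, unary arithmetic *)

Section Lists.
Context {A B X : Type} {eA : encodable A} {eB : encodable B} {eX : encodable X}.

Lemma pf_cons (f : X -> A) (g : X -> seq A) : pf f -> pf g -> pf (fun x => f x :: g x).
Proof. by move=> Hf Hg; apply: pf_cast (pf_pair Hf Hg) _. Qed.

Lemma pf_succ (f : X -> nat) : pf f -> pf (fun x => (f x).+1).
Proof. by move=> Hf; apply: pf_cast (pf_pair (pf_const tt) Hf) _. Qed.

Lemma pf_units (f : X -> nat) : pf f -> pf (fun x => nseq (f x) tt).
Proof. by move=> Hf; apply: pf_cast Hf _. Qed.

Lemma pf_some (f : X -> A) : pf f -> pf (fun x => Some (f x)).
Proof. by move=> Hf; apply: pf_cast (pf_pair Hf (pf_const Leaf)) _. Qed.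

Lemma pf_match_opt (o : X -> option A) (f : X -> B) (g : X -> A -> B) :
  pf o -> pf f -> pf (fun p : X * A => g p.1 p.2) ->
  pf (fun x => match o x with None => f x | Some a => g x a end).
Proof.
move=> Ho Hf Hg; pose s x := if o x is Some a then [:: a] else [::].
have Hs : pf s by apply: pf_cast Ho _ => x; rewrite /s; case: (o x).
apply: (pf_ext (f := fun x => match s x with [::] => f x | a :: _ => g x a end)); last first.
  by move=> x; rewrite /s; case: (o x).
apply: pf_match => //; apply: (pf_comp (f := fun p : X * (A * seq A) => (p.1, p.2.1)) Hg).
by apply: pf_pair; [apply: pf_fst|apply: pf_fst; apply: pf_snd]; apply: pf_id.
Qed.

Lemma pf_iter (bnd : X -> nat) (step : X -> B -> B) (n : X -> nat) (i : X -> B) :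
  pf (fun p : X * B => step p.1 p.2) -> pf n -> pf i -> pbd bnd ->
  (forall x j, j <= n x -> esize (iter j (step x) (i x)) <= bnd x) ->
  pf (fun x => iter (n x) (step x) (i x)).
Proof.
move=> Hs Hn Hi Hb Hbnd.
have E x b (v : seq unit) : foldl (fun b _ => step x b) b v = iter (size v) (step x) b.
  by elim: v b => //= a v IH b; rewrite IH -iterSr.
apply: (pf_ext (f := fun x => foldl (fun b _ => step x b) (i x) (nseq (n x) tt))); last first.
  by move=> x; rewrite E size_nseq.
apply: (pf_foldl (bnd := bnd)) => //; last first.
- by move=> x j; rewrite E; apply: Hbnd; rewrite size_take_min size_nseq geq_minr.
- by apply: (pf_comp (f := fun p : X * B * unit => p.1) Hs); apply: pf_fst; apply: pf_id.
Qed.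
End Lists.

(** Extension point of [pf_auto], redefined after each group of closure lemmas. *)
Ltac pf_hook := fail.

Ltac pf_step :=
  match goal with
  | |- pf (fun x => x) => exact pf_id
  | |- pf (fun _ => ?c) => exact (pf_const c)
  | |- pf _ => first
    [ assumption | pf_hook | simple apply pf_pair | simple apply pf_fst | simple apply pf_snd
    | simple apply pf_if | simple apply pf_cons | simple apply pf_succ | simple apply pf_some
    | simple apply pf_match | simple apply pf_match_opt ]
  end.

Ltac pf_auto := cbv beta; repeat (pf_step; cbv beta).

Section Library.
Context {X : Type} {eX : encodable X}.

Lemma pf_negb (b : X -> bool) : pf b -> pf (fun x => ~~ b x).
Proof.
move=> H; apply: (pf_ext (f := fun x => if b x then false else true)); last by [].
by pf_auto.
Qed.

Lemma pf_andb (b c : X -> bool) : pf b -> pf c -> pf (fun x => b x && c x).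
Proof. by move=> Hb Hc; apply: pf_if => //; apply: pf_const. Qed.

Lemma pf_orb (b c : X -> bool) : pf b -> pf c -> pf (fun x => b x || c x).
Proof. by move=> Hb Hc; apply: pf_if => //; apply: pf_const. Qed.

Lemma pf_eqb (b c : X -> bool) : pf b -> pf c -> pf (fun x => b x == c x).
Proof.
move=> Hb Hc; apply: (pf_ext (f := fun x => if b x then c x else ~~ c x)).
  by apply: pf_if => //; apply: pf_negb.
by move=> x; case: (b x); case: (c x).
Qed.

Lemma pf_addb (b c : X -> bool) : pf b -> pf c -> pf (fun x => b x (+) c x).
Proof.
move=> Hb Hc; apply: (pf_ext (f := fun x => if b x then ~~ c x else c x)).
  by apply: pf_if => //; apply: pf_negb.
by move=> x; case: (b x); case: (c x).
Qed.
End Library.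

Section SeqLibrary.
Context {A X : Type} {eA : encodable A} {eX : encodable X}.
Implicit Types f g : X -> seq A.

Lemma esize_catrev (s t : seq A) : (esize (catrev s t)).+1 = esize s + esize t.
Proof. by elim: s t => //= a s IH t; rewrite IH !esize_cons; lia. Qed.

Lemma esize_cat (s t : seq A) : (esize (s ++ t)).+1 = esize s + esize t.
Proof. by elim: s => //= a s IH; rewrite !esize_cons; lia. Qed.

Lemma esize_rev (s : seq A) : esize (rev s) = esize s.
Proof. by have := @esize_catrev s [::]; rewrite esize_nil /rev; lia. Qed.

Lemma pf_catrev f g : pf f -> pf g -> pf (fun x => catrev (f x) (g x)).
Proof.
move=> Hf Hg.
apply: (pf_ext (f := fun x => foldl (fun b a => a :: b) (g x) (f x))).
  apply: (pf_foldl_grow (k := 1) (d := fun=> 1)) => //; [by pf_auto|exact: pbd_const|].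
  by move=> x b a; rewrite esize_cons; lia.
by move=> x; elim: (f x) (g x) => //= a s IH t.
Qed.

Lemma pf_rev f : pf f -> pf (fun x => rev (f x)).
Proof. by move=> Hf; apply: pf_catrev => //; apply: pf_const. Qed.

Lemma pf_cat f g : pf f -> pf g -> pf (fun x => f x ++ g x).
Proof.
move=> Hf Hg; apply: (pf_ext (f := fun x => catrev (rev (f x)) (g x))).
  by apply: pf_catrev => //; apply: pf_rev.
by move=> x; rewrite catrevE revK.
Qed.

Lemma pf_behead f : pf f -> pf (fun x => behead (f x)).
Proof.
move=> Hf; apply: (pf_ext (f := fun x => match f x with [::] => [::] | a :: s => s end)).
  by pf_auto.
by move=> x; case: (f x).
Qed.

Lemma pf_head a f : pf f -> pf (fun x => head a (f x)).
Proof.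
move=> Hf; apply: (pf_ext (f := fun x => match f x with [::] => a | b :: s => b end)).
  by pf_auto.
by move=> x; case: (f x).
Qed.

Lemma pf_nilp f : pf f -> pf (fun x => nilp (f x)).
Proof.
move=> Hf; apply: (pf_ext (f := fun x => match f x with [::] => true | b :: s => false end)).
  by pf_auto.
by move=> x; case: (f x).
Qed.

End SeqLibrary.

Lemma pf_flatten {A X : Type} {eA : encodable A} {eX : encodable X} 
    (f : X -> seq (seq A)) :
  pf f -> pf (fun x => flatten (f x)).
Proof.
move=> Hf; apply: (pf_ext (f := fun x => foldl cat [::] (f x))).
  apply: (pf_foldl_grow (k := 1) (d := fun=> 1)) => //.
  - by apply: pf_cat; pf_auto.
  - exact: pf_const.
  - exact: pbd_const.
  - by move=> x b a; have := @esize_cat A eA b a; lia.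
move=> x; have H (b : seq A) s : foldl cat b s = b ++ flatten s.
  by elim: s b => [|a s IH] b /=; rewrite ?cats0 // IH catA.
by rewrite H.
Qed.

Lemma esize_take {A : Type} {eA : encodable A} j (l : seq A) : esize (take j l) <= esize l.
Proof.
by elim: l j => [|a v IH] [|j] //=; rewrite !esize_cons ltnS leq_add2l.
Qed.

Lemma pf_map {A B X : Type} {eA : encodable A} {eB : encodable B} {eX : encodable X}
    (h : X -> A -> B) (l : X -> seq A) :
  pf (fun p : X * A => h p.1 p.2) -> pf l -> pf (fun x => [seq h x a | a <- l x]).
Proof.
move=> Hh Hl; have [e He] := pf_size Hh.
apply: (pf_ext (f := fun x => rev (foldl (fun b a => h x a :: b) [::] (l x)))); last first.
  move=> x; have H s t : foldl (fun b a => h x a :: b) t s = catrev [seq h x a | a <- s] t.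
    by elim: s t => //= a s IH t.
  by rewrite H -/(rev _) revK.
apply: pf_rev; apply: (pf_foldl (bnd := fun x => esize (l x) * (esize x + esize (l x) + 3) ^ e + esize (l x) + 1)) => //.
- by apply: pf_cons; pf_auto; apply: (pf_comp (f := fun p : X * seq B * A => (p.1.1, p.2)) Hh); pf_auto.
- by pf_auto.
- have HL := pf_size Hl; apply: (pbd_add _ (pbd_const 1)); apply: (pbd_add _ HL).
  apply: (pbd_mul HL); apply: pbd_exp; apply: (pbd_add _ (pbd_const 3)); exact: (pbd_add pbd_esize HL).
move=> x j; set Y := _ ^ e.
have H s t : (forall a, esize a <= esize (l x) -> esize (h x a) <= Y) -> esize s <= esize (l x) ->
    esize (foldl (fun b a => h x a :: b) t s) <= esize t + size s * Y + size s.
  move=> HY; elim: s t => [|a s IH] t Hs /=; first lia.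
  rewrite esize_cons in Hs; apply: leq_trans (IH _ _) _; first lia.
  by rewrite esize_cons; have := HY a; rewrite mulSn; lia.
have Ht : esize (take j (l x)) <= esize (l x) by apply: esize_take.
apply: leq_trans (H _ _ _ Ht) _.
  move=> a Ha; apply: leq_trans (He (x, a)) _; apply: leq_expl; rewrite esize_pair; lia.
have Hz : size (take j (l x)) <= esize (l x) by apply: leq_trans (ltnW (esize_size _)) Ht.
have : size (take j (l x)) * Y <= esize (l x) * Y by rewrite leq_mul2r Hz orbT.
by rewrite esize_nil; lia.
Qed.

Section NatLibrary.
Context {A X : Type} {eA : encodable A} {eX : encodable X}.
Implicit Types m n : X -> nat.

Lemma pf_length (l : X -> seq A) : pf l -> pf (fun x => size (l x)).
Proof.
move=> Hl; apply: (pf_cast (f := fun x => [seq tt | _ <- l x])); first by apply: pf_map => //; apply: pf_const.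
move=> x; rewrite -[LHS]/(enc (nseq (size (l x)) tt)).
by congr enc; elim: (l x) => //= a s ->.
Qed.

Lemma pf_nseq n (a : X -> A) : pf n -> pf a -> pf (fun x => nseq (n x) (a x)).
Proof.
move=> Hn Ha; apply: (pf_ext (f := fun x => [seq a x | _ <- nseq (n x) tt])).
  by apply: pf_map; [apply: (pf_comp Ha); pf_auto|apply: pf_units].
by move=> x; rewrite map_nseq.
Qed.

Lemma pf_drop n (l : X -> seq A) : pf n -> pf l -> pf (fun x => drop (n x) (l x)).
Proof.
move=> Hn Hl; apply: (pf_ext (f := fun x => iter (n x) behead (l x))).
  apply: (pf_iter (bnd := fun x => esize (l x))) => //; first by apply: pf_behead; pf_auto.
    exact: pf_size.
  move=> x j _; elim: j => //= j IH; apply: leq_trans IH.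
  by case: (iter _ _ _) => //= a s; rewrite esize_cons; lia.
move=> x; elim: (n x) => [|k IH] /=; first exact: drop0.
by rewrite -IH -drop1 drop_drop add1n.
Qed.

End NatLibrary.

Lemma pf_zip {A B X : Type} {eA : encodable A} {eB : encodable B} {eX : encodable X}
    (f : X -> seq A) (g : X -> seq B) : pf f -> pf g -> pf (fun x => zip (f x) (g x)).
Proof.
move=> Hf Hg.
pose step (s : seq B * seq (A * B)) a :=
  match s.1 with [::] => s | b :: t => (t, (a, b) :: s.2) end.
apply: (pf_ext (f := fun x => rev (foldl step (g x, [::]) (f x)).2)); last first.
  move=> x; have H s t o : (foldl step (t, o) s).2 = catrev (zip s t) o.
    elim: s t o => [|a s IH] [|b t] o //=; last by rewrite IH.
    by rewrite {1}/step /=; elim: s {IH}.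
  by rewrite H -/(rev _) revK.
apply: pf_rev; apply: pf_snd; apply: (pf_foldl_grow (k := 1) (d := fun=> 1)) => //.
- by rewrite /step; pf_auto.
- by pf_auto.
- exact: pbd_const.
- move=> x [[|b t] o] a; rewrite /step /= !esize_pair ?esize_cons ?esize_pair; lia.
Qed.

Ltac pf_hook1 := first
  [ simple apply pf_negb | simple apply pf_andb | simple apply pf_orb | simple apply pf_eqb
  | simple apply pf_addb | simple apply pf_catrev | simple apply pf_rev | simple apply pf_cat
  | simple apply pf_behead | simple apply pf_head | simple apply pf_nilp
  | simple apply pf_flatten | simple apply pf_map | simple apply pf_length
  | simple apply pf_nseq | simple apply pf_drop | simple apply pf_zip ].

Ltac pf_hook ::= pf_hook1.

Section Unary.
Context {X : Type} {eX : encodable X}.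
Implicit Types m n : X -> nat.

Lemma pf_addn m n : pf m -> pf n -> pf (fun x => m x + n x).
Proof.
move=> Hm Hn; apply: (pf_ext (f := fun x => size (nseq (m x) tt ++ nseq (n x) tt))); first by pf_auto.
by move=> x; rewrite size_cat !size_nseq.
Qed.

Lemma pf_muln m n : pf m -> pf n -> pf (fun x => m x * n x).
Proof.
move=> Hm Hn; apply: (pf_ext (f := fun x => size (flatten (nseq (m x) (nseq (n x) tt))))); first by pf_auto.
by move=> x; elim: (m x) => //= k IH; rewrite size_cat size_nseq -IH mulSn.
Qed.

Lemma pf_subn m n : pf m -> pf n -> pf (fun x => m x - n x).
Proof.
move=> Hm Hn; apply: (pf_ext (f := fun x => size (drop (n x) (nseq (m x) tt)))); first by pf_auto.
by move=> x; rewrite size_drop size_nseq.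
Qed.

Lemma pf_leq m n : pf m -> pf n -> pf (fun x => m x <= n x).
Proof.
move=> Hm Hn; apply: (pf_ext (f := fun x => nilp (drop (n x) (nseq (m x) tt)))); first by pf_auto.
by move=> x; rewrite /nilp size_drop size_nseq subn_eq0.
Qed.

Lemma pf_expn m e : pf m -> pf (fun x => m x ^ e).
Proof.
move=> Hm; elim: e => [|e IH]; first exact: pf_const.
by apply: (pf_ext (f := fun x => m x * m x ^ e)); [exact: pf_muln|move=> x; rewrite expnS].
Qed.

Lemma pf_minn m n : pf m -> pf n -> pf (fun x => minn (m x) (n x)).
Proof.
move=> Hm Hn; apply: (pf_ext (f := fun x => m x - (m x - n x))); first by do !apply: pf_subn => //.
by move=> x; lia.
Qed.

Lemma pf_maxn m n : pf m -> pf n -> pf (fun x => maxn (m x) (n x)).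
Proof.
move=> Hm Hn; apply: (pf_ext (f := fun x => m x + (n x - m x))); last by move=> x; lia.
by apply: pf_addn => //; apply: pf_subn.
Qed.

Lemma pf_iota0 n : pf n -> pf (fun x => iota 0 (n x)).
Proof.
have E k : iter k (fun s => rcons s (size s)) [::] = iota 0 k.
  by elim: k => // k IH; rewrite iterS IH size_iota -cats1 -[in RHS](addn1 k) iotaD.
move=> Hn; apply: (pf_ext (f := fun x => iter (n x) (fun s => rcons s (size s)) [::])); last by move=> x; rewrite E.
apply: (pf_iter (bnd := fun x => n x * (2 * n x + 3) + 1)) => //.
- by apply: (pf_ext (f := fun p : X * seq nat => p.2 ++ [:: size p.2])); [pf_auto|move=> p; rewrite cats1].
- exact: pf_const.
- have Hz : pbd (fun x => n x).
    by apply: pbd_le (pf_size Hn) _ => x; rewrite esize_unary; lia.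
  by apply: (pbd_add _ (pbd_const 1)); apply: (pbd_mul Hz); apply: (pbd_add _ (pbd_const 3)); apply: (pbd_mul (pbd_const 2)).
- move=> x j Hj; rewrite E.
  have H : forall k i, i + k <= n x -> esize (iota i k) <= k * (2 * n x + 3) + 1.
    elim=> [|k IH] i Hi //=; rewrite esize_cons esize_unary; have := IH i.+1; rewrite mulSn; lia.
  by apply: leq_trans (H j 0 Hj) _; rewrite leq_add2r leq_mul2r Hj orbT.
Qed.
End Unary.

Lemma pf_has {A X : Type} {eA : encodable A} {eX : encodable X} (h : X -> A -> bool) (l : X -> seq A) :
  pf (fun p : X * A => h p.1 p.2) -> pf l -> pf (fun x => has (h x) (l x)).
Proof.
move=> Hh Hl; apply: (pf_ext (f := fun x => foldl (fun b a => b || h x a) false (l x))).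
  apply: (pf_foldl_grow (k := 0) (d := fun=> 0)) => //.
  - by pf_auto; apply: (pf_comp (f := fun p : X * bool * A => (p.1.1, p.2)) Hh); pf_auto.
  - exact: pf_const.
  - exact: pbd_const.
  - by move=> x b a; rewrite !esize_bool.
move=> x; have H b s : foldl (fun b a => b || h x a) b s = b || has (h x) s.
  by elim: s b => [|a s IH] b /=; rewrite ?orbF // IH orbA.
by rewrite H.
Qed.

Lemma pf_all {A X : Type} {eA : encodable A} {eX : encodable X} (h : X -> A -> bool) (l : X -> seq A) :
  pf (fun p : X * A => h p.1 p.2) -> pf l -> pf (fun x => all (h x) (l x)).
Proof.
move=> Hh Hl; apply: (pf_ext (f := fun x => ~~ has (fun a => ~~ h x a) (l x))).
  by pf_auto; apply: pf_has => //; pf_auto.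
by move=> x; elim: (l x) => //= a s ->; case: (h x a).
Qed.

Lemma pf_count {A X : Type} {eA : encodable A} {eX : encodable X} (h : X -> A -> bool) (l : X -> seq A) :
  pf (fun p : X * A => h p.1 p.2) -> pf l -> pf (fun x => count (h x) (l x)).
Proof.
move=> Hh Hl; apply: (pf_ext (f := fun x => size (flatten [seq (if h x a then [:: tt] else [::]) | a <- l x]))).
  by pf_auto.
by move=> x; elim: (l x) => //= a s ->; case: (h x a).
Qed.

Lemma pf_take {A X : Type} {eA : encodable A} {eX : encodable X} (n : X -> nat) (l : X -> seq A) :
  pf n -> pf l -> pf (fun x => take (n x) (l x)).
Proof.
move=> Hn Hl; apply: (pf_ext (f := fun x => [seq p.1 | p <- zip (l x) (nseq (n x) tt)])).
  by pf_auto.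
by move=> x; elim: (l x) (n x) => [|a s IH] [|k] //=; rewrite IH.
Qed.

Ltac pf_hook2 := first
  [ simple apply pf_addn | simple apply pf_muln | simple apply pf_subn | simple apply pf_leq
  | simple apply pf_expn | simple apply pf_minn | simple apply pf_maxn | simple apply pf_iota0
  | simple apply pf_has | simple apply pf_all | simple apply pf_count | simple apply pf_take ].

Ltac pf_hook ::= first [ pf_hook2 | pf_hook1 ].

(** * Binary numbers, least significant bit first *)

Fixpoint bval (l : seq bool) : nat := if l is b :: s then b + 2 * bval s else 0.

(** The state consists of the unread digits of both numbers, the carry, and the digits produced so
    far in reverse; the new carry is the majority of the three bits. *)
Definition add_step (s : (seq bool * seq bool) * (bool * seq bool)) :=
  let a := head false s.1.1 in let b := head false s.1.2 in let c := s.2.1 in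
  ((behead s.1.1, behead s.1.2),
   (if a then b || c else b && c, (a (+) b (+) c) :: s.2.2)).

Definition add (p q : seq bool) : seq bool :=
  let s := iter (maxn (size p) (size q)) add_step ((p, q), (false, [::])) in
  rev (s.2.1 :: s.2.2).

Lemma bval_cat p q : bval (p ++ q) = bval p + 2 ^ size p * bval q.
Proof. by elim: p => [|b p IH] /=; rewrite ?expnS ?expn0 ?mul1n // IH; lia. Qed.

Lemma bval_rcons p b : bval (rcons p b) = bval p + 2 ^ size p * b.
Proof. by rewrite -cats1 bval_cat /=; case: b; lia. Qed.

Lemma bval_behead p : bval p = head false p + 2 * bval (behead p).
Proof. by case: p. Qed.

Lemma add_iter n p q c o : let s := iter n add_step ((p, q), (c, o)) in
  bval (rev s.2.2) + 2 ^ size s.2.2 * (s.2.1 + bval s.1.1 + bval s.1.2) =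
  bval (rev o) + 2 ^ size o * (c + bval p + bval q) /\
  [/\ size s.2.2 = n + size o, s.1.1 = drop n p & s.1.2 = drop n q].
Proof.
elim: n => [|n [IH [Hs Hp Hq]]] /=; first by rewrite !drop0.
case: (iter n add_step _) IH Hs Hp Hq => -[p' q'] [c' o'] /= IH Hs Hp Hq.
split; last by rewrite Hs Hp Hq -!drop1 !drop_drop add1n.
rewrite -IH rev_cons bval_rcons size_rev expnS (bval_behead p') (bval_behead q').
move: (bval (behead p')) (bval (behead q')) (2 ^ size o') => u v w.
by case: (head false p'); case: (head false q'); case: c' {IH} => /=; lia.
Qed.

Lemma bval_add p q : bval (add p q) = bval p + bval q.
Proof.
rewrite /add /=; have := add_iter (maxn (size p) (size q)) p q false [::] => /=.
case: (iter _ _ _) => -[p' q'] [c o] /= [H [_ Hp Hq]].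
rewrite rev_cons bval_rcons size_rev.
by move: H; rewrite Hp Hq !drop_oversize ?leq_maxl ?leq_maxr //=; lia.
Qed.

Lemma size_add p q : size (add p q) = (maxn (size p) (size q)).+1.
Proof.
rewrite /add; have := add_iter (maxn (size p) (size q)) p q false [::] => /= -[_ [Hs _ _]].
by rewrite size_rev /= Hs addn0.
Qed.

Definition mul (p q : seq bool) : seq bool :=
  foldl (fun acc b => add (false :: acc) (if b then q else [::])) [::] (rev p).

Lemma mul_cons b p q : mul (b :: p) q = add (false :: mul p q) (if b then q else [::]).
Proof. by rewrite /mul rev_cons foldl_rcons. Qed.

Lemma bval_mul p q : bval (mul p q) = bval p * bval q.
Proof.
elim: p => [|b p IH]; first by [].
by rewrite mul_cons bval_add /= IH; case: b => /=; lia.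
Qed.

Lemma size_mul p q : size (mul p q) <= 2 * size p + size q.
Proof.
elim: p => [|b p IH]; first by [].
by rewrite mul_cons size_add /=; case: b => /=; lia.
Qed.

Definition trim (l : seq bool) : seq bool :=
  foldl (fun acc b => if nilp acc && ~~ b then [::] else b :: acc) [::] (rev l).

Definition canon (l : seq bool) : bool := last true l.

Lemma trim_cons b l : trim (b :: l) = if nilp (trim l) && ~~ b then [::] else b :: trim l.
Proof. by rewrite /trim rev_cons foldl_rcons. Qed.

Lemma bval_trim l : bval (trim l) = bval l.
Proof.
elim: l => // b l IH; rewrite trim_cons /= -IH.
by case: (trim l) => //=; case: b.
Qed.

Lemma canon_trim l : canon (trim l).
Proof.
elim: l => // b l IH; rewrite trim_cons.
by case: (trim l) IH => [|c s] //=; case: b.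
Qed.

Lemma canon_behead b l : canon (b :: l) -> canon l.
Proof. by case: l. Qed.

Lemma canon_bval0 l : canon l -> bval l = 0 -> l = [::].
Proof.
elim: l => // b l IH Hc; case: b Hc => // Hc /= H.
have E : l = [::] by apply: IH (canon_behead Hc) _; lia.
by rewrite E in Hc.
Qed.

Lemma bits_auxE f n : n <= f -> bval (bits_aux f n) = n /\ canon (bits_aux f n).
Proof.
elim: f n => [|f IH] n /=; first by case: n.
case: eqP => [->|Hn] // Hf; have [|H1 H2] := IH n./2; first lia.
split=> /=; first by rewrite H1 -[RHS]odd_double_half mul2n.
case E: (bits_aux f n./2) H1 H2 => [|b l] //= H1 _.
have := odd_double_half n; rewrite -H1 /canon /=; case: (odd n) => //= Hz.
by case: Hn; rewrite -Hz.
Qed.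

Lemma bval_bits n : bval (bits n) = n. Proof. by case: (bits_auxE (leqnn n)). Qed.
Lemma canon_bits n : canon (bits n). Proof. by case: (bits_auxE (leqnn n)). Qed.

Lemma canon_inj p q : canon p -> canon q -> bval p = bval q -> p = q.
Proof.
elim: p q => [|a p IH] [|b q] Hp Hq H //.
- by rewrite (canon_bval0 Hq).
- by rewrite (canon_bval0 Hp).
- move: H => /= H; have E : a = b by case: a b H {Hp Hq} => [] [] //=; lia.
  rewrite E (IH q (canon_behead Hp) (canon_behead Hq)) //.
  by move: H; rewrite E; lia.
Qed.

Lemma bits_bval l : canon l -> bits (bval l) = l.
Proof. by move=> H; apply: canon_inj => //; [exact: canon_bits|exact: bval_bits]. Qed.

Lemma trimE l : trim l = bits (bval l).
Proof. by rewrite -bval_trim bits_bval // canon_trim. Qed.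

Definition eqv (p q : seq bool) : bool :=
  let s := foldl (fun s b => (behead s.1, s.2 && (head false s.1 == b))) (q, true) p in
  s.2 && ~~ has id s.1.

Lemma eqvP p q : eqv p q = (bval p == bval q).
Proof.
rewrite /eqv; suff H c : let s := foldl (fun s b => (behead s.1, s.2 && (head false s.1 == b))) (q, c) p in
    s.2 && ~~ has id s.1 = c && (bval p == bval q) by rewrite H.
elim: p q c => [|b p IH] q c /=.
  by congr andb; elim: q => //= a q IH; rewrite negb_or; case: a => //=; rewrite IH; case: (bval q).
rewrite IH -andbA; congr andb; rewrite (bval_behead q); case: b; case: (head false q) => //=; lia.
Qed.

Definition binof (n : nat) : seq bool := trim (iter n (fun v => add v [:: true]) [::]).

Lemma binofE n : binof n = bits n.
Proof.
rewrite /binof trimE; congr bits.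
by elim: n => //= n IH; rewrite bval_add IH /=; lia.
Qed.

(** Dimensions and k arrive in binary and may be exponential in the input length. Their unary value
    is computed up to a cap only, and cutting after every doubling keeps intermediate values
    small. *)
Definition capval (c : nat) (l : seq bool) : nat :=
  foldl (fun v (b : bool) => minn (v + v + b) c) 0 (rev l).

Lemma capvalE c l : capval c l = minn (bval l) c.
Proof.
elim: l => [|b l IH]; first by rewrite min0n.
by rewrite /capval rev_cons foldl_rcons -/(capval c l) IH /=; lia.
Qed.

Section BinaryPF.
Context {X : Type} {eX : encodable X}.
Implicit Types f g : X -> seq bool.

Lemma pbd_size {A : Type} {eA : encodable A} (f : X -> seq A) : pf f -> pbd (fun x => size (f x)).
Proof. by move=> /pf_size H; apply: pbd_le H _ => x; apply: ltnW (esize_size _). Qed.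

Lemma pf_add f g : pf f -> pf g -> pf (fun x => add (f x) (g x)).
Proof.
move=> Hf Hg; rewrite /add; apply: pf_rev.
have H : pf (fun x => iter (maxn (size (f x)) (size (g x))) add_step ((f x, g x), (false, [::]))).
  apply: (pf_iter (bnd := fun x => 12 * size (f x) + 12 * size (g x) + 12)).
  - by rewrite /add_step; pf_auto.
  - by pf_auto.
  - by pf_auto.
  - apply: (pbd_add _ (pbd_const 12)); apply: pbd_add; apply: (pbd_mul (pbd_const 12)); exact: pbd_size.
  - move=> x j Hj; have := add_iter j (f x) (g x) false [::] => /=.
    case: (iter _ _ _) => -[p' q'] [c o] /= [_ [Hs -> ->]].
    rewrite !esize_pair esize_bool !esize_bits !size_drop Hs /=; lia.
exact: (pf_cons (pf_fst (pf_snd H)) (pf_snd (pf_snd H))).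
Qed.
End BinaryPF.

Lemma pf_mul {X : Type} {eX : encodable X} (f g : X -> seq bool) :
  pf f -> pf g -> pf (fun x => mul (f x) (g x)).
Proof.
move=> Hf Hg; rewrite /mul.
apply: (pf_foldl (bnd := fun x => 6 * (2 * size (f x) + size (g x)) + 1)).
- apply: pf_add; first by pf_auto.
  apply: (pf_comp (f := fun p : X * seq bool * bool => (p.1.1, p.2)) (g := fun p => if p.2 then g p.1 else [::])); last by pf_auto.
  by apply: pf_if; [pf_auto|apply: (pf_comp Hg); pf_auto|pf_auto].
- by pf_auto.
- by pf_auto.
- apply: (pbd_add _ (pbd_const 1)); apply: (pbd_mul (pbd_const 6)); apply: pbd_add; last exact: pbd_size.
  by apply: (pbd_mul (pbd_const 2)); apply: pbd_size.
- move=> x j; rewrite esize_bits leq_add2r leq_mul2l /=.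
  have E : forall s, foldl (fun acc (b : bool) => add (false :: acc) (if b then g x else [::])) [::] s = mul (rev s) (g x).
    by move=> s; rewrite /mul revK.
  rewrite E; apply: leq_trans (size_mul _ _) _; rewrite size_rev size_take_min size_rev; lia.
Qed.

Section BinaryPF2.
Context {X : Type} {eX : encodable X}.
Implicit Types f g : X -> seq bool.

Lemma pf_trim f : pf f -> pf (fun x => trim (f x)).
Proof.
move=> Hf; rewrite /trim.
apply: (pf_foldl_grow (k := 1) (d := fun=> 1)); [by pf_auto|by pf_auto|by pf_auto|exact: pbd_const|].
by move=> x b a; case: ifP => _; rewrite ?esize_cons ?esize_nil; have := esize_bits b; lia.
Qed.

Lemma pf_canon f : pf f -> pf (fun x => canon (f x)).
Proof.
move=> Hf; apply: (pf_ext (f := fun x => head true (rev (f x)))); first by pf_auto.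
by move=> x; rewrite /canon; elim/last_ind: (f x) => // s b _; rewrite last_rcons rev_rcons.
Qed.

Lemma pf_eqv f g : pf f -> pf g -> pf (fun x => eqv (f x) (g x)).
Proof.
move=> Hf Hg; rewrite /eqv.
have H : pf (fun x => foldl (fun s b => (behead s.1, s.2 && (head false s.1 == b))) (g x, true) (f x)).
  apply: (pf_foldl_grow (k := 0) (d := fun=> 0)); [by pf_auto|by pf_auto|by pf_auto|exact: pbd_const|].
  move=> x [b c] a; rewrite !esize_pair !esize_bool !esize_bits size_behead /=; lia.
by apply: pf_andb; [exact: pf_snd|apply: pf_negb; apply: pf_has; [pf_auto|exact: pf_fst]].
Qed.

Lemma pf_binof (n : X -> nat) : pf n -> pf (fun x => binof (n x)).
Proof.
move=> Hn; rewrite /binof; apply: pf_trim.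
apply: (pf_iter (bnd := fun x => 6 * n x + 7)).
- by apply: pf_add; pf_auto.
- by [].
- exact: pf_const.
- apply: (pbd_add _ (pbd_const 7)); apply: (pbd_mul (pbd_const 6)).
  by apply: pbd_le (pf_size Hn) _ => x; rewrite esize_unary; lia.
- move=> x j Hj; rewrite esize_bits.
  have : size (iter j (fun v => add v [:: true]) [::]) <= j.+1.
    by elim: j {Hj} => //= j IH; rewrite size_add /=; lia.
  lia.
Qed.

Lemma pf_nat_of_bool (b : X -> bool) : pf b -> pf (fun x => nat_of_bool (b x)).
Proof. by move=> Hb; apply: (pf_ext (f := fun x => if b x then 1 else 0)); pf_auto; move=> x; case: (b x). Qed.
End BinaryPF2.

Lemma pf_capval {X : Type} {eX : encodable X} (c : X -> nat) (f : X -> seq bool) :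
  pf c -> pf f -> pf (fun x => capval (c x) (f x)).
Proof.
move=> Hc Hf; rewrite /capval.
apply: (pf_foldl (bnd := fun x => esize (c x))).
- apply: pf_minn; last by apply: (pf_comp Hc); pf_auto.
  by apply: pf_addn; [pf_auto|apply: pf_nat_of_bool; pf_auto].
- exact: pf_const.
- by pf_auto.
- exact: pf_size.
- move=> x j; have E s : foldl (fun v (b : bool) => minn (v + v + b) (c x)) 0 s = capval (c x) (rev s).
    by rewrite /capval revK.
  by rewrite E capvalE !esize_unary; lia.
Qed.

Ltac pf_hook3 := first
  [ simple apply pf_add | simple apply pf_mul | simple apply pf_trim | simple apply pf_canon
  | simple apply pf_eqv | simple apply pf_binof | simple apply pf_capval ].

Ltac pf_hook ::= first [ pf_hook3 | pf_hook2 | pf_hook1 ].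

(** * Parsing *)

Definition split_step (s : seq bool * seq bool) : seq bool * seq bool :=
  match s.2 with
  | [::] => s
  | c :: r => match r with
              | [::] => s
              | b :: r' => if c then (b :: s.1, r') else s
              end
  end.

(** [split_step] is stationary once no stuffed bit is in front, so [size s] rounds suffice for any
    word. *)
Definition unpair (s : seq bool) : option (seq bool * seq bool) :=
  let t := iter (size s) split_step ([::], s) in
  match t.2 with
  | [::] => None
  | c :: r => match r with
              | [::] => None
              | b :: r' => if c || b then None else Some (rev t.1, r')
              end
  end.

Definition stuffed (x : seq bool) : seq bool := flatten [seq [:: true; b] | b <- x].

Lemma split_iter_stuffed x a s :
  iter (size x) split_step (a, stuffed x ++ s) = (catrev x a, s).
Proof. by elim: x a => // b x IH a; rewrite [size _]/= iterSr; apply: (IH (b :: a)). Qed.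

Lemma split_iter_inv n a s : let t := iter n split_step (a, s) in
  exists2 x, t.1 = catrev x a & s = stuffed x ++ t.2.
Proof.
elim: n => [|n [x H1 H2]] /=; first by exists [::].
case E: (iter n _ _) H1 H2 => [a' s'] /= H1 H2; rewrite /split_step /=.
case: s' E H2 => [|c [|b r]] E H2; try by exists x.
case: c E H2 => E H2; last by exists x.
exists (rcons x b) => /=; first by rewrite H1 -cats1 catrev_catl.
by rewrite H2 /stuffed map_rcons flatten_rcons -catA.
Qed.

Lemma pair_encE x y : pair_enc x y = stuffed x ++ [:: false, false & y].
Proof. by []. Qed.

Lemma size_stuffed x : size (stuffed x) = 2 * size x.
Proof. by elim: x => //= b x; rewrite /stuffed => ->; lia. Qed.

Lemma size_pair_enc x y : size (pair_enc x y) = 2 * size x + 2 + size y.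
Proof. by rewrite pair_encE size_cat size_stuffed /=; lia. Qed.

Lemma unpair_enc x y : unpair (pair_enc x y) = Some (x, y).
Proof.
rewrite /unpair size_pair_enc pair_encE.
have -> : 2 * size x + 2 + size y = (size x + 2 + size y) + size x by lia.
rewrite iterD split_iter_stuffed.
have -> n : iter n split_step (catrev x [::], [:: false, false & y]) = (catrev x [::], [:: false, false & y]).
  by elim: n => //= n ->.
by rewrite /= -/(rev x) revK.
Qed.

Lemma unpairP s x y : unpair s = Some (x, y) -> s = pair_enc x y.
Proof.
rewrite /unpair; have [z] := split_iter_inv (size s) [::] s.
case: (iter _ _ _) => a [|c [|b r]] //= -> Hs; case: c Hs; case: b => //= Hs [<- <-].
by rewrite Hs pair_encE -/(rev z) revK.
Qed.

Lemma pf_unpair {X : Type} {eX : encodable X} (f : X -> seq bool) : pf f -> pf (fun x => unpair (f x)).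
Proof.
move=> Hf; rewrite /unpair.
have H : pf (fun x => iter (size (f x)) split_step ([::], f x)).
  apply: (pf_iter (bnd := fun x => 6 * size (f x) + 3)).
  - by rewrite /split_step; pf_auto.
  - by pf_auto.
  - by pf_auto.
  - apply: (pbd_add _ (pbd_const 3)); apply: (pbd_mul (pbd_const 6)); exact: pbd_size.
  - move=> x j _; have [z] := split_iter_inv j [::] (f x).
    case: (iter _ _ _) => a r /= -> Hs; rewrite esize_pair !esize_bits.
    have := congr1 size Hs; rewrite size_cat size_stuffed -/(rev z) size_rev; lia.
apply: (pf_comp (g := fun t : seq bool * seq bool => match t.2 with
  | [::] => None
  | c :: r => match r with
              | [::] => None
              | b :: r' => if c || b then None else Some (rev t.1, r')
              end
  end) _ H).
by pf_auto.
Qed.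

(** * Lists of words and the grammar of instances *)

Definition tokens (y : seq bool) : seq (seq bool) :=
  rev (iter (size y) (fun s => match unpair s.2 with None => s | Some p => (p.1 :: s.1, p.2) end)
    ([::], y)).1.

Lemma pf_tokens {X : Type} {eX : encodable X} (f : X -> seq bool) : pf f -> pf (fun x => tokens (f x)).
Proof.
move=> Hf; rewrite /tokens; apply: pf_rev; apply: pf_fst.
apply: (pf_iter (bnd := fun x => 6 * size (f x) + 3)).
- apply: pf_match_opt; [by apply: pf_unpair; pf_auto|by pf_auto|by pf_auto].
- by pf_auto.
- by pf_auto.
- apply: (pbd_add _ (pbd_const 3)); apply: (pbd_mul (pbd_const 6)); exact: pbd_size.
- move=> x j _; elim: j => [|j IH]; first by rewrite esize_pair esize_bits esize_nil; lia.
  rewrite iterS; case: (iter j _ _) IH => a r; rewrite esize_pair esize_bits /=.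
  case E: (unpair r) => [[u v]|]; rewrite /= esize_pair esize_bits // esize_cons esize_bits.
  by rewrite (unpairP E) size_pair_enc; lia.
Qed.

Lemma tokens_enc (l : seq (seq bool)) : tokens (flatten [seq pair_enc t [::] | t <- l]) = l.
Proof.
rewrite /tokens; set y := flatten _.
pose st (s : seq (seq bool) * seq bool) := match unpair s.2 with None => s | Some p => (p.1 :: s.1, p.2) end.
have pE t s : pair_enc t [::] ++ s = pair_enc t s by rewrite !pair_encE -catA.
have E a k : iter (size k) st (a, flatten [seq pair_enc t [::] | t <- k]) = (catrev k a, [::]).
  elim: k a => // t k IH a; rewrite [size _]/= iterSr /= {2}/st /= pE unpair_enc; exact: IH.
have Hs : size l <= size y.
  by rewrite /y; elim: (l) => //= t k; rewrite size_cat size_pair_enc; lia.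
rewrite -(subnK Hs) iterD -/st E; have -> n : iter n st (catrev l [::], [::]) = (catrev l [::], [::]).
  by elim: n => //= n ->.
by rewrite /= -/(rev l) revK.
Qed.

Lemma size_tokens_enc (l : seq (seq bool)) (M : nat) : (forall t, t \in l -> size t <= M) ->
  size (flatten [seq pair_enc t [::] | t <- l]) <= size l * (2 * M + 2).
Proof.
elim: l => //= t l IH H; rewrite size_cat size_pair_enc mulSn.
have := H t; rewrite mem_head => /(_ isT) Ht.
by have := IH (fun t' Ht' => H t' (mem_behead (s := t :: l) Ht')); rewrite /=; lia.
Qed.

(** Sign, digits of the absolute numerator, digits of the denominator, as found in a word: neither
    canonical nor in lowest terms. *)
Notation raw := (bool * (seq bool * seq bool))%type.

Definition rats_word (rs : seq raw) (t : seq bool) : seq bool :=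
  foldr (fun q t => q.1 :: pair_enc q.2.1 (pair_enc q.2.2 t)) t rs.

Definition word (m n : seq bool) (rs : seq raw) (k : seq bool) : seq bool :=
  pair_enc m (pair_enc n (rats_word rs (pair_enc k [::]))).

Definition rat_step (o : option (seq raw * seq bool)) : option (seq raw * seq bool) :=
  match o with
  | None => None
  | Some s =>
      match s.2 with
      | [::] => None
      | b :: r =>
          match unpair r with
          | None => None
          | Some p =>
              match unpair p.2 with
              | None => None
              | Some q => Some ((b, (p.1, q.1)) :: s.1, q.2)
              end
          end
      end
  end.

Definition parse (w : seq bool) : option (seq bool * (seq bool * (seq raw * seq bool))) :=
  match unpair w with
  | None => None
  | Some p =>
      match unpair p.2 with
      | None => None
      | Some q =>
          match iter (capval (size w) p.1 * capval (size w) q.1) rat_step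
                  (Some ([::], q.2)) with
          | None => None
          | Some s =>
              match unpair s.2 with
              | None => None
              | Some t => if nilp t.2 then Some (p.1, (q.1, (rev s.1, t.1))) else None
              end
          end
      end
  end.

Lemma rat_iter_word rs a t :
  iter (size rs) rat_step (Some (a, rats_word rs t)) = Some (catrev rs a, t).
Proof.
elim: rs a => // -[b [x y]] rs IH a.
by rewrite [size _]/= iterSr {2}/rat_step /= !unpair_enc /= IH.
Qed.

Lemma rat_iter_inv n a s b t :
  iter n rat_step (Some (a, s)) = Some (b, t) ->
  exists rs, [/\ b = catrev rs a, size rs = n & s = rats_word rs t].
Proof.
have N k : iter k rat_step None = None by elim: k => //= k ->.
elim: n a s => [|n IH] a s; first by case=> <- <-; exists [::].
rewrite iterSr {2}/rat_step /=; case: s => [|c s]; first by rewrite N.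
case E: (unpair s) => [[x r]|]; last by rewrite N.
rewrite /=; case E': (unpair r) => [[y r']|]; last by rewrite N.
move=> /IH /= [rs [Hb Hs Hr]]; exists ((c, (x, y)) :: rs); split => //=; first by rewrite Hs.
by rewrite (unpairP E) (unpairP E') Hr.
Qed.

Lemma size_rats_word rs t : 5 * size rs + size t <= size (rats_word rs t).
Proof. by elim: rs => //= q rs IH; rewrite !size_pair_enc; lia. Qed.

Lemma size_word m n rs k : size rs + size m + size n + size k < size (word m n rs k).
Proof.
rewrite /word !size_pair_enc; have := size_rats_word rs (pair_enc k [::]).
by rewrite size_pair_enc; lia.
Qed.

Lemma parse_word m n rs k : size rs = bval m * bval n ->
  parse (word m n rs k) = Some (m, (n, (rs, k))).
Proof.
move=> H; rewrite /parse; have := size_word m n rs k; move: (size (word _ _ _ _)) => c Hc.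
rewrite /word !unpair_enc /= !capvalE.
have -> : minn (bval m) c * minn (bval n) c = size rs.
  rewrite H; case: (bval m) (bval n) H => [|u] [|v] H; rewrite ?min0n ?minn0 ?muln0 ?mul0n //.
  have : u.+1 <= u.+1 * v.+1 by rewrite leq_pmulr.
  have : v.+1 <= u.+1 * v.+1 by rewrite leq_pmull.
  by move=> H1 H2; congr muln; lia.
by rewrite rat_iter_word /= unpair_enc /= -/(rev rs) revK.
Qed.

(** Capping the dimensions does no harm. Every entry takes at least one letter, so a dimension
    beyond [size w] would force at least [size w] entries unless the other dimension is 0, and then
    both products vanish. *)
Lemma parseP w m n rs k : parse w = Some (m, (n, (rs, k))) ->
  w = word m n rs k /\ size rs = bval m * bval n.
Proof.
rewrite /parse; case E1: (unpair w) => [[m' r]|] //=; case E2: (unpair r) => [[n' r']|] //=.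
case E3: (iter _ _ _) => [[b t]|] //=; case E4: (unpair t) => [[k' z]|] //=.
case: z E4 => //= E4 [<- <- <- <-].
have [rs' [Hb Hs Hr]] := rat_iter_inv E3.
have Hw : w = word m' n' rs' k'.
  by rewrite /word (unpairP E1) (unpairP E2) Hr (unpairP E4).
rewrite Hb -/(rev rs') revK; split => //.
have := size_word m' n' rs' k'; rewrite -Hw Hs !capvalE.
case: (leqP (bval m') (size w)) => Hm; case: (leqP (bval n') (size w)) => Hn.
- by [].
- case: (bval m') Hm => [|u] Hm; first by rewrite !mul0n.
  by have := leq_mul (ltn0Sn u) (leqnn (size w)); lia.
- case: (bval n') Hn => [|u] Hn; first by rewrite !muln0.
  by have := leq_mul (leqnn (size w)) (ltn0Sn u); lia.
- case: (size w) Hm => [|c] Hm; first lia.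
  by have := leq_mul (ltn0Sn c) (leqnn c.+1); lia.
Qed.

(** * The verifier *)

Definition bad_raw (q : raw) : bool :=
  [|| ~~ canon q.2.1, ~~ canon q.2.2, nilp q.2.2 | q.1 && nilp q.2.1].

(* [toks = d :: a :: b :: _] exhibits the common factor [d] *)
Definition reducible (toks : seq (seq bool)) (q : raw) : bool :=
  let d := head [::] toks in
  eqv q.2.1 (mul d (head [::] (behead toks))) &&
  eqv q.2.2 (mul d (head [::] (behead (behead toks)))).

Definition nonzero (e : seq bool * seq bool) : bool := has id e.1 || has id e.2.

(* Running sum (P - N) / Q of the products of rational entries with the integer
   entries [p - q]. *)
Definition row_step (s : seq bool * seq bool * seq bool)
    (e : raw * (seq bool * seq bool)) : seq bool * seq bool * seq bool :=
  let a := e.1.2.1 in let d := e.1.2.2 in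
  let u := mul a (if e.1.1 then e.2.2 else e.2.1) in
  let v := mul a (if e.1.1 then e.2.1 else e.2.2) in
  (add (mul d s.1.1) (mul u s.2), add (mul d s.1.2) (mul v s.2), mul d s.2).

Definition row_ok (l : seq (raw * (seq bool * seq bool))) : bool :=
  let s := foldl row_step ([::], [::], [:: true]) l in eqv s.1.1 s.1.2.

(** The first n words are the positive parts of the entries of the vector, the next n the negative
    parts. Nonvanishing is certified by an entry with nonzero positive part and empty negative part;
    every nonzero integral vector has such an entry after a change of sign. *)
Definition ker_ok (c : nat) (m n : seq bool) (rs : seq raw) (k : seq bool)
    (toks : seq (seq bool)) : bool :=
  let n' := capval c n in
  let xs := zip (take n' toks) (take n' (drop n' toks)) in
  [&& count nonzero xs <= capval c k,
      has (fun e => has id e.1 && nilp e.2) xs &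
      all (fun i => row_ok (zip (take n' (drop (i * n') rs)) xs)) (iota 0 (capval c m))].

(** A word that is not the code of an instance lies in the complement: a syntax error needs no
    certificate, a reducible fraction needs a common factor with more than one digit. If there is no
    row, n may be exponential in the length of w, but every unit vector is then in the kernel, so n
    > 0 is all there is to test. *)
Definition check (w y : seq bool) : bool :=
  let toks := tokens y in
  match parse w with
  | None => true
  | Some (m, (n, (rs, k))) =>
      [|| ~~ canon m, ~~ canon n, ~~ canon k, nilp k, has bad_raw rs,
          (1 < size (trim (head [::] toks))) && has (reducible toks) rs |
          if nilp m then ~~ nilp n else ker_ok (size w) m n rs k toks]
  end.

Definition verify (z : seq bool) : bool :=
  match unpair z with None => false | Some p => check p.1 p.2 end.

(** * The verifier runs in polynomial time *)

Lemma esize_none {A : Type} {eA : encodable A} : esize (None : option A) = 1.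
Proof. by []. Qed.

Lemma esize_some {A : Type} {eA : encodable A} (a : A) : esize (Some a) = esize a + 2.
Proof. by rewrite /esize /code_of /= size_cat /=; lia. Qed.

Lemma pf_rat_iter {X : Type} {eX : encodable X} (n : X -> nat) (f : X -> seq bool) :
  pf n -> pf f -> pf (fun x => iter (n x) rat_step (Some ([::], f x))).
Proof.
move=> Hn Hf; apply: (pf_iter (bnd := fun x => 6 * size (f x) + 6)).
- rewrite /rat_step; pf_auto; try (by apply: pf_unpair; pf_auto).
- by [].
- by pf_auto.
- apply: (pbd_add _ (pbd_const 6)); apply: (pbd_mul (pbd_const 6)); exact: pbd_size.
- move=> x j _; case E: (iter _ _ _) => [[b t]|]; last by rewrite esize_none; lia.
  have [rs [-> _ ->]] := rat_iter_inv E.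
  rewrite -/(rev rs) esize_some esize_pair esize_rev esize_bits.
  have : esize rs + 6 * size t <= 6 * size (rats_word rs t) + 1.
    elim: rs {E} => [|q rs IH] /=; first by rewrite esize_nil; lia.
    rewrite esize_cons; case: q => [s [a d]]; rewrite !esize_pair esize_bool !esize_bits.
    by rewrite !size_pair_enc /=; lia.
  lia.
Qed.

Lemma pf_parse {X : Type} {eX : encodable X} (f : X -> seq bool) : pf f -> pf (fun x => parse (f x)).
Proof.
move=> Hf; apply: (pf_comp (g := parse)) => //.
rewrite /parse; apply: pf_match_opt; [by apply: pf_unpair; pf_auto|by pf_auto|].
apply: pf_match_opt; [by apply: pf_unpair; pf_auto|by pf_auto|].
apply: pf_match_opt; [by apply: pf_rat_iter; pf_auto|by pf_auto|].
apply: pf_match_opt; [by apply: pf_unpair; pf_auto|by pf_auto|].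
by pf_auto.
Qed.

(** The running fraction is never reduced. Each step multiplies by one entry and one coordinate, so
    lengths add up and stay linear in the size of the list. *)
Lemma pf_row_fold : pf (fun l : seq (raw * (seq bool * seq bool)) =>
  foldl row_step ([::], [::], [:: true]) l).
Proof.
apply: (pf_foldl (step := fun _ => row_step) (bnd := fun l => 18 * (4 * esize l + 1) + 5)).
- by rewrite /row_step; pf_auto.
- by pf_auto.
- by pf_auto.
- apply: (pbd_add _ (pbd_const 5)); apply: (pbd_mul (pbd_const 18)).
  by apply: (pbd_add _ (pbd_const 1)); apply: (pbd_mul (pbd_const 4)); apply: pbd_esize.
move=> l j.
have H s r z : size s.1.1 <= z -> size s.1.2 <= z -> size s.2 <= z ->
    let t := foldl row_step s r in
    [/\ size t.1.1 <= z + 4 * esize r, size t.1.2 <= z + 4 * esize r & size t.2 <= z + 4 * esize r].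
  elim: r s z => [|e r IH] s z H1 H2 H3 /=; first by split; apply: leq_trans (leq_addr _ _).
  case: e => [[b [a d]] [p q]]; set s' := row_step _ _.
  have E : esize ((b, (a, d), (p, q)) :: r) = 6 * (size a + size d + size p + size q) + esize r + 14.
    by rewrite esize_cons !esize_pair esize_bool !esize_bits; lia.
  have := IH s' (z + 4 * (size a + size d + size p + size q) + 1).
  rewrite E => {}IH; case: IH.
  + rewrite /s' /row_step /= size_add.
    have := size_mul d s.1.1; have := size_mul (mul a (if b then q else p)) s.2.
    by have := size_mul a (if b then q else p); case: b {E s'} => /=; lia.
  + rewrite /s' /row_step /= size_add.
    have := size_mul d s.1.2; have := size_mul (mul a (if b then p else q)) s.2.
    by have := size_mul a (if b then p else q); case: b {E s'} => /=; lia.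
  + by rewrite /s' /row_step /=; have := size_mul d s.2; lia.
  by move=> h1 h2 h3; split; lia.
have [|||h1 h2 h3] := H ([::], [::], [:: true]) (take j l) 1 => //.
have Ht : esize (take j l) <= esize l by apply: esize_take.
case: (foldl _ _ _) h1 h2 h3 => [[P N] Q] /= h1 h2 h3.
by rewrite !esize_pair !esize_bits; lia.
Qed.

Lemma pf_row_ok {X : Type} {eX : encodable X} (f : X -> seq (raw * (seq bool * seq bool))) :
  pf f -> pf (fun x => row_ok (f x)).
Proof.
move=> Hf; apply: (pf_comp (g := row_ok) _ Hf); rewrite /row_ok.
have H := pf_row_fold; by pf_auto.
Qed.

Lemma pf_check : pf (fun p : seq bool * seq bool => check p.1 p.2).
Proof.
rewrite /check.
have Ht : pf (fun p : seq bool * seq bool => tokens p.2) by apply: pf_tokens; pf_auto.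
apply: (pf_ext (f := fun p => match parse p.1 with None => true | Some d =>
   [|| ~~ canon d.1, ~~ canon d.2.1, ~~ canon d.2.2.2, nilp d.2.2.2, has bad_raw d.2.2.1,
          (1 < size (trim (head [::] (tokens p.2)))) && has (reducible (tokens p.2)) d.2.2.1 |
          if nilp d.1 then ~~ nilp d.2.1 else ker_ok (size p.1) d.1 d.2.1 d.2.2.1 d.2.2.2 (tokens p.2)] end)); last first.
  by case=> w y /=; case: (parse w) => [[m [n [rs k]]]|].
apply: pf_match_opt; [by apply: pf_parse; pf_auto|by pf_auto|].
set D := (seq bool * (seq bool * (seq raw * seq bool)))%type.
have {}Ht : pf (fun p : seq bool * seq bool * D => tokens p.1.2) by apply: pf_tokens; pf_auto.
pf_auto.
- by rewrite /bad_raw; pf_auto.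
- rewrite /reducible; pf_auto.
  + by apply: pf_tokens; pf_auto.
  + by apply: pf_tokens; pf_auto.
  + by apply: pf_tokens; pf_auto.
  + by apply: pf_tokens; pf_auto.
- rewrite /ker_ok; pf_auto.
all: try by rewrite /nonzero; pf_auto.
all: try by apply: pf_tokens; pf_auto.
by apply: pf_row_ok; pf_auto; apply: pf_tokens; pf_auto.
Qed.

Lemma pf_verify : pf verify.
Proof.
rewrite /verify; apply: pf_match_opt; [by apply: pf_unpair; pf_auto|by pf_auto|].
by apply: (pf_comp pf_check); pf_auto.
Qed.

(** * Sparse kernel vectors *)

Definition support (F : fieldType) n (x : 'cV[F]_n) : {set 'I_n} :=
  [set i | x i 0%R != 0%R].

Definition sparse_kernel m n (A : 'M[rat]_(m, n)) (k : nat) : Prop :=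
  exists x : 'cV[rat]_n, [/\ x != 0%R, (A *m x = 0)%R & #|support x| <= k].

Local Open Scope ring_scope.

(** Trades the sorted list for a set of indices; the last clause retains all that is used of the
    order. *)
Lemma topk_set (R : realType) n k (x : 'cV[R]_n) : exists S : {set 'I_n},
  [/\ #|S| = minn k n, topk_norm k x = \sum_(i in S) `|x i 0|
    & forall i j, i \in S -> j \notin S -> `|x j 0| <= `|x i 0|].
Proof.
rewrite /topk_norm sort_map; set s := sort _ _.
have us : uniq s by rewrite sort_uniq enum_uniq.
have ss : size s = n by rewrite size_sort size_enum_ord.
exists [set i in take k s]; split.
- by rewrite cardsE (card_uniqP (take_uniq _ us)) size_take_min ss.
- rewrite -map_take big_map big_uniq ?take_uniq //=.
  by apply: eq_bigl => i; rewrite inE.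
- move=> i j; rewrite !inE => Hi Hj.
  have tr : transitive (relpre (fun i : 'I_n => `|x i 0|) (fun a b : R => b <= a)).
    by move=> a b c /= H1 H2; exact: le_trans H2 H1.
  have : sorted (relpre (fun i : 'I_n => `|x i 0|) (fun a b : R => b <= a)) s.
    by apply: sort_sorted => a b /=; exact: le_total.
  rewrite (sorted_pairwise tr) -{1}(cat_take_drop k s) pairwise_cat => /and3P [/allrelP H _ _].
  apply: H => //; have : j \in s by rewrite mem_sort mem_enum.
  by rewrite -{1}(cat_take_drop k s) mem_cat (negbTE Hj).
Qed.

(** On a vector with at most k nonzero entries the top-k norm equals the l1 norm, which is positive
    for a nonzero vector. *)
Lemma sparse_kernel_not_NSP (R : realType) m n (A : 'M[rat]_(m, n)) k :
  sparse_kernel A k -> forall alpha : R, alpha < 1 -> ~ NSP A k alpha.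
Proof.
move=> [x [x0 Ax Sx]] alpha alpha1 H.
pose y := map_mx (@ratr R) x.
have yE i : y i 0 = ratr (x i 0) by rewrite mxE.
have y0 i : (y i 0 == 0) = (x i 0 == 0) by rewrite yE fmorph_eq0.
have Ay : map_mx (@ratr R) A *m y = 0 by rewrite -map_mxM Ax map_mx0.
have [S [cS tS mS]] := topk_set k y.
(* A nonzero entry outside [S] would be dominated by all those in [S], giving min(k, n) + 1 nonzero
   entries. *)
have out j : j \notin S -> y j 0 = 0.
  move=> jS; apply/eqP/negP => /negP yj.
  have sub : j |: S \subset support x.
    apply/subsetP => i; rewrite !inE -y0 => /orP [/eqP -> //|iS].
    by rewrite -normr_gt0 (lt_le_trans _ (mS i j iS jS)) // normr_gt0.
  have := subset_leq_card sub; rewrite cardsU1 jS add1n cS => lt1.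
  have : (#|j |: S| <= n)%N by rewrite -[X in (_ <= X)%N](card_ord n) max_card.
  rewrite cardsU1 jS add1n cS => lt2.
  by move: (leq_trans lt1 Sx); lia.
have tl : topk_norm k y = l1norm y.
  rewrite tS /l1norm [RHS](bigID (mem S)) /= [X in _ = _ + X]big1 ?addr0 //.
  by move=> i iS; rewrite out ?normr0.
have l0 : 0 < l1norm y.
  have [i xi] : exists i, x i 0 != 0.
    apply/existsP; apply: contraR x0; rewrite negb_exists => /forallP xz.
    by apply/eqP/colP => i; rewrite mxE; apply/eqP; rewrite -[_ == _]negbK xz.
  rewrite /l1norm (bigD1 i) //= ltr_wpDr ?normr_gt0 ?y0 //.
  by apply: sumr_ge0.
have := H y Ay; rewrite tl -{1}[l1norm y]mul1r ler_pM2r // leNgt.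
by rewrite alpha1.
Qed.

(** Let P erase the coordinates in S. A rational kernel vector of A stacked on P would be supported
    in S, so the stacked matrix has full column rank and a rational left inverse. Applied to a real
    kernel vector y, this inverse recovers y linearly from P y; the constant is the sum of the
    absolute values of its entries. Working over the rationals first avoids any passage from real to
    rational kernel vectors. *)
Lemma kernel_bound (R : realType) m n (A : 'M[rat]_(m, n)) k (S : {set 'I_n}) :
  ~ sparse_kernel A k -> (#|S| <= k)%N ->
  exists C : R, forall y : 'cV[R]_n, map_mx (@ratr R) A *m y = 0 ->
    l1norm y <= C * \sum_(i | i \notin S) `|y i 0|.
Proof.
move=> nA cS; pose P : 'M[rat]_n := diag_mx (\row_i (i \notin S)%:R).
have fullM : row_full (col_mx A P).
  have : row_free (col_mx A P)^T; last by rewrite /row_free mxrank_tr.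
  rewrite -kermx_eq0; apply/negP => /negP; rewrite -nz_row_eq0.
  set v := nz_row _ => v0; apply: nA; exists v^T.
  have Hv : col_mx A P *m v^T = 0.
    apply: trmx_inj; rewrite trmx_mul trmxK trmx0.
    by apply/sub_kermxP; apply: nz_row_sub.
  move: Hv; rewrite mul_col_mx -[0]vsubmxK => /eq_col_mx [Av Pv].
  split; first by rewrite -(inj_eq (@trmx_inj _ _ _)) trmxK trmx0.
    by rewrite Av linear0.
  apply: leq_trans cS; apply/subset_leq_card/subsetP => i; rewrite inE.
  apply: contraR => iS; have := congr1 (fun B : 'cV_n => B i 0) Pv.
  by rewrite /P mul_diag_mx !mxE iS mul1r => ->.
have /row_fullP [B HB] := fullM.
pose B2 := map_mx (@ratr R) (rsubmx B).
exists (\sum_(i < n) \sum_(j < n) `|B2 i j|) => y Ay.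
have yE : y = B2 *m (map_mx (@ratr R) P *m y).
  rewrite /B2 mulmxA -map_mxM -[LHS]mul1mx -(map_mx1 (@ratr R)) -HB -{1}[B]hsubmxK.
  rewrite mul_row_col map_mxD mulmxDl [map_mx _ (lsubmx B *m A)]map_mxM -mulmxA Ay mulmx0 add0r.
  by [].
have Py i : (map_mx (@ratr R) P *m y) i 0 = (if i \notin S then y i 0 else 0).
  rewrite map_diag_mx mul_diag_mx !mxE rmorph_nat.
  by case: (i \notin S); rewrite ?mul1r ?mul0r.
rewrite /l1norm mulr_suml; apply: ler_sum => i _.
rewrite {1}yE mxE; apply: le_trans (ler_norm_sum _ _ _) _.
rewrite mulr_suml; apply: ler_sum => j _; rewrite normrM ler_wpM2l // Py.
case: ifP => jS; last by rewrite normr0 sumr_ge0.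
by rewrite (bigD1 j) //= lerDl sumr_ge0.
Qed.

(** There are finitely many sets S, hence one K >= 1 for all of them: the l1 norm is at most K times
    the mass v outside S. The mass inside S is the norm minus v, so at most 1 - 1/K times the
    norm. *)
Lemma NSP_of_not_sparse_kernel (R : realType) m n (A : 'M[rat]_(m, n)) k :
  ~ sparse_kernel A k -> exists alpha : R, alpha < 1 /\ NSP A k alpha.
Proof.
move=> nA.
pose P (S : {set 'I_n}) (c : R) := (#|S| <= k)%N -> forall y : 'cV[R]_n,
  map_mx (@ratr R) A *m y = 0 -> l1norm y <= c * \sum_(i | i \notin S) `|y i 0|.
have [S|C HC] := @fin_all_exists _ _ P.
  rewrite /P; have [cS|_] := leqP #|S| k; last by exists 0.
  by have [c Hc] := kernel_bound R nA cS; exists c.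
pose K : R := 1 + \sum_S `|C S|.
have K1 : 1 <= K by rewrite /K lerDl sumr_ge0.
have K0 : 0 < K by apply: lt_le_trans K1.
exists (1 - K^-1); split; first by rewrite ltrBlDr ltrDl invr_gt0.
move=> y Ay; have [S [cS -> _]] := topk_set k y.
have kS : (#|S| <= k)%N by rewrite cS geq_minl.
have Hy := HC S kS y Ay.
have lE : l1norm y = \sum_(i in S) `|y i 0| + \sum_(i | i \notin S) `|y i 0|.
  by rewrite /l1norm (bigID (mem S)).
have CK : C S <= K.
  apply: le_trans (ler_norm _) _; rewrite /K (bigD1 S) //= addrCA lerDl.
  by rewrite addr_ge0 // sumr_ge0.
set u := \sum_(i in S) _ in lE *; set v := \sum_(i | i \notin S) _ in lE Hy *.
have v0 : 0 <= v by apply: sumr_ge0.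
have Kv : l1norm y <= K * v by apply: le_trans Hy _; rewrite ler_wpM2r.
rewrite mulrBl mul1r lerBrDr {2}lE lerD2l mulrC ler_pdivrMr //.
by rewrite mulrC.
Qed.

(** * Integral kernel vectors of bounded size *)

Lemma det_bound r (D : 'M[int]_r) (M : nat) : (forall i j, `|D i j| <= M%:Z) ->
  `|\det D| <= (r`! * M ^ r)%N%:Z.
Proof.
move=> HD; apply: le_trans (ler_norm_sum _ _ _) _.
apply: (@le_trans _ _ (\sum_(s : 'S_r) (M ^ r)%N%:Z)).
  apply: ler_sum => s _; rewrite normrM normrX normrN1 expr1n mul1r normr_prod.
  rewrite -natz natrX -[r in M%:R ^+ r]card_ord -prodr_const natz.
  by apply: ler_prod => i _; rewrite normr_ge0 HD.
by rewrite sumr_const card_Sn -natz -mulrnA natz mulnC -natz -mulr_natr !natz.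
Qed.

Lemma fact_exp_bound r n M : (r <= n)%N -> (0 < n)%N -> (0 < M)%N ->
  (r`! * M ^ r <= (n * M) ^ n)%N.
Proof.
move=> rn n0 M0; apply: (@leq_trans ((n * M) ^ r)).
  rewrite expnMn leq_mul2r; apply/orP; right.
  elim: r rn => // r IH rn; rewrite factS expnS leq_mul //.
  by apply: IH; apply: ltnW.
by rewrite leq_pexp2l // muln_gt0 n0.
Qed.

(* Cramer's rule on a maximal independent set of columns of [B] inside the
   support of [x], one more such column being expressed through them. *)
Lemma integral_kernel m n (B : 'M[int]_(m, n)) (M k : nat) :
  (0 < M)%N -> (forall i j, `|B i j| <= M%:Z) ->
  (exists x : 'cV[rat]_n,
    [/\ x != 0, map_mx intr B *m x = 0 & (#|support x| <= k)%N]) ->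
  exists z : 'cV[int]_n, [/\ z != 0, B *m z = 0,
    (#|[set i | z i ord0 != 0]| <= k)%N & forall i, `|z i 0| <= ((n * M) ^ n)%N%:Z].
Proof.
move=> M0 HB [x [x0 Bx xk]].
pose ev (t : 'I_#|support x|) : 'I_n := enum_val t.
(* Transposed: the columns of [B] in the support become rows, whose rank falls short because [x] is
   a relation among them. *)
pose C : 'M[rat]_(#|support x|, m) := rowsub ev (map_mx intr B)^T.
have rkC : (\rank C < #|support x|)%N.
  rewrite ltn_neqAle rank_leq_row andbT; apply/negP => frC.
  pose u : 'rV[rat]_#|support x| := \row_t x (ev t) 0.
  have uC : u *m C = 0.
    rewrite /C; apply/rowP => i.
    have E : (map_mx intr B *m x) i 0 = 0 by rewrite Bx mxE.
    rewrite [RHS]mxE -[RHS]E [LHS]mxE [RHS]mxE.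
    rewrite [RHS](bigID (mem (support x))) /= [X in _ = _ + X]big1 ?addr0; last first.
      by move=> j; rewrite inE negbK => /eqP ->; rewrite mulr0.
    rewrite [RHS](big_enum_val) /=; apply: eq_bigr => t _.
    by rewrite !mxE mulrC.
  have u0 : u = 0 by apply/eqP; rewrite -(mulmx_free_eq0 u frC) uC.
  case/eqP: x0; apply/colP => i; rewrite mxE; apply/eqP; apply/negPn/negP => xi.
  have iS : i \in support x by rewrite inE.
  have := congr1 (fun D : 'rV_#|support x| => D 0 (enum_rank_in iS i)) u0.
  by rewrite !mxE /ev enum_rankK_in // => /eqP; rewrite (negbTE xi).
pose r := \rank C; pose f := maxrankfun C.
have [t0 Ht0] : exists t0, t0 \notin codom f.
  apply/existsP; rewrite -negb_forall; apply/negP => /forallP H.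
  have : (#|{: 'I_#|support x| }| <= #|codom f|)%N by apply/subset_leq_card/subsetP => t _.
  by rewrite card_ord (card_codom (@maxrankfun_inj _ _ _ C)) card_ord leqNgt rkC.
pose C0 := rowsub f C.
have fullC0 : row_full C0^T by rewrite /row_full mxrank_tr; exact: maxrowsub_free.
pose g := fullrankfun fullC0.
pose D : 'M[int]_r := \matrix_(a, b) B (g b) (ev (f a)).
pose c : 'rV[int]_r := \row_b B (g b) (ev t0).
pose w := c *m \adj D.
(* Cramer's rule cleared of its denominator det D; integral because the adjugate is. *)
pose z : 'rV[int]_n := \det D *: delta_mx 0 (ev t0) - w *m rowsub (ev \o f) 1%:M.
pose q (p1 p2 : nat) (E : 'M[int]_(p1, p2)) : 'M[rat]_(p1, p2) := map_mx intr E.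
have qD : q _ _ D = colsub g C0 by apply/matrixP => a b; rewrite !mxE.
have uD : q _ _ D \in unitmx.
  rewrite qD -unitmx_tr (_ : _^T = rowsub g C0^T); first exact: fullrowsub_unit.
  by apply/matrixP => a b; rewrite !mxE.
have detD : \det D != 0.
  by move: uD; rewrite unitmxE unitfE /q det_map_mx intr_eq0.
have evf_inj : injective (ev \o f).
  by apply: inj_comp; [exact: enum_val_inj|exact: maxrankfun_inj].
have t0f a : ev (f a) != ev t0.
  by apply/eqP => /enum_val_inj E; case/negP: Ht0; rewrite -E codom_f.
have zt i : z 0 i = \det D *+ (i == ev t0) - \sum_a w 0 a *+ (ev (f a) == i).
  rewrite !mxE eqxx /= mulr_natr; congr (_ - _).
  by apply: eq_bigr => a _; rewrite !mxE mulr_natr.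
have zt0 : z 0 (ev t0) = \det D.
  rewrite zt eqxx big1 ?subr0 // => a _; by rewrite (negbTE (t0f a)).
have zf a : z 0 (ev (f a)) = - w 0 a.
  rewrite zt (negbTE (t0f a)) add0r (bigD1 a) //= eqxx big1 ?addr0 // => b ba.
  by rewrite (inj_eq evf_inj) (negbTE ba).
have zout i : i != ev t0 -> (forall a, ev (f a) != i) -> z 0 i = 0.
  by move=> H1 H2; rewrite zt (negbTE H1) big1 ?subr0 // => a _; rewrite (negbTE (H2 a)).
have zB : q _ _ z *m (map_mx intr B)^T = 0.
  (* Row t0 is a rational combination e of the chosen rows. Restricted to the columns [g] this reads
     c = e D, so c adj(D) = det(D) e and [z] annihilates every column of [C], not only the selected
     ones. *)
  have /submxP [e He] : (row t0 C <= C0)%MS by rewrite eq_maxrowsub row_sub.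
  have qc : q _ _ c = e *m q _ _ D.
    rewrite qD mulmx_colsub -He; apply/rowP => b; rewrite !mxE.
    by [].
  have -> : q _ _ z = (\det (q _ _ D)) *: delta_mx 0 (ev t0) -
      q _ _ c *m \adj (q _ _ D) *m rowsub (ev \o f) 1%:M.
    rewrite /q /z map_mxB map_mxZ map_delta_mx det_map_mx -map_mx_adj !map_mxM.
    congr (_ - _ *m _); apply/matrixP => a b; rewrite !mxE.
    by case: (_ == _).
  rewrite mulmxBl -scalemxAl -rowE -(mulmxA (q _ _ c *m _)) -rowsubE.
  have -> : rowsub (ev \o f) (map_mx intr B)^T = C0.
    by apply/matrixP => a b; rewrite !mxE.
  have -> : row (ev t0) (map_mx intr B)^T = row t0 C.
    by apply/rowP => b; rewrite !mxE.
  by rewrite qc He -(mulmxA e) mul_mx_adj mul_mx_scalar -scalemxAl subrr.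
have Bz : B *m z^T = 0.
  have E : map_mx (intr : int -> rat) (B *m z^T) = 0.
    by rewrite map_mxM -[LHS]trmxK trmx_mul -!map_trmx trmxK zB trmx0.
  apply/matrixP => i j; apply/eqP; rewrite [X in _ == X]mxE -(intr_eq0 rat).
  by have := congr1 (fun Y : 'cV_m => Y i j) E; rewrite [LHS]mxE [RHS]mxE => ->.
have ri : (r < n)%N.
  apply: leq_trans rkC _; rewrite -[X in (_ <= X)%N](card_ord n); exact: max_card.
have n0 : (0 < n)%N by apply: leq_trans ri.
exists z^T; split => //.
- apply/negP => /eqP E; have := congr1 (fun y : 'cV_n => y (ev t0) 0) E.
  by rewrite mxE zt0 mxE => /eqP; rewrite (negbTE detD).
- apply: leq_trans xk; apply/subset_leq_card/subsetP => i; rewrite inE mxE => zi.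
  have [->|Hi] := eqVneq i (ev t0); first exact: enum_valP.
  have [/existsP [a /eqP <-]|] := boolP [exists a, ev (f a) == i]; first exact: enum_valP.
  rewrite negb_exists => /forallP H; case/eqP: zi.
  exact: zout.
- move=> i; rewrite mxE.
  have HF : ((r`! * M ^ r)%N%:Z <= ((n * M) ^ n)%N%:Z).
    by rewrite lez_nat; apply: fact_exp_bound => //; apply: ltnW.
  have [->|Hi] := eqVneq i (ev t0).
    by rewrite zt0; apply: le_trans HF; apply: det_bound => a b; rewrite mxE.
  have [/existsP [a /eqP <-]|] := boolP [exists a, ev (f a) == i]; last first.
    by rewrite negb_exists => /forallP H; rewrite zout ?normr0.
  rewrite zf normrN; apply: le_trans HF; rewrite mxE.
  apply: le_trans (ler_norm_sum _ _ _) _.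
  (* Each entry is a sum of r products of an entry of [B] with a cofactor of order r - 1, and r M
     (r-1)! M^(r-1) = r! M^r. *)
  apply: (@le_trans _ _ (\sum_(b < r) (M * ((r.-1)`! * M ^ r.-1))%N%:Z)).
    apply: ler_sum => b _; rewrite normrM PoszM ler_pM //; first by rewrite mxE.
    rewrite mxE /cofactor normrM normrX normrN1 expr1n mul1r.
    by apply: det_bound => u v; rewrite !mxE.
  rewrite sumr_const card_ord -mulr_natr -natz -natrM natz lez_nat.
  have r0 : (0 < r)%N by apply: leq_ltn_trans (ltn_ord a).
  rewrite -[X in (_ <= X`! * M ^ X)%N](prednK r0) factS expnS (prednK r0).
  by move: (r.-1)`! (M ^ r.-1)%N => u v; nia.
Qed.

Local Close Scope ring_scope.

(** * Codes of rationals and matrices, and their values *)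

Lemma bval_lt l : bval l < 2 ^ size l.
Proof. by elim: l => //= b l IH; rewrite expnS; case: b => /=; lia. Qed.

Lemma canon_size l s : canon l -> bval l < 2 ^ s -> size l <= s.
Proof.
elim: l s => // b l IH s Hc.
case: l IH Hc => [|c l] IH Hc; first by case: s => //=; move: Hc; rewrite /canon /= => ->.
case: s => [|s].
  move=> H; have E : bval (b :: c :: l) = 0 by move: H; rewrite expn0; lia.
  by have := canon_bval0 Hc E.
by rewrite expnS ltnS => H; apply: IH; [exact: (canon_behead Hc)|move: H => /=; lia].
Qed.

Lemma size_bits_le v s : v < 2 ^ s -> size (bits v) <= s.
Proof. by move=> H; apply: canon_size; rewrite ?canon_bits ?bval_bits. Qed.

Lemma bval_eq0 l : (bval l == 0) = ~~ has id l.
Proof. by elim: l => //= b l IH; rewrite negb_or -IH; case: b => /=; lia. Qed.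

Lemma nilp_bits v : nilp (bits v) = (v == 0).
Proof.
apply/nilP/eqP => [E|->] //; first by rewrite -(bval_bits v) E.
Qed.

Definition raw_of (q : rat) : raw := ((numq q < 0)%R, (bits `|numq q|, bits `|denq q|)).

Definition rawlist m n (A : 'M[rat]_(m, n)) : seq raw :=
  [seq raw_of (A i j) | i <- enum 'I_m, j <- enum 'I_n].

Definition rval (q : raw) : rat :=
  ((if q.1 then -1 else 1) * (bval q.2.1)%:R / (bval q.2.2)%:R)%R.

Lemma raw_ofK q : rval (raw_of q) = q.
Proof.
rewrite /rval /= !bval_bits -[RHS]divq_num_den; congr (_ / _)%R.
  rewrite pmulrn; case: (ltrP (numq q) 0) => H.
    by rewrite mulN1r -mulrNz; congr (_%:~R)%R; lia.
  by rewrite mul1r; congr (_%:~R)%R; lia.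
by rewrite pmulrn; congr (_%:~R)%R; have := denq_gt0 q; lia.
Qed.

(** A triple that passes the syntactic tests and is in lowest terms is the code of its own value;
    this is what turns a well-formed word back into an instance. *)
Lemma rvalK (q : raw) : ~~ bad_raw q -> coprime (bval q.2.1) (bval q.2.2) -> raw_of (rval q) = q.
Proof.
case: q => s [a d]; rewrite /bad_raw /= !negb_or !negbK => /and4P [ca cd nd ns] co.
have d0 : bval d <> 0 by move=> /(canon_bval0 cd) E; rewrite E in nd.
pose u : int := (if s then - Posz (bval a) else Posz (bval a))%R.
have Er : rval (s, (a, d)) = (u%:~R / (Posz (bval d))%:~R)%R.
  rewrite /rval /u /=; case: (s); rewrite ?mulN1r ?mul1r //.
  by rewrite rmorphN.
have dz : (Posz (bval d) != 0)%R by apply/eqP => E; apply: d0; lia.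
have cu : coprime `|u|%N `|Posz (bval d)|%N by rewrite /u; case: (s); rewrite ?abszN.
rewrite /raw_of Er coprimeq_num // coprimeq_den //.
rewrite (negbTE dz) gtr0_sg ?mul1r; last by lia.
congr (_, (_, _)).
- rewrite /u; case: s ns {Er u cu} => /= ns; last lia.
  suff : bval a <> 0 by lia.
  by move=> /(canon_bval0 ca) E; rewrite E in ns.
- rewrite -[RHS](bits_bval ca); congr bits; rewrite /u; case: (s); lia.
- by rewrite -[RHS](bits_bval cd); congr bits; lia.
Qed.

Lemma enc_instance_word m n (A : 'M[rat]_(m, n)) k :
  enc_instance A k = word (bits m) (bits n) (rawlist A) (bits k).
Proof.
have pE t s : pair_enc t [::] ++ s = pair_enc t s by rewrite !pair_encE -catA.
rewrite /enc_instance /word /enc_nat -!/(pair_enc _ [::]) !pE; congr (pair_enc _ (pair_enc _ _)).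
pose qs := [seq A i j | i <- enum 'I_m, j <- enum 'I_n].
have -> : rawlist A = map raw_of qs by rewrite /qs map_allpairs.
have -> : [seq enc_rat (A i j) | i <- enum 'I_m, j <- enum 'I_n] = map enc_rat qs.
  by rewrite /qs map_allpairs.
elim: qs => //= q s IH.
by rewrite -catA IH /enc_rat /enc_int /enc_nat /pair_enc /= -!catA.
Qed.

Lemma size_rawlist m n (A : 'M[rat]_(m, n)) : size (rawlist A) = m * n.
Proof. by rewrite /rawlist size_allpairs !size_enum_ord. Qed.

Lemma parse_instance m n (A : 'M[rat]_(m, n)) k :
  parse (enc_instance A k) = Some (bits m, (bits n, (rawlist A, bits k))).
Proof. by rewrite enc_instance_word parse_word // size_rawlist !bval_bits. Qed.

Lemma rows_flatten (T : Type) n (ss : seq (seq T)) i :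
  all (fun s => size s == n) ss -> i < size ss ->
  take n (drop (i * n) (flatten ss)) = nth [::] ss i.
Proof.
elim: ss i => // s ss IH [|i] /= /andP [/eqP Hs Hss] Hi; first by rewrite mul0n drop0 take_size_cat.
by rewrite mulSn addnC -drop_drop drop_size_cat // IH.
Qed.

Lemma row_rawlist m n (A : 'M[rat]_(m, n)) (i : 'I_m) :
  take n (drop (i * n) (rawlist A)) = [seq raw_of (A i j) | j <- enum 'I_n].
Proof.
rewrite rows_flatten; first by rewrite (nth_map i) ?size_enum_ord // nth_ord_enum.
  by apply/allP => s /mapP [t _ ->]; rewrite size_map size_enum_ord.
by rewrite size_map size_enum_ord.
Qed.

Section RowSum.
Local Open Scope ring_scope.

Definition evalue (e : seq bool * seq bool) : rat := (bval e.1)%:R - (bval e.2)%:R.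

Lemma row_okP (l : seq (raw * (seq bool * seq bool))) :
  (forall e, e \in l -> bval e.1.2.2 <> 0%N) ->
  row_ok l = (\sum_(e <- l) rval e.1 * evalue e.2 == 0).
Proof.
pose sv (s : seq bool * seq bool * seq bool) : rat := ((bval s.1.1)%:R - (bval s.1.2)%:R) / (bval s.2)%:R.
suff H s : bval s.2 <> 0%N -> (forall e, e \in l -> bval e.1.2.2 <> 0%N) ->
    let t := foldl row_step s l in
    bval t.2 <> 0%N /\ sv t = sv s + \sum_(e <- l) rval e.1 * evalue e.2.
  move=> Hl; have [|t0 tE] := H ([::], [::], [:: true]) _ Hl => //.
  rewrite /row_ok /= eqvP -[X in _ = (X == 0)]add0r.
  have -> : 0 = sv ([::], [::], [:: true]) by rewrite /sv /= subrr mul0r.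
  rewrite -tE /sv /=; set t := foldl _ _ _.
  rewrite subrr mul0r mulf_eq0 invr_eq0 pnatr_eq0 (introF eqP t0) orbF subr_eq0.
  by rewrite eqr_nat.
elim: l s => [|e l IH] s s0 Hl /=; first by rewrite big_nil addr0.
have e0 : bval e.1.2.2 <> 0%N by apply: Hl; rewrite mem_head.
have step0 : bval (row_step s e).2 <> 0%N by rewrite /row_step /= bval_mul; lia.
have [|t0 ->] := IH _ step0; first by move=> e' He'; apply: Hl; rewrite inE He' orbT.
split=> //; rewrite big_cons addrA; congr (_ + _).
rewrite /sv /row_step /= !bval_add !bval_mul /rval /evalue.
case: e e0 {Hl step0 IH t0} => [[b [a d]] [p q]] /= d0.
have dn : (bval d)%:R != 0 :> rat by rewrite pnatr_eq0; apply/eqP.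
have sn : (bval s.2)%:R != 0 :> rat by rewrite pnatr_eq0; apply/eqP.
by rewrite !natrD !natrM; case: b; field; rewrite dn sn.
Qed.

Lemma sum_zip (T U : Type) (F : T -> U -> rat) (a : T) (b : U) (s : seq T) (t : seq U) n :
  (forall x, F x b = 0) -> size s = n ->
  \sum_(e <- zip s t) F e.1 e.2 = \sum_(j < n) F (nth a s j) (nth b t j).
Proof.
move=> Fb <-; elim: s t => [|x s IH] [|y t] /=; rewrite ?big_nil ?big_ord0 //.
  by rewrite big1 // => j _; rewrite nth_nil.
by rewrite big_cons big_ord_recl IH.
Qed.
End RowSum.

Lemma card_nth_count (T : Type) (P : pred T) (d : T) (s : seq T) n : ~~ P d ->
  #|[set i : 'I_n | P (nth d s i)]| <= count P s.
Proof.
move=> Pd; rewrite -sum1_card (eq_bigl (fun i : 'I_n => P (nth d s i))); last by move=> i; rewrite inE.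
rewrite big_mkcond /=; elim: s n => [|x s IH] n.
  by rewrite big1 // => i _; rewrite nth_nil (negbTE Pd).
case: n => [|n]; first by rewrite big_ord0.
by rewrite big_ord_recl /=; apply: leq_add; [case: (P x)|apply: IH].
Qed.

(** As soon as there are entries they outnumber both dimensions. The alternative n = 0 has to stay,
    since m is then not bounded by the length of the code. *)
Lemma dim_le_size m n (A : 'M[rat]_(m, n)) k : 0 < m -> n <= size (enc_instance A k) /\ m <= size (enc_instance A k) \/ n = 0.
Proof.
move=> m0; case: n A => [|n] A; [by right|left].
rewrite enc_instance_word; have := size_word (bits m) (bits n.+1) (rawlist A) (bits k).
rewrite size_rawlist; have : n.+1 <= m * n.+1 by rewrite leq_pmull.
have : m <= m * n.+1 by rewrite leq_pmulr.
lia.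
Qed.

(** * Soundness and completeness of certificates *)

Section KerOk.
Variables (m n : nat) (A : 'M[rat]_(m, n)) (k : nat).
Let L := size (enc_instance A k).
Hypothesis m0 : 0 < m.

Lemma capvalE_rows : capval L (bits n) = n.
Proof.
rewrite capvalE bval_bits; case: (dim_le_size A k m0) => [[Hn _]|->]; last by rewrite min0n.
by apply/minn_idPl.
Qed.

Lemma row_sum (xs : seq (seq bool * seq bool)) (i : 'I_m) :
  row_ok (zip (take n (drop (i * n) (rawlist A))) xs) =
  (\sum_(j < n) A i j * evalue (nth ([::], [::]) xs j) == 0)%R.
Proof.
rewrite row_rawlist row_okP; last first.
  move=> [q e] He /=.
  have /mapP [j _ ->] : q \in [seq raw_of (A i j) | j <- enum 'I_n].
    move: He; move: (map _ _) => s; elim: s (xs) => [|a s IH] [|b t] //=.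
    by rewrite !inE => /orP [/eqP [-> _]|/IH ->]; rewrite ?eqxx ?orbT.
  by rewrite /= bval_bits; have := denq_gt0 (A i j); lia.
have -> : (\sum_(e <- zip [seq raw_of (A i j) | j <- enum 'I_n] xs) rval e.1 * evalue e.2 =
   \sum_(j < n) rval (nth (raw_of 0) [seq raw_of (A i j) | j <- enum 'I_n] j) * evalue (nth ([::], [::]) xs j))%R.
  apply: (sum_zip (F := fun q e => rval q * evalue e)%R); last by rewrite size_map size_enum_ord.
  by move=> x; rewrite /evalue /= subrr mulr0.
congr (_ == _); apply: eq_bigr => j _.
by rewrite (nth_map j) ?size_enum_ord // nth_ord_enum raw_ofK.
Qed.

Lemma ker_ok_sound toks :
  ker_ok L (bits m) (bits n) (rawlist A) (bits k) toks -> sparse_kernel A k.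
Proof.
rewrite /ker_ok capvalE_rows; set xs := zip _ _ => /and3P [Hc Hh Ha].
have sxs : size xs <= n.
  by rewrite /xs size_zip size_take_min; apply: leq_trans (geq_minl _ _) (geq_minl _ _).
pose x : 'cV[rat]_n := (\col_i evalue (nth ([::], [::]) xs i))%R.
have xE i : (x i 0 = evalue (nth ([::], [::]) xs i))%R by rewrite mxE.
exists x; split.
- have /(has_nthP ([::], [::])) [i Hi /andP [Hp /nilP Hq]] := Hh.
  apply/eqP => E; have := xE (Ordinal (leq_trans Hi sxs)); rewrite E mxE /evalue /= Hq /= subr0.
  by move/esym/eqP; rewrite pnatr_eq0 bval_eq0 Hp.
- apply/colP => i; rewrite [RHS]mxE mxE; apply/eqP.
  have : row_ok (zip (take n (drop (i * n) (rawlist A))) xs).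
    apply: (allP Ha); rewrite mem_iota add0n /= capvalE bval_bits.
    case: (dim_le_size A k m0) => [[_ Hm]|n0]; first by rewrite (minn_idPl Hm).
    (* For n = 0 the list [xs] is empty, which contradicts [Hh]. *)
    by move: Hh; rewrite /xs n0 !take0.
  rewrite row_sum => /eqP E; rewrite -[X in _ == X]E; apply/eqP/eq_bigr => j _.
  by rewrite xE.
- apply: leq_trans (leq_trans Hc _); last by rewrite capvalE bval_bits geq_minl.
  apply: leq_trans (card_nth_count xs n (isT : ~~ nonzero ([::], [::]))).
  apply/subset_leq_card/subsetP => i; rewrite !inE xE /evalue /nonzero.
  rewrite -[has _ _]negbK -bval_eq0 -[has id (nth _ _ _).2]negbK -bval_eq0.
  by apply: contraR; rewrite negb_or !negbK => /andP [/eqP -> /eqP ->]; rewrite subrr.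
Qed.

Lemma ker_ok_complete (p q : 'I_n -> nat) :
  (exists i, 0 < p i /\ q i = 0) ->
  (A *m (\col_i ((p i)%:R - (q i)%:R)) = 0)%R ->
  #|[set i | (p i != 0) || (q i != 0)]| <= k ->
  ker_ok L (bits m) (bits n) (rawlist A) (bits k)
    ([seq bits (p i) | i <- enum 'I_n] ++ [seq bits (q i) | i <- enum 'I_n]).
Proof.
move=> [i0 [p0 q0]] Az Sk; rewrite /ker_ok capvalE_rows.
rewrite take_size_cat; last by rewrite size_map size_enum_ord.
rewrite drop_size_cat; last by rewrite size_map size_enum_ord.
rewrite [take n _]take_oversize; last by rewrite size_map size_enum_ord.
rewrite zip_map.
set xs := map _ _; have nz v : has id (bits v) = (v != 0).
  by rewrite -[has _ _]negbK -bval_eq0 bval_bits.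
have cE : count nonzero xs = #|[set i | (p i != 0) || (q i != 0)]|.
  rewrite /xs count_map -sum1_count big_enum_cond -sum1_card.
  by apply: eq_bigl => i; rewrite !inE /nonzero /= !nz.
apply/and3P; split.
- rewrite capvalE bval_bits leq_min cE Sk /=.
  apply: leq_trans (max_card _) _; rewrite card_ord.
  by case: (dim_le_size A k m0) => [[]|->].
- apply/hasP; exists (bits (p i0), bits (q i0)); first by apply/mapP; exists i0; rewrite ?mem_enum.
  by rewrite /= nz nilp_bits q0 eqxx andbT -lt0n.
- apply/allP => i; rewrite mem_iota add0n capvalE bval_bits => /andP [_ Hi].
  have im : i < m by apply: leq_trans Hi (geq_minl _ _).
  rewrite (row_sum _ (Ordinal im)); apply/eqP.
  have := congr1 (fun y : 'cV_m => y (Ordinal im) 0%R) Az; rewrite [in X in _ -> X]/=.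
  rewrite [X in X = _ -> _]mxE [X in _ = X -> _]mxE => E; rewrite -[RHS]E.
  apply: eq_bigr => j _; rewrite mxE (nth_map j) ?size_enum_ord // nth_ord_enum.
  by rewrite /evalue /= !bval_bits.
Qed.
End KerOk.

(** On the code of an instance no syntax error is possible and a common factor contradicts lowest
    terms; what remains is a sparse kernel vector, a unit vector if there are no rows. *)
Lemma check_sound (R : realType) w y : check w y -> ~ NSP_language R w.
Proof.
move=> Hc [m [n [A [k [k0 [Hw [alpha [a1 HN]]]]]]]]; move: Hc; rewrite /check Hw parse_instance.
rewrite !canon_bits nilp_bits (gtn_eqF k0) /= => /or3P [].
- case/hasP => q /allpairsP [[i j] [_ _ ->]] /=.
  rewrite /bad_raw /= !canon_bits !nilp_bits /=; have := denq_gt0 (A i j).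
  by case: ltrP; lia.
- case/andP => d1 /hasP [q /allpairsP [[i j] [_ _ ->]]]; rewrite /reducible /= !eqvP !bval_mul !bval_bits.
  set d := bval (head [::] (tokens y)); move=> /andP [/eqP Hn /eqP Hd].
  have : d %| gcdn `|numq (A i j)| `|denq (A i j)| by rewrite dvdn_gcd Hn Hd !dvdn_mulr.
  have /eqP -> : coprime `|numq (A i j)| `|denq (A i j)| by exact: coprime_num_den.
  rewrite dvdn1 => /eqP dE; move: d1; rewrite trimE -/d dE.
  by [].
- rewrite !nilp_bits; case: eqP => [m0 n0|/eqP m0 Hk].
    apply: (@sparse_kernel_not_NSP R _ _ A k _ alpha a1) => //.
    have n0' : 0 < n by rewrite lt0n.
    exists (delta_mx (Ordinal n0') 0%R); split.
    + apply/eqP => E; have := congr1 (fun y : 'cV_n => y (Ordinal n0') 0%R) E.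
      by rewrite !mxE !eqxx => /eqP; rewrite oner_eq0.
    + by apply/matrixP => i; move: (ltn_ord i); rewrite {2}m0.
    + apply: leq_trans k0; apply: (@leq_trans #|[set Ordinal n0']|); last by rewrite cards1.
      apply/subset_leq_card/subsetP => i.
      by rewrite !inE mxE; case: (i == _) => //=; rewrite eqxx.
  apply: (@sparse_kernel_not_NSP R _ _ A k _ alpha a1) => //.
  by apply: ker_ok_sound Hk; rewrite lt0n.
Qed.

Lemma raw_bound m n (A : 'M[rat]_(m, n)) k i j :
  `|numq (A i j)| < 2 ^ size (enc_instance A k) /\ `|denq (A i j)| < 2 ^ size (enc_instance A k).
Proof.
have H q rs t : q \in rs -> size q.2.1 + size q.2.2 <= size (rats_word rs t).
  by elim: rs => //= q' rs IH; rewrite inE !size_pair_enc => /orP [/eqP ->|/IH]; lia.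
have Hq : raw_of (A i j) \in rawlist A.
  by apply/allpairsP; exists (i, j); rewrite !mem_enum.
have := H _ _ (pair_enc (bits k) [::]) Hq; rewrite /= => HL.
have {}HL : size (bits `|numq (A i j)|) <= size (enc_instance A k) /\ size (bits `|denq (A i j)|) <= size (enc_instance A k).
  by rewrite enc_instance_word /word !size_pair_enc; lia.
have := bval_lt (bits `|numq (A i j)|); have := bval_lt (bits `|denq (A i j)|); rewrite !bval_bits => H1 H2.
by split; [apply: leq_trans H2 _|apply: leq_trans H1 _]; rewrite leq_pexp2l //; case: HL.
Qed.

(** A certificate has at most 2L words (three if it exhibits a common factor) of at most (2L + L^2)
    L + 1 bits each, doubled by the self-delimiting code. *)
Definition cert_bound (L : nat) : nat := 20 * (L + 2) ^ 4.

Lemma cert_boundP L s c : s <= (2 * L + L * L) * L + 1 -> c <= 2 * L + 3 ->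
  c * (2 * s + 2) <= cert_bound L.
Proof.
move=> Hs Hc; apply: (@leq_trans ((2 * L + 3) * (2 * ((2 * L + L * L) * L + 1) + 2))).
  by rewrite leq_mul // leq_add2r leq_mul2l.
rewrite /cert_bound !expnS expn0; nia.
Qed.

Lemma check_of_sparse m n (A : 'M[rat]_(m, n)) k : sparse_kernel A k ->
  exists y, size y <= cert_bound (size (enc_instance A k)) /\ check (enc_instance A k) y.
Proof.
move=> HA; rewrite /check parse_instance !nilp_bits; set L := size _.
case: (posnP m) => [m0|m0].
  exists [::]; split => //; have [x [x0 _ _]] := HA.
  suff -> : n != 0 by rewrite !orbT.
  apply/eqP => n0; case/eqP: x0; apply/matrixP => i; by move: (ltn_ord i); rewrite {2}n0.
have nL : n <= L by case: (dim_le_size A k m0) => [[]|->].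
(* Each row is multiplied by the product of its denominators, which leaves the kernel unchanged. *)
pose B : 'M[int]_(m, n) := (\matrix_(i, j) (numq (A i j) * \prod_(j' < n | j' != j) denq (A i j')))%R.
pose D i : rat := (\prod_(j < n) (denq (A i j))%:~R)%R.
have D0 i : (D i != 0)%R by apply/prodf_neq0 => j _; rewrite intr_eq0 denq_eq0.
have BE i j : ((B i j)%:~R = A i j * D i)%R.
  rewrite mxE /D [in RHS](bigD1 j) //= mulrA rmorphM /= rmorph_prod /=; congr (_ * _)%R.
  by rewrite -{2}[A i j]divq_num_den mulfVK // intr_eq0 denq_eq0.
have kerE (x : 'cV[rat]_n) : ((map_mx intr B *m x == 0) = (A *m x == 0))%R.
  have E i : ((map_mx intr B *m x) i 0 = D i * (A *m x) i 0)%R.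
    rewrite !mxE mulr_sumr; apply: eq_bigr => j _.
    by rewrite mxE BE -mulrA mulrCA.
  apply/eqP/eqP => H; apply/colP => i; have := E i; rewrite H !mxE.
    by move/esym/eqP; rewrite mulf_eq0 (negbTE (D0 i)) /= => /eqP.
  by rewrite mulr0.
(* One numerator and at most L denominators, each below 2^L. *)
pose M := 2 ^ (L + L * L).
have HB i j : (`|B i j| <= Posz M)%R.
  rewrite mxE normrM normr_prod /M expnD PoszM.
  have [Hn _] := raw_bound A k i j; rewrite -/L in Hn.
  apply: ler_pM; rewrite ?normr_ge0 //; [exact: prodr_ge0|by rewrite -abszE lez_nat ltnW|].
  apply: (@le_trans _ _ (\prod_(j' < n | j' != j) (2 ^ L)%:Z)%R).
    apply: ler_prod => j' _; rewrite normr_ge0 -abszE lez_nat /=.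
    by have [_ Hd] := raw_bound A k i j'; apply: ltnW.
  rewrite prodr_const -natz -natrX natz lez_nat -expnM leq_pexp2l // leq_mul2l.
  apply/orP; right; apply: leq_trans (max_card _) _.
  by rewrite card_ord.
have [x [x0 /eqP Ax Sx]] := HA.
have M0 : 0 < M by rewrite expn_gt0.
have [z [z0 Bz Sz zb]] : exists z : 'cV[int]_n, [/\ (z != 0)%R, (B *m z = 0)%R,
    #|[set i | (z i ord0 != 0)%R]| <= k & forall i, (`|z i 0| <= ((n * M) ^ n)%N%:Z)%R].
  by apply: (integral_kernel M0 HB); exists x; split=> //; apply/eqP; rewrite kerE.
(* [ker_ok] looks for a positive entry; replace z by -z if necessary. *)
wlog [i0 zi0] : z z0 Bz Sz zb / exists i, (0 < z i 0)%R.
  move=> W; have [i zi] : exists i, (z i 0 != 0)%R.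
    apply/existsP; apply: contraR z0; rewrite negb_exists => /forallP zz.
    by apply/eqP/colP => i; rewrite mxE; apply/eqP; rewrite -[_ == _]negbK zz.
  case: (ltrP 0%R (z i 0%R)) => Hi; first by apply: (W z) => //; exists i.
  apply: (W (- z)%R).
  - by rewrite oppr_eq0.
  - by rewrite mulmxN Bz oppr0.
  - by congr (_ <= _): Sz; apply: eq_card => j; rewrite !inE mxE oppr_eq0.
  - by move=> j; rewrite mxE normrN.
  - by exists i; rewrite mxE oppr_gt0 lt_neqAle zi.
pose p (i : 'I_n) : nat := if (0 < z i 0)%R then `|z i 0%R|%N else 0.
pose q (i : 'I_n) : nat := if (0 < z i 0)%R then 0 else `|z i 0%R|%N.
have pq i : ((p i)%:R - (q i)%:R = (z i 0)%:~R :> rat)%R.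
  rewrite /p /q; case: ltrP => Hz; rewrite ?subr0 ?sub0r pmulrn.
    by congr (_%:~R)%R; lia.
  by rewrite -mulrNz; congr (_%:~R)%R; lia.
have HK := @ker_ok_complete m n A k m0 p q.
exists (flatten [seq pair_enc t [::] | t <- [seq bits (p i) | i <- enum 'I_n] ++ [seq bits (q i) | i <- enum 'I_n]]).
split; last first.
  rewrite tokens_enc HK ?orbT //.
  - by exists i0; rewrite /p /q zi0; split => //; lia.
  - apply/eqP; rewrite -kerE; apply/eqP.
    have -> : (\col_i ((p i)%:R - (q i)%:R) = map_mx intr z :> 'cV[rat]_n)%R.
      by apply/colP => i; rewrite !mxE pq.
    by rewrite -map_mxM Bz map_mx0.
  - apply: leq_trans Sz; apply/subset_leq_card/subsetP => i; rewrite !inE /p /q.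
    by case: ltrP => _ /=; rewrite ?orbF absz_eq0.
(* From n <= L <= 2^L and the value of [M], (n M)^n is at most 2^((2L + L^2) L). *)
have zlt i : `|z i 0%R|%N < 2 ^ ((2 * L + L * L) * L + 1).
  apply: leq_ltn_trans (_ : 2 ^ ((2 * L + L * L) * L) < _); last by rewrite ltn_exp2l // addn1.
  have := zb i; rewrite -abszE lez_nat => H; apply: leq_trans H _.
  have n0 : 0 < n by apply: leq_ltn_trans (ltn_ord i).
  rewrite expnM; apply: (@leq_trans ((n * M) ^ L)); first by rewrite leq_pexp2l // muln_gt0 n0 M0.
  apply: leq_expl; rewrite (_ : 2 * L + L * L = L + (L + L * L)); last lia.
  rewrite expnD leq_mul //; apply: leq_trans nL (ltnW (ltn_expl _ _)) => //.
apply: leq_trans (size_tokens_enc (M := (2 * L + L * L) * L + 1) _) _.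
  move=> t; rewrite mem_cat => /orP [] /mapP [i _ ->]; apply: size_bits_le; rewrite /p /q; case: ifP => _ //;
    by rewrite expn_gt0.
rewrite size_cat 2!(size_map _ (enum 'I_n)) size_enum_ord; apply: cert_boundP => //; lia.
Qed.

(** A syntax error gets the empty certificate, a reducible fraction its gcd with the two quotients.
    Any other word is the code of a matrix rebuilt from its entries, and failure of the nullspace
    property yields a sparse kernel vector. *)
Lemma check_complete (R : realType) w : ~ NSP_language R w ->
  exists y, size y <= cert_bound (size w) /\ check w y.
Proof.
move=> Hw; case Hp: (parse w) => [[m [n [rs k]]]|]; last by exists [::]; rewrite /check Hp.
have [wE srs] := parseP Hp.
case bad : [|| ~~ canon m, ~~ canon n, ~~ canon k, nilp k | has bad_raw rs].
  by exists [::]; split => //; rewrite /check Hp; move: bad => /or4P [->|->|->|/orP [->|->]]; rewrite ?orbT.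
move/negbT: (bad); rewrite !negb_or !negbK => /and5P [cm cn ck nk nb].
have [allco|] := boolP (all (fun q : raw => coprime (bval q.2.1) (bval q.2.2)) rs); last first.
  rewrite -has_predC => /hasP [q qrs /= nco].
  have nbq : ~~ bad_raw q by apply: contra nb => H; apply/hasP; exists q.
  have d0 : 0 < bval q.2.2.
    rewrite lt0n; apply/eqP => E; move: nbq; rewrite /bad_raw !negb_or !negbK => /and4P [_ cd nd _].
    by move: nd; rewrite (canon_bval0 cd E).
  pose g := gcdn (bval q.2.1) (bval q.2.2).
  have g0 : 0 < g by rewrite gcdn_gt0 d0 orbT.
  pose toks := [:: bits g; bits (bval q.2.1 %/ g); bits (bval q.2.2 %/ g)].
  exists (flatten [seq pair_enc t [::] | t <- toks]); split.
    apply: leq_trans (size_tokens_enc (M := size w) _) _.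
      have sq : size q.2.1 <= size w /\ size q.2.2 <= size w.
        rewrite wE /word !size_pair_enc; elim: (rs) qrs => //= q' rs' IH.
        by rewrite inE !size_pair_enc => /orP [/eqP <-|/IH]; lia.
      have lt1 v s : v <= bval s -> size s <= size w -> size (bits v) <= size w.
        move=> H1 H2; apply: size_bits_le; apply: leq_ltn_trans H1 _.
        by apply: leq_trans (bval_lt s) _; rewrite leq_pexp2l.
      case: sq => s1 s2 t; rewrite !inE => /or3P [] /eqP ->.
      - by apply: (lt1 _ q.2.2) => //; apply: dvdn_leq; rewrite ?dvdn_gcdr.
      - by apply: (lt1 _ q.2.1) => //; apply: leq_div.
      - by apply: (lt1 _ q.2.2) => //; apply: leq_div.
    apply: cert_boundP; [|rewrite /=; lia].
    have : 0 < size w by rewrite wE /word size_pair_enc; lia.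
    by move: (size w) => u; nia.
  rewrite /check Hp tokens_enc /=.
  have -> : 1 < size (trim (bits g)).
    rewrite trimE bval_bits; move: nco; rewrite /coprime -/g.
    have := bval_bits g; move: g0; case: (bits g) => [|b [|c s]] //=; [lia|case: b; lia].
  suff -> : has (reducible toks) rs by rewrite !orbT.
  apply/hasP; exists q => //; rewrite /reducible /= !eqvP !bval_mul !bval_bits.
  by rewrite mulnC divnK ?dvdn_gcdl // mulnC divnK ?dvdn_gcdr // !eqxx.
pose A : 'M[rat]_(bval m, bval n) := (\matrix_(i, j) rval (nth (false, ([::], [::])) rs (i * bval n + j)))%R.
have rsE : rawlist A = rs.
  have K q : q \in rs -> raw_of (rval q) = q.
    move=> qrs; apply: rvalK; last by apply: (allP allco).
    by apply: contra nb => H; apply/hasP; exists q.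
  apply: (@eq_from_nth _ (false, ([::], [::]))); rewrite size_rawlist // => t Ht.
  have n0 : 0 < bval n by case: (bval n) Ht => //; rewrite muln0.
  have ti : t %/ bval n < bval m by rewrite ltn_divLR.
  have tj : t %% bval n < bval n by rewrite ltn_mod.
  have := row_rawlist A (Ordinal ti) => /(congr1 (fun s => nth (false, ([::], [::])) s (t %% bval n))).
  rewrite nth_take // nth_drop -divn_eq /= => ->.
  rewrite (nth_map (Ordinal tj)) ?size_enum_ord // -[t %% bval n]/(nat_of_ord (Ordinal tj)) nth_ord_enum.
  by rewrite mxE /= -divn_eq K // mem_nth // srs.
have wA : w = enc_instance A (bval k) by rewrite enc_instance_word rsE !bits_bval.
have HA : sparse_kernel A (bval k).
  apply: contrapT => /(NSP_of_not_sparse_kernel R) Hn; apply: Hw.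
  exists (bval m), (bval n), A, (bval k); split; last by split.
  by rewrite lt0n; apply/eqP => E; move: nk; rewrite (canon_bval0 ck E).
by rewrite wA; apply: check_of_sparse.
Qed.

Lemma NSP_inCoNP (R : realType) : inCoNP (NSP_language R).
Proof.
exists (fun z => verify z); split.
  exists (fun z => if verify z then [:: true] else [::]); split.
    apply: pf_FP; apply: pf_if; [exact: pf_verify|exact: pf_const|exact: pf_const].
  by move=> x; case: (verify x).
(* 20 (n + 2)^4 <= (n + 2)^9 because 20 <= 2^5, and the exponent 9 costs the constant 3^10 in
   [poly_bound]. *)
exists (3 ^ 10) => x; split => [/check_complete [y [Hy Hc]]|[y [_]]].
  exists y; split; last by rewrite /verify unpair_enc.
  by apply: leq_trans Hy _; apply: leq_trans (leq_poly_bound 9 _); apply: (@leq_exp_bound 20 _ 5 4).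
by rewrite /verify unpair_enc; apply: check_sound.
Qed.

(** * Exact subset sums as sparse kernel vectors *)

Section SumMatrix.
Variables (s : seq nat) (k T : nat).
Hypothesis us : uniq s.
Hypothesis k0 : 0 < k.
Local Open Scope ring_scope.

Definition sum_extra (i : nat) : nat := if i == k.-1 then 1%N else if i == k then T else 0%N.

Definition sum_matrix : 'M[rat]_(k.+1, (size s).+1) :=
  \matrix_(i, j) (if (j < size s)%N then (nth 0%N s j ^ i)%N else sum_extra i)%:R.

Let a (j : nat) : rat := (nth 0%N s j)%:R.

Let a_inj (i j : 'I_(size s)) : a i = a j -> i = j.
Proof.
move=> /eqP; rewrite eqr_nat nth_uniq // => /eqP E; exact: val_inj.
Qed.

Let w (j : 'I_(size s)) : 'I_(size s).+1 := widen_ord (leqnSn _) j.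

(* Combining the rows with the coefficients of [p] evaluates [p] at the [a j]
   and, in the last column, gives [p_(k-1) + T p_k]. *)
Let col_value (p : {poly rat}) j : (size p <= k.+1)%N ->
  \sum_(i < k.+1) p`_i * sum_matrix i (w j) = p.[a j].
Proof.
move=> sp; rewrite (horner_coef_wide _ sp); apply: eq_bigr => i _.
by rewrite mxE /= ltn_ord natrX.
Qed.

Let col_max (p : {poly rat}) :
  \sum_(i < k.+1) p`_i * sum_matrix i ord_max = p`_k.-1 + T%:R * p`_k.
Proof.
under eq_bigr => i _ do rewrite mxE /= ltnn.
have km : (k.-1 < k.+1)%N by lia.
rewrite (bigD1 (Ordinal km)) //= (bigD1 ord_max) /=; last first.
  by apply/eqP => /(congr1 (@nat_of_ord _)) /=; lia.
rewrite big1 ?addr0 => [|i /andP [i1 i2]].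
  rewrite /sum_extra eqxx mulr1; case: eqP => [|_]; first lia.
  by rewrite eqxx mulrC.
rewrite /sum_extra; case: eqP => [E|_]; first by case/eqP: i1; exact: val_inj.
case: eqP => [E|_]; first by case/eqP: i2; exact: val_inj.
by rewrite mulr0.
Qed.

(** A kernel vector is a linear relation, on polynomials of degree at most k, between the
    evaluations at the [a j] and the functional p_(k-1) + T p_k. It can thus be tested on
    well-chosen polynomials. *)
Lemma sum_matrix_poly (x : 'cV[rat]_(size s).+1) (p : {poly rat}) :
  sum_matrix *m x = 0 -> (size p <= k.+1)%N ->
  \sum_(j < size s) x (w j) 0 * p.[a j] +
    x ord_max 0 * (p`_k.-1 + T%:R * p`_k) = 0.
Proof.
move=> Mx sp; transitivity (\sum_(i < k.+1) p`_i * (sum_matrix *m x) i 0); last first.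
  by rewrite Mx big1 // => i _; rewrite mxE mulr0.
under [RHS]eq_bigr => i _ do rewrite mxE big_ord_recr /= mulrDr mulr_sumr.
rewrite big_split /=; congr (_ + _).
  rewrite exchange_big /=; apply: eq_bigr => j _.
  rewrite -(col_value _ sp) mulr_sumr; apply: eq_bigr => i _.
  by rewrite mulrC -mulrA.
rewrite -col_max mulr_sumr; apply: eq_bigr => i _.
by rewrite mulrC -mulrA.
Qed.

Let pJ (J : {set 'I_(size s)}) : {poly rat} :=
  \prod_(c <- [seq a (nat_of_ord j) | j <- enum J]) ('X - c%:P).

Let size_pJ J : size (pJ J) = #|J|.+1.
Proof. by rewrite /pJ size_prod_XsubC size_map -cardE. Qed.

Let pJ_eq0 J (j : 'I_(size s)) : ((pJ J).[a j] == 0) = (j \in J).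
Proof.
rewrite -[_ == 0]/(root (pJ J) (a j)) root_prod_XsubC; apply/mapP/idP => [[i]|Hj].
  by rewrite mem_enum => Hi /a_inj ->.
by exists j; rewrite ?mem_enum.
Qed.

Let pJ_lead (J : {set 'I_(size s)}) : (pJ J)`_#|J| = 1.
Proof.
have /eqP := monic_prod_XsubC [seq a (nat_of_ord j) | j <- enum J] xpredT id.
by rewrite lead_coefE -/(pJ J) size_pJ.
Qed.

Let pJ_next (J : {set 'I_(size s)}) : (0 < #|J|)%N -> (pJ J)`_#|J|.-1 = - \sum_(j in J) a j.
Proof.
move=> J0; have := @coefPn_prod_XsubC rat [seq a (nat_of_ord j) | j <- enum J].
rewrite size_map -cardE -lt0n J0 => /(_ isT); rewrite -/(pJ J) => ->.
by rewrite big_map big_enum.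
Qed.

(** If the extra coordinate were 0, at most k + 1 nodes would occur, and the polynomial vanishing at
    all of them but one would isolate a nonzero coordinate. So at most k nodes occur, and p_(k-1) +
    T p_k = 0 for every p of degree at most k that vanishes at them. With fewer than k nodes a monic
    p of degree k - 1 contradicts this; with exactly k, the monic p of degree k gives the sum T by
    Vieta. *)
Lemma sum_of_sparse_kernel : sparse_kernel sum_matrix k.+1 ->
  exists J : {set 'I_(size s)}, #|J| = k /\ \sum_(j in J) nth 0%N s j = T :> nat.
Proof.
move=> [x [x0 Mx Sx]].
pose J := [set j : 'I_(size s) | x (w j) 0 != 0].
have cJ : (#|J| + (x ord_max 0 != 0)%R <= k.+1)%N.
  apply: leq_trans Sx; rewrite /support.
  have wi : injective w by move=> i j /(congr1 (@nat_of_ord _)) /= E; apply: val_inj.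
  rewrite -(card_imset (mem J) wi) [X in (_ <= X)%N](cardsD1 ord_max) inE addnC leq_add2l.
  apply/subset_leq_card/subsetP => i /imsetP [j]; rewrite inE => Hj ->.
  rewrite !inE Hj andbT; apply/eqP => /(congr1 (@nat_of_ord _)) /= E.
  by have := ltn_ord j; rewrite E ltnn.
have out j : j \notin J -> x (w j) 0 = 0.
  by rewrite inE negbK => /eqP.
have xm : x ord_max 0 != 0.
  apply/negP => /eqP xm; rewrite xm eqxx addn0 in cJ.
  have [j jJ] : exists j, j \in J.
    apply/set0Pn; apply: contra x0 => /eqP J0; apply/eqP/colP => i; rewrite mxE.
    case: (unliftP ord_max i) => [j ->|->] //.
    have -> : lift ord_max j = w j by apply: val_inj; rewrite /= /bump leqNgt ltn_ord.
    by rewrite out // J0 inE.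
  have := sum_matrix_poly (p := pJ (J :\ j)) Mx.
  rewrite size_pJ xm mul0r addr0 (bigD1 j) //= big1 ?addr0 => [H|i ij]; last first.
    have [iJ|iJ] := boolP (i \in J); last by rewrite out ?mul0r.
    suff /eqP -> : (pJ (J :\ j)).[a i] == 0 by rewrite mulr0.
    by rewrite pJ_eq0 in_setD1 ij iJ.
  have /eqP : x (w j) 0 * (pJ (J :\ j)).[a j] = 0.
    apply: H; have E := cardsD1 j J; rewrite jJ add1n in E.
    by rewrite -E.
  rewrite mulf_eq0 pJ_eq0 !inE eqxx /= orbF; move: jJ; rewrite inE => jJ.
  by rewrite (negbTE jJ).
rewrite xm addn1 ltnS in cJ.
have vanish (p : {poly rat}) : (size p <= k.+1)%N -> (forall j, j \in J -> p.[a j] = 0) ->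
    p`_k.-1 + T%:R * p`_k = 0.
  move=> sp pz; have := sum_matrix_poly Mx sp; rewrite big1 ?add0r => [/eqP|j _].
    by rewrite mulf_eq0 (negbTE xm) /= => /eqP.
  by have [jJ|jJ] := boolP (j \in J); [rewrite pz ?mulr0|rewrite out ?mul0r].
have Jk : #|J| = k.
  apply/eqP; rewrite eqn_leq cJ /= leqNgt; apply/negP => lt.
  (* Padded by a power of X to degree exactly k - 1, so that p_(k-1) = 1 and p_k = 0. *)
  pose p := pJ J * 'X^(k.-1 - #|J|).
  have sp : size p = k.
    rewrite size_mulXn ?size_pJ -?size_poly_gt0 ?size_pJ // addnS subnK ?prednK //.
    by rewrite -ltnS prednK.
  have : p`_k.-1 + T%:R * p`_k = 0.
    apply: vanish; first by rewrite sp.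
    move=> j jJ; suff /eqP E : (pJ J).[a j] == 0 by rewrite hornerM E mul0r.
    by rewrite pJ_eq0.
  rewrite [p`_k]nth_default ?sp // mulr0 addr0 coefMXn.
  have lt' : (#|J| <= k.-1)%N by rewrite -ltnS prednK.
  rewrite ltnNge leq_subr /= subKn //.
  by rewrite pJ_lead => /eqP; rewrite oner_eq0.
exists J; split => //.
have : (pJ J)`_k.-1 + T%:R * (pJ J)`_k = 0.
  apply: vanish; first by rewrite size_pJ Jk.
  by move=> j jJ; apply/eqP; rewrite pJ_eq0.
have nJ : (pJ J)`_k.-1 = - \sum_(j in J) a j by rewrite -[in LHS]Jk pJ_next // Jk.
have lJ : (pJ J)`_k = 1 by rewrite -[in LHS]Jk pJ_lead.
rewrite nJ lJ mulr1 addrC => /eqP.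
by rewrite subr_eq0 -natr_sum eqr_nat => /eqP ->.
Qed.

(** The coefficients of the monic polynomial with roots at J form a left kernel vector of the square
    submatrix on these k columns and the extra one. Being singular, it also has a right kernel
    vector, which is extended by zeros. *)
Lemma sparse_kernel_of_sum (J : {set 'I_(size s)}) :
  #|J| = k -> (\sum_(j in J) nth 0%N s j)%N = T -> sparse_kernel sum_matrix k.+1.
Proof.
move=> Jk JT.
pose f (t : 'I_k.+1) : 'I_(size s).+1 :=
  if unlift ord_max t is Some t' then
    widen_ord (leqnSn _) (enum_val (cast_ord (esym Jk) t')) else ord_max.
have f_inj : injective f.
  move=> t1 t2; rewrite /f; case: unliftP => [u1 ->|->]; case: unliftP => [u2 ->|->] //.
  - move=> /(congr1 (@nat_of_ord _)) /= E; congr lift; apply: (@cast_ord_inj _ _ (esym Jk)).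
    by apply: enum_val_inj; apply: val_inj.
  - by move=> /(congr1 (@nat_of_ord _)) /= E; have := ltn_ord (enum_val (cast_ord (esym Jk) u1)); rewrite E ltnn.
  - by move=> /(congr1 (@nat_of_ord _)) /= E; have := ltn_ord (enum_val (cast_ord (esym Jk) u2)); rewrite -E ltnn.
pose M := colsub f sum_matrix.
have nJ : (pJ J)`_k.-1 = - \sum_(j in J) a j by rewrite -[in LHS]Jk pJ_next // Jk.
have lJ : (pJ J)`_k = 1 by rewrite -[in LHS]Jk pJ_lead.
have det0 : \det M^T == 0.
  rewrite det_tr; apply/det0P; exists (\row_i (pJ J)`_i).
    apply/eqP => E; have := congr1 (fun v : 'rV_k.+1 => v 0 ord_max) E.
    by rewrite !mxE /= lJ => /eqP; rewrite oner_eq0.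
  have sp : (size (pJ J) <= k.+1)%N by rewrite size_pJ Jk.
  apply/rowP => t; rewrite mxE [RHS]mxE.
  under eq_bigr => i _ do rewrite mxE [M i t]mxE.
  rewrite /f; case: unliftP => [u _|_].
    by rewrite (col_value _ sp); apply/eqP; rewrite pJ_eq0 enum_valP.
  rewrite col_max nJ lJ mulr1 addrC.
  by rewrite -natr_sum JT subrr.
have /det0P [v v0 Mv] := det0.
have {}Mv : M *m v^T = 0 by apply: trmx_inj; rewrite trmx_mul trmxK Mv trmx0.
exists (colsub f 1%:M *m v^T); split.
- apply: contra v0 => /eqP E; apply/eqP/rowP => t; rewrite mxE.
  have := congr1 (fun y : 'cV_(size s).+1 => y (f t) 0) E; rewrite !mxE (bigD1 t) //= big1 => [|i it].
    by rewrite !mxE eqxx mul1r addr0.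
  by rewrite !mxE (inj_eq f_inj) eq_sym (negbTE it) mul0r.
- by rewrite mulmxA mulmx_colsub mulmx1.
- apply: (@leq_trans #|[set f t | t : 'I_k.+1]|); last by rewrite card_imset // card_ord.
  apply/subset_leq_card/subsetP => i; rewrite inE; apply: contraR => Hi.
  rewrite mxE big1 // => t _; rewrite !mxE; case: eqP => [E|_]; last by rewrite mul0r.
  by case/imsetP: Hi; exists t.
Qed.
End SumMatrix.

(** * Cell-by-cell choices as exact subset sums *)

Lemma digits_inj B P (f g : nat -> nat) :
  (forall i, i < P -> f i < B) -> (forall i, i < P -> g i < B) ->
  \sum_(i < P) f i * B ^ i = \sum_(i < P) g i * B ^ i -> forall i, i < P -> f i = g i.
Proof.
elim: P f g => [|P IH] f g Hf Hg // H.
have S (h : nat -> nat) : \sum_(i < P.+1) h i * B ^ i = h 0 + B * \sum_(i < P) h i.+1 * B ^ i.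
  rewrite big_ord_recl /= expn0 muln1 big_distrr; congr addn; apply: eq_bigr => i _.
  by rewrite /bump /= expnS mulnCA.
move: H; rewrite !S => H.
have B0 : 0 < B by apply: leq_ltn_trans (Hf 0 _).
have E0 : f 0 = g 0.
  have := congr1 (modn^~ B) H; rewrite ![B * _]mulnC ![_ + _ * B]addnC !modnMDl.
  by rewrite !modn_small ?Hf ?Hg.
have E1 : \sum_(i < P) f i.+1 * B ^ i = \sum_(i < P) g i.+1 * B ^ i.
  by apply/eqP; rewrite -(eqn_pmul2l B0); apply/eqP; move: H; rewrite E0; apply: addnI.
by case=> // i Hi; apply: (IH (fun i => f i.+1) (fun i => g i.+1)) => // j Hj; [apply: Hf|apply: Hg].
Qed.

Lemma sum_triples (B n : nat) (f : nat -> nat) :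
  \sum_(i < 3 * n) f i * B ^ i =
  \sum_(c < n) B ^ (3 * c) * (f (3 * c) + f (3 * c + 1) * B + f (3 * c + 2) * B ^ 2).
Proof.
elim: n => [|n IH]; first by rewrite !big_ord0.
have -> : 3 * n.+1 = (3 * n).+3 by lia.
rewrite [RHS]big_ord_recr -IH /=; move: (3 * n) => N {IH}.
rewrite !big_ord_recr /= -!addnA; congr addn.
have -> : B ^ N.+1 = B ^ N * B by rewrite expnS mulnC.
have -> : B ^ N.+2 = B ^ N * B ^ 2 by rewrite -expnD addn2.
rewrite addn1 addn2; move: (B ^ N) (f _) (f _) (f _) => u v w z; ring.
Qed.

Lemma sum_pick k (F : nat -> nat) c : \sum_(i < k) F i * (i == c :> nat) = (c < k) * F c.
Proof.
case: ltnP => H; last first.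
  by rewrite big1 // => i _; case: eqP => [E|_]; rewrite ?muln0 //; have := ltn_ord i; lia.
rewrite (bigD1 (Ordinal H)) //= eqxx big1 ?addn0 ?muln1 ?mul1n // => i Hi.
by case: eqP => [E|_]; rewrite ?muln0 //; case/eqP: Hi; apply: val_inj.
Qed.

Notation tile := (nat * nat * (nat * nat))%type.

Section Choice.
Variables (k W C B : nat) (tl : seq tile) (t1 t2 : nat -> nat).
Hypotheses (k0 : 0 < k) (W0 : 0 < W) (BC : k * (1 + 4 * C) < B) (utl : uniq tl)
  (tlC : forall e : tile, e \in tl -> [/\ e.1.1 <= C, e.1.2 <= C, e.2.1 <= C & e.2.2 <= C])
  (t1C : forall c, t1 c <= C) (t2C : forall c, t2 c <= C).

Let P := 3 * (k + W).

(* Cell [c] owns digits [3c], [3c+1], [3c+2]; its tile contributes to the first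
   one, to the two others, and to digits of cells [c+1] and [c+W]. *)
Definition dig (c : nat) (e : tile) (i : nat) : nat :=
  (i == 3 * c) + e.1.1 * (i == 3 * c + 1) + e.1.2 * (i == 3 * c + 2) +
  e.2.1 * (i == 3 * c + 4) + e.2.2 * (i == 3 * c + 3 * W + 2).

Definition tile_num (e : tile) : nat :=
  1 + e.1.1 * B + e.1.2 * B ^ 2 + e.2.1 * B ^ 4 + e.2.2 * B ^ (3 * W + 2).

Definition cell_nums : seq nat := [seq B ^ (3 * c) * tile_num e | c <- iota 0 k, e <- tl].

Definition tdig (i : nat) : nat :=
  if i %% 3 == 0 then i %/ 3 < k : nat
  else if i %% 3 == 1 then t1 (i %/ 3) else t2 (i %/ 3).

Definition target : nat :=
  \sum_(c < k + W) B ^ (3 * c) * ((c < k) + t1 c * B + t2 c * B ^ 2).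

Let tdigE c : [/\ tdig (3 * c) = (c < k), tdig (3 * c + 1) = t1 c & tdig (3 * c + 2) = t2 c].
Proof.
have D e : e < 3 -> (3 * c + e) %/ 3 = c /\ (3 * c + e) %% 3 = e by lia.
rewrite /tdig; have [h1 h2] := D 1 isT; have [h3 h4] := D 2 isT; have [h5 h6] := D 0 isT.
by rewrite addn0 in h5 h6; rewrite h1 h2 h3 h4 h5 h6.
Qed.

Let targetE : target = \sum_(i < P) tdig i * B ^ i.
Proof.
by rewrite sum_triples; apply: eq_bigr => c _; have [-> -> ->] := tdigE c.
Qed.

Let tile_numE c e : c < k -> B ^ (3 * c) * tile_num e = \sum_(i < P) dig c e i * B ^ i.
Proof.
move=> ck; under eq_bigr => i _ do rewrite /dig !mulnDl.
rewrite !big_split /=.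
have S v j : j < P -> \sum_(i < P) v * (i == j :> nat) * B ^ i = v * B ^ j.
  move=> jP; transitivity (\sum_(i < P) (fun i => v * B ^ i) i * (i == j :> nat)).
    by apply: eq_bigr => i _; rewrite mulnAC.
  by rewrite (sum_pick P (fun i => v * B ^ i)) jP mul1n.
have E : \sum_(i < P) (i == 3 * c :> nat) * B ^ i = B ^ (3 * c).
  by rewrite -[RHS]mul1n -S; [apply: eq_bigr => i _; rewrite mul1n|rewrite /P; lia].
rewrite E !S; try (rewrite /P; lia).
by rewrite /tile_num !expnD expn1; move: (B ^ (3 * c)) => u; ring.
Qed.

(** One marker and four contributions of at most C; by [BC], k such digits add up to less than B, so
    no carry occurs. *)
Let dig_small c (e : tile) i : e \in tl -> dig c e i <= 1 + 4 * C.
Proof.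
move=> /tlC [h1 h2 h3 h4]; rewrite /dig.
move: (e.1.1) (e.1.2) (e.2.1) (e.2.2) h1 h2 h3 h4 => a b c' d.
by do 5!case: (_ == _); rewrite /= ?muln0 ?muln1; lia.
Qed.

Let CB : 1 + 4 * C < B.
Proof. by apply: leq_ltn_trans BC; rewrite leq_pmull. Qed.

Let tdig_small i : tdig i < B.
Proof.
apply: leq_ltn_trans CB; rewrite /tdig.
case: eqP => _; first by case: (_ < _).
by case: eqP => _; [apply: leq_trans (t1C _) _|apply: leq_trans (t2C _) _]; lia.
Qed.

Let d0 : tile := ((0, 0), (0, 0)).
Let t := size tl.

Let nth_cell_nums c i : c < k -> i < t ->
  nth 0 cell_nums (c * t + i) = B ^ (3 * c) * tile_num (nth d0 tl i).
Proof.
move=> ck it; rewrite -nth_drop -(nth_take _ it).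
rewrite rows_flatten ?size_map ?size_iota //; last first.
  by apply/allP => s /mapP [x _ ->]; rewrite size_map.
by rewrite (nth_map 0) ?size_iota // nth_iota // add0n (nth_map d0).
Qed.

Let size_cell_nums : size cell_nums = k * t.
Proof. by rewrite size_allpairs size_iota. Qed.

Let dig_inj (x x' : nat) (y y' : tile) : x < k -> x' < k ->
  (forall i, i < P -> dig x y i = dig x' y' i) -> (x, y) = (x', y').
Proof.
move=> xk xk' D; have E : x = x'.
  have := D (3 * x); rewrite /dig /P.
  by do ![case: eqP => ?]; rewrite ?muln0 ?muln1 /=; lia.
rewrite -{x' xk'}E in D *; congr pair.
have D1 := D (3 * x + 1); have D2 := D (3 * x + 2).
have D3 := D (3 * x + 4); have D4 := D (3 * x + 3 * W + 2).
have N (a b : nat) : a <> b -> (a == b) = false by move/eqP/negbTE.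
rewrite /dig !eqxx in D1 D2 D3 D4.
rewrite !(N (3 * x + 1)) in D1; try lia.
rewrite !(N (3 * x + 2)) in D2; try lia.
rewrite !(N (3 * x + 4)) in D3; try lia.
rewrite !(N (3 * x + 3 * W + 2)) in D4; try lia.
rewrite !muln0 !muln1 !addn0 !add0n in D1 D2 D3 D4.
have {}D1 : y.1.1 = y'.1.1 by apply: D1; rewrite /P; lia.
have {}D2 : y.1.2 = y'.1.2 by apply: D2; rewrite /P; lia.
have {}D3 : y.2.1 = y'.2.1 by apply: D3; rewrite /P; lia.
have {}D4 : y.2.2 = y'.2.2 by apply: D4; rewrite /P; lia.
by case: y y' D1 D2 D3 D4 {D} => -[? ?] [? ?] [[? ?] [? ?]] /= -> -> -> ->.
Qed.

(** The Vandermonde argument needs distinct nodes. The marker digit reveals the cell, the other four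
    digits the tile. *)
Lemma cell_nums_uniq : uniq cell_nums.
Proof.
apply: allpairs_uniq => //; first exact: iota_uniq.
move=> [c e] [c' e'] /allpairsP [[x y] [/= Hx He [-> ->]]] /allpairsP [[x' y'] [/= Hx' He' [-> ->]]] H.
rewrite !mem_iota !add0n in Hx Hx'; apply: dig_inj => //.
by apply: (@digits_inj B); rewrite -?tile_numE // => i _;
  apply: leq_ltn_trans CB; apply: dig_small.
Qed.

(** The equations for digits 3c + 1 and 3c + 2. The cells from k to k + W - 1 lie past the end and
    hold no tile: their digits only receive contributions from cell k - 1 and from the last W
    cells. *)
Definition fits (f : nat -> tile) : Prop := forall c, c < k + W ->
  (c < k) * (f c).1.1 + (0 < c <= k) * (f c.-1).2.1 = t1 c /\
  (c < k) * (f c).1.2 + (W <= c) * (f (c - W)).2.2 = t2 c.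

Let fitsP (f : nat -> tile) :
  (forall i, i < P -> \sum_(c < k) dig c (f c) i = tdig i) <-> fits f.
Proof.
pose F i := \sum_(c < k) dig c (f c) i.
have F0 c : F (3 * c) = (c < k).
  rewrite /F -[RHS]muln1 -(sum_pick k (fun=> 1)); apply: eq_bigr => i _.
  by rewrite /dig; do ![case: eqP => ?]; rewrite ?muln0 ?muln1 ?mul0n ?mul1n ?addn0 ?add0n //; lia.
have F1 c : F (3 * c + 1) = (c < k) * (f c).1.1 + (0 < c <= k) * (f c.-1).2.1.
  have -> : (0 < c <= k) * (f c.-1).2.1 = \sum_(i < k) (f i).2.1 * (i.+1 == c).
    case: c => [|c]; first by rewrite big1 // => i _; rewrite muln0.
    by rewrite -(sum_pick k (fun i => (f i).2.1) c); apply: eq_bigr.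
  rewrite -(sum_pick k (fun i => (f i).1.1)) -big_split /=; apply: eq_bigr => i _.
  by rewrite /dig; do ![case: eqP => ?]; rewrite ?muln0 ?muln1 ?mul0n ?mul1n ?addn0 ?add0n //; lia.
have F2 c : c < k + W -> F (3 * c + 2) = (c < k) * (f c).1.2 + (W <= c) * (f (c - W)).2.2.
  move=> cW; have -> : (W <= c) * (f (c - W)).2.2 = \sum_(i < k) (f i).2.2 * (i + W == c).
    case: leqP => H; last by rewrite big1 // => i _; case: eqP => ?; lia.
    have -> : true * (f (c - W)).2.2 = (c - W < k) * (f (c - W)).2.2 by congr muln; lia.
    rewrite -(sum_pick k (fun i => (f i).2.2) (c - W)); apply: eq_bigr => i _.
    by congr muln; lia.
  rewrite -(sum_pick k (fun i => (f i).1.2)) -big_split /=; apply: eq_bigr => i _.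
  by rewrite /dig; do ![case: eqP => ?]; rewrite ?muln0 ?muln1 ?mul0n ?mul1n ?addn0 ?add0n //; lia.
split=> [H c ck|H i iP].
  have [_ E1 E2] := tdigE c.
  by rewrite -F1 -F2 // -E1 -E2; split; apply: H; rewrite /P; lia.
pose c := i %/ 3; have cP : c < k + W by move: iP; rewrite /P /c; lia.
have [E0 E1 E2] := tdigE c; have [H1 H2] := H c cP.
have [->|->|->] : [\/ i = 3 * c, i = 3 * c + 1 | i = 3 * c + 2].
  have := divn_eq i 3; have : i %% 3 < 3 by rewrite ltn_mod.
  rewrite -/c; case: (i %% 3) => [|[|[|]]] // _ Hi; [apply: Or31|apply: Or32|apply: Or33]; lia.
- rewrite E0; exact: F0.
- rewrite E1 -H1; exact: F1.
- rewrite E2 -H2; exact: F2.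
Qed.

(** Because exactly k numbers are added, digits never carry and the equation with the target splits
    into one equation per digit. The marker digits force one number per cell; the remaining digits
    are the conditions [fits]. *)
Lemma choice_sum :
  (exists J : {set 'I_(size cell_nums)},
     #|J| = k /\ \sum_(j in J) nth 0 cell_nums j = target) <->
  (exists f : nat -> tile, (forall c, c < k -> f c \in tl) /\ fits f).
Proof.
split=> [[J [cJ sJ]]|[f [ft Hf]]].
- pose cl (j : 'I_(size cell_nums)) := nat_of_ord j %/ t.
  pose ti (j : 'I_(size cell_nums)) := nth d0 tl (j %% t).
  have jb j : [/\ cl j < k, j %% t < t & nat_of_ord j = cl j * t + j %% t].
    have := ltn_ord j; rewrite {2}size_cell_nums => jl.
    have t0 : 0 < t by case: (t) jl => //; rewrite muln0.
    by rewrite /cl -divn_eq ltn_mod t0 ltn_divLR.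
  have tij j : ti j \in tl by have [_ h _] := jb j; rewrite mem_nth.
  have nJ (j : 'I_(size cell_nums)) : nth 0 cell_nums j = \sum_(i < P) dig (cl j) (ti j) i * B ^ i.
    have [h1 h2 h3] := jb j.
    by rewrite h3 nth_cell_nums // tile_numE.
  have D : forall i, i < P -> \sum_(j in J) dig (cl j) (ti j) i = tdig i.
    apply: (@digits_inj B) => // [i _|].
      apply: leq_ltn_trans BC; rewrite -cJ -sum_nat_const.
      by apply: leq_sum => j _; apply: dig_small.
    rewrite -targetE -sJ (eq_bigr _ (fun j _ => nJ j)) exchange_big /=.
    by apply: eq_bigr => i _; rewrite big_distrl.
  (* Digit 3c is touched only by the numbers of cell c, each of which contributes 1. *)
  have one (c : 'I_k) : exists j, [set j in J | cl j == c] = [set j].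
    have E : \sum_(j in J) dig (cl j) (ti j) (3 * c) = 1.
      rewrite D; first by have [-> _ _] := tdigE c; rewrite ltn_ord.
      by have := ltn_ord c; rewrite /P; lia.
    apply/cards1P/eqP; rewrite -[RHS]E -sum1_card.
    rewrite (eq_bigl (fun j => (j \in J) && (cl j == c))); last by move=> j; rewrite !inE.
    rewrite big_mkcondr; apply: eq_bigr => j _.
    rewrite /dig; case: (cl j =P c) => [->|H].
      by rewrite eqxx; do ![case: eqP => ?]; rewrite ?muln0 ?muln1; lia.
    by do ![case: eqP => ?]; rewrite ?muln0 ?muln1; lia.
  have [g Hg] := fin_all_exists one.
  pose f c := if insub c is Some c' then ti (g c') else d0.
  have fE (c : 'I_k) : f c = ti (g c) by rewrite /f valK.
  exists f; split; first by move=> c ck; rewrite -[c]/(nat_of_ord (Ordinal ck)) fE.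
  apply/fitsP => i iP; rewrite -D //.
  rewrite (partition_big (fun j => Ordinal (let: And3 h _ _ := jb j in h)) xpredT) //=.
  apply: eq_bigr => c _; rewrite fE.
  have gc : cl (g c) = c by have := set11 (g c); rewrite -Hg inE => /andP [_ /eqP].
  transitivity (\sum_(j in [set j in J | cl j == c]) dig (cl j) (ti j) i).
    by rewrite Hg big_set1 gc.
  by apply: eq_bigl => j; rewrite !inE -val_eqE.
- have t0 : 0 < t by have := ft 0 k0; rewrite /t; case: (tl).
  have jP (c : 'I_k) : c * t + index (f c) tl < size cell_nums.
    rewrite size_cell_nums; have := ft c (ltn_ord c); rewrite -index_mem -/t => H.
    by apply: leq_trans (_ : c.+1 * t <= _); [rewrite mulSn; lia|rewrite leq_mul2r ltn_ord orbT].
  pose j c := Ordinal (jP c).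
  have j_inj : injective j.
    move=> c c' /(congr1 (@nat_of_ord _)) /= /(congr1 (divn^~ t)).
    rewrite !divnMDl // !divn_small ?addn0 => [/val_inj //||];
      by rewrite index_mem ft.
  exists [set j c | c : 'I_k]; split; first by rewrite card_imset // card_ord.
  rewrite big_imset /=; last by move=> ? ? _ _; apply: j_inj.
  have Hc (c : 'I_k) : nth 0 cell_nums (c * t + index (f c) tl) = \sum_(i < P) dig c (f c) i * B ^ i.
    by rewrite nth_cell_nums ?index_mem ?ft // nth_index ?ft // tile_numE.
  rewrite (eq_bigr _ (fun c _ => Hc c)) exchange_big targetE /=.
  move/fitsP: Hf => Hf; apply: eq_bigr => i _.
  by rewrite -Hf // big_distrl.
Qed.
End Choice.

(** * Computation tableaux *)

(** Symbols in which no letter follows a blank form a word padded by blanks; this reads the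
    certificate off the tableau. *)
Lemma monotone_word n (g : nat -> option bool) :
  (forall e, e.+1 < n -> g e = None -> g e.+1 = None) ->
  exists y, size y <= n /\ forall e, e < n -> onth y e = g e.
Proof.
elim: n g => [|n IH] g Hg; first by exists [::].
case E: (g 0) => [b|].
  have [|y [Hy He]] := IH (fun e => g e.+1); first by move=> e He; apply: Hg.
  by exists (b :: y); split => // -[|e] // H; apply: He.
exists [::]; split => // e; elim: e => [|e IHe] // He.
by rewrite Hg //; have /= := IHe (ltnW He); case: (e).
Qed.

Section Tableau.
Variable M : TM.
Let Q : finType := 'I_(tm_states M).+1.
Definition tcell : finType := (option 'I_(tm_states M).+1 * option bool)%type.

(* Symbols of the tableau: [Fx z] and [Free] in row 0 (the latter standing for
   an unknown certificate symbol), [Un z] in row 1, [Cf z] in the rows of the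
   computation, [Done] above the last row. *)
Definition tsym : finType := option (option (option bool * tcell)).
Notation Done := (None : tsym).
Notation Free := (Some None : tsym).
Notation Fx z := (Some (Some (None, z)) : tsym).
Notation Un z := (Some (Some (Some false, z)) : tsym).
Notation Cf z := (Some (Some (Some true, z)) : tsym).

Definition mv_right (a : tsym) : option Q :=
  match a with
  | Some (Some (Some true, (Some q, s))) =>
      if tm_delta q s is Some (q', _, MoveR) then Some q' else None
  | _ => None
  end.

Definition mv_left (a : tsym) : option Q :=
  match a with
  | Some (Some (Some true, (Some q, s))) =>
      if tm_delta q s is Some (q', _, MoveL) then Some q' else None
  | _ => None
  end.

Definition upd (a : tsym) (z : tcell) (c : tsym) : tcell :=
  match z.1 with
  | Some q =>
      match tm_delta q z.2 with
      | None => z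
      | Some (q', s', d) => (if d is Stay then Some q' else None, s')
      end
  | None => (if mv_right a is Some q' then Some q' else mv_left c, z.2)
  end.

Definition is_bit (c : tsym) : bool :=
  if c is Some (Some (Some true, (_, Some _))) then true else false.

(** A halted head must read [true] with no bit on its right, which is the local form of the output
    [[:: true]]. *)
Definition ok_halt (z : tcell) (c : tsym) : bool :=
  if z.1 is Some q then
    (if tm_delta q z.2 is Some _ then true else false) || (z.2 == Some true) && ~~ is_bit c
  else true.

(** In row 1 no bit may follow a blank, so that the guessed symbols form a word; the cell under the
    head is exempt, as the first letter follows the blank margin. [Done] is allowed above any
    configuration cell but satisfies no constraint itself, so it can occur only past the last
    row. *)
Definition local (a b c d : tsym) : bool :=
  match b with
  | None => false
  | Some None => if d is Some (Some (Some false, (None, _))) then true else false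
  | Some (Some (None, z)) => d == Un z
  | Some (Some (Some false, z)) =>
      (d == Cf z) && ~~ ((a == Un (None, None)) && (z.1 == None) && (z.2 != None))
  | Some (Some (Some true, z)) =>
      ((d == Cf (upd a z c)) || (d == Done)) && ok_halt z c
  end.

Definition fconf : Type := (Q * (int -> sym) * int)%type.

Definition fcstep (c : fconf) : fconf :=
  match tm_delta c.1.1 (c.1.2 c.2) with
  | None => c
  | Some (q', s, d) => (q', fupd c.1.2 c.2 s, (c.2 + move_delta d)%R)
  end.

Definition fcell (c : fconf) (z : int) : tcell :=
  (if z == c.2 then Some c.1.1 else None, c.1.2 z).

Lemma fcell_step c z :
  fcell (fcstep c) z = upd (Cf (fcell c (z - 1)%R)) (fcell c z) (Cf (fcell c (z + 1)%R)).
Proof.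
case: c => [[q f] h]; rewrite /fcstep /upd /mv_right /mv_left /fcell /=.
case: (z =P h) => [->|zh] /=.
  case E: (tm_delta q (f h)) => [[[q' s'] d]|] /=; last by rewrite eqxx.
  rewrite /fupd eqxx; congr pair; case: d {E} => /=; case: eqP => //; lia.
case: ((z - 1)%R =P h) => [E1|n1]; case: ((z + 1)%R =P h) => [E2|n2] /=; try lia.
- rewrite E1; case E: (tm_delta q (f h)) => [[[q' s'] d]|] /=; last by case: eqP.
  rewrite /fupd; case: (z =P h) => // _; congr pair.
  by case: d {E} => /=; case: eqP => //; lia.
- rewrite E2; case E: (tm_delta q (f h)) => [[[q' s'] d]|] /=; last by case: eqP.
  rewrite /fupd; case: (z =P h) => // _; congr pair.
  by case: d {E} => /=; case: eqP => //; lia.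
- case E: (tm_delta q (f h)) => [[[q' s'] d]|] /=; last by case: eqP.
  rewrite /fupd; case: (z =P h) => // _; congr pair.
  by case: d {E} => /=; case: eqP => //; lia.
Qed.

Definition fcrun (w : seq bool) (t : nat) : fconf := iter t fcstep (ord0, wtape w, 0%R).

Lemma fcrun_rep w t : let c := run t (init M w) in
  c.1 = (fcrun w t).1.1 /\ trep c.2 (fcrun w t).1.2 (fcrun w t).2.
Proof.
elim: t => [|t [IH1 IH2]] /=; first by split => //; apply: trep_init.
move: IH1 IH2; rewrite /fcrun /run /=; case: (iter t _ (init M w)) => q tp /=.
case: (iter t fcstep _) => [[q' f] h] /= -> Ht; rewrite /step /fcstep /=.
have -> : thead tp = f h by case: Ht.
case: (tm_delta q' (f h)) => [[[q1 s] d]|] //=; split => //; exact: trep_move.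
Qed.

Lemma fcrun_head w t : (- t%:Z <= (fcrun w t).2 <= t%:Z)%R.
Proof.
elim: t => // t; rewrite /fcrun /= /fcstep; case: (iter t _ _) => [[q f] h] /=.
by case: (tm_delta q (f h)) => [[[q1 s] d]|] /=; [case: d => /=|]; lia.
Qed.

Lemma fcrun_far w t (z : int) : ((z < - t%:Z) || (t%:Z < z))%R -> (fcrun w t).1.2 z = wtape w z.
Proof.
elim: t => // t IH H; have := fcrun_head w t; have := IH; rewrite /fcrun /= {1 4}/fcstep.
case: (iter t _ _) => [[q f] h] /= {}IH Hh.
case: (tm_delta q (f h)) => [[[q1 s] d]|] /=; last by apply: IH; lia.
by rewrite /fupd; case: eqP => [E|_]; [lia|apply: IH; lia].
Qed.

Lemma fcell_nohead w t (z : int) : ((z < - t%:Z) || (t%:Z < z))%R -> (fcell (fcrun w t) z).1 = None.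
Proof.
move=> H; rewrite /fcell /=; have := fcrun_head w t; case: eqP => // E.
by move: H; rewrite E; move: (fcrun w t).2 => h; lia.
Qed.

Lemma mv_none (z : tcell) : z.1 = None -> mv_right (Cf z) = None /\ mv_left (Cf z) = None.
Proof. by case: z => [[q|] s]. Qed.

Variables (pre : seq bool) (yb Tm : nat).
Hypothesis pre0 : 0 < size pre.

(** Reading the rows one after another makes the end of a row a neighbour of the start of the next.
    A margin exceeding the running time keeps the head away from the border columns, so these false
    neighbours have no effect. *)
Definition t_off : nat := Tm.+1.
Definition t_width : nat := t_off + (size pre + yb) + t_off.
(** Two rows prepare the input, the other Tm + 1 hold the configurations at times 0 to Tm. *)
Definition t_height : nat := Tm + 3.
Definition t_cells : nat := t_width * t_height.

Definition t_init (p : nat) : tsym :=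
  if p < t_off then Fx (None, None)
  else let z := p - t_off in
    if z < size pre then Fx (if z == 0 then Some ord0 else None, onth pre z)
    else if z < size pre + yb then Free else Fx (None, None).

Definition prev (u : nat -> tsym) (c : nat) : tsym := if c is c'.+1 then u c' else Cf (None, None).

(** The last cell is prescribed because the target sum has to contain the code of the pair formed by
    it and the [Done] after it. *)
Definition t_valid (u : nat -> tsym) : Prop :=
  [/\ forall c, c < t_width -> u c = t_init c,
      forall c, t_cells <= c < t_cells + t_width -> u c = Done,
      u t_cells.-1 = Cf (None, None) &
      forall c, c < t_cells -> local (prev u c) (u c) (u c.+1) (u (c + t_width))].

Let W := t_width.

Let rowP (r p : nat) : r < t_height -> p < W -> r * W + p < t_cells.
Proof.
move=> Hr Hp; apply: (@leq_trans (r.+1 * W)); first by rewrite mulSn; lia.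
by rewrite /t_cells mulnC leq_mul2l Hr orbT.
Qed.

Let pos (p : nat) : int := (p%:Z - t_off%:Z)%R.

Variable F : seq bool -> seq bool.
Hypothesis FM : forall y, size y <= yb -> exists t, [/\ t <= Tm, halted (run t (init M (pre ++ y))) &
  output (run t (init M (pre ++ y))) = F (pre ++ y)].

Let fc y t := fcrun (pre ++ y) t.

Let halt_step w t t' : halted (run t (init M w)) -> t <= t' -> fcrun w t' = fcrun w t.
Proof.
move=> Hh /subnKC <-; elim: (t' - t) => [|n IH]; first by rewrite addn0.
rewrite addnS /fcrun iterS -/(fcrun w (t + n)) IH /fcstep.
have [E [Hd _ _]] := fcrun_rep w t; move: Hh; rewrite /halted E Hd.
by case: (tm_delta _ _).
Qed.

Let out_true w t : output (run t (init M w)) = [:: true] <->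
  (fcrun w t).1.2 (fcrun w t).2 = Some true /\
  (if (fcrun w t).1.2 ((fcrun w t).2 + 1)%R is Some _ then false else true).
Proof.
have [_ [Hd _ Hr]] := fcrun_rep w t; rewrite /output Hd.
have := Hr 0; rewrite (_ : _ + 1 + 0%:Z = (fcrun w t).2 + 1)%R; last lia.
case: (tright _) => [|a r] /= <-; case: ((fcrun w t).1.2 _) => [[]|] /=.
- by split.
- by split => // -[].
- by split => // -[].
- by case: a => [b|] //=; split => // -[].
- by split => // -[].
- by split => // -[].
Qed.

(** Row 1 determines the certificate y; by induction row t + 2 is the configuration of the run on
    [pre ++ y] at time t. At the halting time the constraint [ok_halt] at the head says that the
    output is [[:: true]]. *)
Lemma tableau_sound u : t_valid u -> exists y, size y <= yb /\ F (pre ++ y) = [:: true].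
Proof.
case=> Hi Hd _ Hl.
have W1 : 1 < W by rewrite /W /t_width /t_off; lia.
have H3 : 2 < t_height by rewrite /t_height; lia.
have next r p : r.+1 < t_height -> p < W -> u (r.+1 * W + p) <> Done.
  move=> Hr Hp E; have := Hl _ (rowP Hr Hp); by rewrite /local E.
have nextE r p : r * W + p + W = r.+1 * W + p by rewrite mulSn; lia.
(* The symbol guessed at the e-th free position, read in row 1. *)
pose g e := if u (W + (t_off + (size pre + e))) is Some (Some (_, (_, s))) then s else None.
have R1 p : p < W -> u (W + p) = match t_init p with
    | Some (Some (_, z)) => Un z | _ => Un (None, g (p - t_off - size pre)) end.
  move=> Hp; have := Hl _ (@rowP 0 p (ltnW (ltnW H3)) Hp).
  rewrite mul0n add0n Hi // addnC {1}/t_init /t_init; case: ltnP => H1 /=; first by move=> /eqP.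
  case: ltnP => H2 /=; first by move=> /eqP.
  case: ltnP => H4 /=; last by move=> /eqP.
  have Ep : p = t_off + (size pre + (p - t_off - size pre)) by lia.
  by rewrite /g -Ep; case: (u (W + p)) => [[[[[|]|] [[q|] s]]|]|].
have g_mono e : e.+1 < yb -> g e = None -> g e.+1 = None.
  move=> He ge; have Hp : t_off + (size pre + e.+1) < W by rewrite /W /t_width; lia.
  have Ui e' : e' < yb -> t_init (t_off + (size pre + e')) = Free.
    by move=> He'; rewrite /t_init; do 3!(case: ltnP => ?; try lia).
  have Ud e' : e' < yb -> u (W + (t_off + (size pre + e'))) = Un (None, g e').
    move=> He'; rewrite R1 ?Ui //; last by rewrite /W /t_width; lia.
    by do 2!congr (Some _); congr (_, (_, g _)); lia.
  have Ep : W + (t_off + (size pre + e.+1)) = (W + (t_off + (size pre + e))).+1 by lia.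
  have := Hl _ (@rowP 1 _ (ltnW H3) Hp); rewrite mul1n Ud // Ep /= Ud ?(ltnW He) // ge /local.
  by case: (g e.+1) => // b; rewrite eqxx andbF.
have [y [Hy gy]] := monotone_word g_mono.
exists y; split => //.
have preE p : t_off <= p -> wtape (pre ++ y) (pos p) = onth (pre ++ y) (p - t_off).
  by move=> H; rewrite /pos (_ : _ - _ = Posz (p - t_off))%R //; lia.
have onth_cat (s1 s2 : seq bool) i : onth (s1 ++ s2) i = if i < size s1 then onth s1 i else onth s2 (i - size s1).
  by elim: s1 i => [|a s1 IH] [|i] //=; rewrite ?subn0 // IH.
have R1' p : p < W -> u (W + p) = Un (fcell (fc y 0) (pos p)).
  move=> Hp; rewrite R1 // /fcell /fc /fcrun /=.
  have pos0 : (pos p == 0%R) = (p == t_off) by rewrite /pos; lia.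
  rewrite pos0 /t_init; case: ltnP => H1.
    rewrite (ltn_eqF H1) (_ : wtape _ _ = None) //.
    by rewrite /pos; case E: (_ - _)%R => [n|n] //; lia.
  rewrite preE // onth_cat; case: ltnP => H2.
    do 2!congr (Some _); congr (_, (_, _)).
    by rewrite subn_eq0 eq_sym eqn_leq H1 /= ; case: (p <= t_off).
  have -> : (p == t_off) = false by lia.
  case: ltnP => H4; first by rewrite gy //; lia.
  do 2!congr (Some _); congr (_, (_, _)).
  have : size y <= p - t_off - size pre by lia.
  by elim: (y) (p - t_off - size pre) => [|a s IH] [|i] //=; exact: IH.
have R2 p : p < W -> u (2 * W + p) = Cf (fcell (fc y 0) (pos p)).
  move=> Hp; have := Hl _ (@rowP 1 p (ltnW H3) Hp).
  by rewrite nextE mul1n R1' // /local => /andP [/eqP].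
have upd_eq a a' z c c' : mv_right a = mv_right a' -> mv_left c = mv_left c' -> upd a z c = upd a' z c'.
  by move=> Ea Ec; rewrite /upd Ea Ec.
have posS p : pos p.+1 = (pos p + 1)%R by rewrite /pos; lia.
have pos_l : pos 0 = (- (Tm%:Z) - 1)%R by rewrite /pos /t_off; lia.
have pos_r : (Tm%:Z < pos W.-1)%R by rewrite /pos /W /t_width /t_off; lia.
(* The second clause concerns the last cell of the previous row, which is the left neighbour of the
   first cell of this one: it must not send a head to the right. *)
have R t : t <= Tm -> (forall p, p < W -> u (t.+2 * W + p) = Cf (fcell (fc y t) (pos p))) /\
    mv_right (u (t.+1 * W + W.-1)) = None.
  elim: t => [|t IH] Ht; first by split; [exact: R2|rewrite mul1n R1' //; lia].
  have {IH} [IH IHr] := IH (ltnW Ht).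
  have Hr : t.+2 < t_height by rewrite /t_height; lia.
  have Hr' : t.+3 < t_height by rewrite /t_height; lia.
  have pprev p : p < W -> mv_right (prev u (t.+2 * W + p)) = mv_right (Cf (fcell (fc y t) (pos p - 1)%R)).
    case: p => [|p] Hp; last by rewrite addnS /= IH ?(ltnW Hp) // posS addrK.
    have -> : mv_right (Cf (fcell (fc y t) (pos 0 - 1)%R)) = None.
      by apply: (proj1 (mv_none _)); apply: fcell_nohead; rewrite pos_l; lia.
    have -> : t.+2 * W + 0 = (t.+1 * W + W.-1).+1 by rewrite addn0 (mulSn t.+1) -addnS prednK ?(ltnW W1) // addnC.
    exact: IHr.
  have step p : p < W -> u (t.+2 * W + p).+1 <> Done ->
      mv_left (u (t.+2 * W + p).+1) = mv_left (Cf (fcell (fc y t) (pos p + 1)%R)) ->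
      u (t.+3 * W + p) = Cf (fcell (fc y t.+1) (pos p)).
    move=> Hp nD En; have := Hl _ (rowP Hr Hp); rewrite nextE IH // {1}/local.
    case/andP => /orP [/eqP -> _|/eqP E]; last by have := next t.+2 p Hr' Hp; rewrite E.
    by rewrite /fc {2}/fcrun iterS fcell_step; congr (Some (Some (_, _))); apply: upd_eq; rewrite ?pprev.
  (* All cells but the last are settled first, because the right neighbour of the last one is the
     first cell of the next row. *)
  have main p : p.+1 < W -> u (t.+3 * W + p) = Cf (fcell (fc y t.+1) (pos p)).
    by move=> Hp; apply: step; rewrite ?(ltnW Hp) // -addnS IH // posS.
  have last1 : (t.+2 * W + W.-1).+1 = t.+3 * W + 0 by rewrite addn0 (mulSn t.+2) -addnS prednK ?(ltnW W1) // addnC.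
  split; last first.
    rewrite IH; last by lia.
    by apply: (proj1 (mv_none _)); apply: fcell_nohead; move: pos_r; move: (pos _) => z; lia.
  move=> p Hp; case: (ltnP p.+1 W) => H1; first exact: main.
  have -> : p = W.-1 by lia.
  apply: step; first by lia.
    by rewrite last1 main.
  rewrite last1 main //.
  transitivity (None : option Q).
    by apply: (proj2 (mv_none _)); apply: fcell_nohead; rewrite pos_l; lia.
  apply/esym; apply: (proj2 (mv_none _)); apply: fcell_nohead; move: pos_r; move: (pos _) => z; lia.
have [t [tT tH tF]] := FM Hy.
have Hh := fcrun_head (pre ++ y) t; have [Ru _] := R t tT.
have [p Ep] : exists p, pos p = (fc y t).2.
  exists `|((fc y t).2 + Posz t_off)%R|%N; rewrite /pos; move: Hh; rewrite -/(fc y t) /t_off; move: (fc y t).2 => h; lia.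
have pW : p.+1 < W.
  move: Ep Hh; rewrite -/(fc y t) /pos /W /t_width /t_off; move: (fc y t).2 => h; lia.
have Hr : t.+2 < t_height by rewrite /t_height; lia.
have := Hl _ (rowP Hr (ltnW pW)); rewrite -addnS !Ru ?(ltnW pW) // {1}/local.
case/andP => _; rewrite /ok_halt {1}/fcell /= Ep eqxx.
have [E [Eh _ _]] := fcrun_rep (pre ++ y) t; move: tH; rewrite /halted E Eh -/(fc y t).
case: (tm_delta _ _) => //= _ /andP [/eqP Es Eb].
rewrite -tF; apply/out_true; split; first exact: Es.
by move: Eb; rewrite posS Ep /fcell /is_bit /=; case: ((fc y t).1.2 _).
Qed.

(** The tableau is the actual run. A halted configuration repeats itself up to the last row, so
    every row that shows a halted head shows the final, accepting configuration. *)
Lemma tableau_complete y : size y <= yb -> F (pre ++ y) = [:: true] -> exists u, t_valid u.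
Proof.
move=> Hy Fy; set w := pre ++ y.
have W1 : 1 < W by rewrite /W /t_width /t_off; lia.
have W0 := ltnW W1.
have sw : size w <= size pre + yb by rewrite size_cat leq_add2l.
pose row r p : tsym := match r with
  | 0 => t_init p
  | 1 => Un (fcell (fc y 0) (pos p))
  | r'.+2 => Cf (fcell (fc y r') (pos p)) end.
pose u c : tsym := if c < t_cells then row (c %/ W) (c %% W) else Done.
have uE r p : r < t_height -> p < W -> u (r * W + p) = row r p.
  by move=> Hr Hp; rewrite /u rowP // divnMDl // divn_small // addn0 modnMDl modn_small.
have posS p : pos p.+1 = (pos p + 1)%R by rewrite /pos; lia.
have pos_l : pos 0 = (- (Tm%:Z) - 1)%R by rewrite /pos /t_off; lia.
have pos_r : (pos W.-1 = Tm%:Z + (size pre + yb)%:Z)%R by rewrite /pos /W /t_width /t_off; lia.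
have last1 r : (r * W + W.-1).+1 = r.+1 * W + 0 by rewrite addn0 mulSn -addnS prednK // addnC.
have edge_l t : t <= Tm -> (fcell (fc y t) (pos 0)).1 = None /\ (fcell (fc y t) (pos 0 - 1)%R).1 = None.
  by move=> Ht; split; apply: fcell_nohead; rewrite pos_l; lia.
have edge_r t : t <= Tm -> (fcell (fc y t) (pos W.-1)).1 = None /\ (fcell (fc y t) (pos W.-1 + 1)%R).1 = None.
  by move=> Ht; split; apply: fcell_nohead; rewrite pos_r; lia.
have f0 p : fcell (fc y 0) (pos p) = (if p == t_off then Some ord0 else None, wtape w (pos p)).
  by rewrite /fcell /fc /fcrun /= (_ : (pos p == 0%R) = (p == t_off)) // /pos; lia.
have wl p : p < t_off -> wtape w (pos p) = None.
  by move=> H; rewrite /pos; case E: (_ - _)%R => [n|n] //; lia.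
have preE p : t_off <= p -> wtape w (pos p) = onth w (p - t_off).
  by move=> H; rewrite /pos (_ : _ - _ = Posz (p - t_off))%R //; lia.
have onth_cat (s1 s2 : seq bool) i : onth (s1 ++ s2) i = if i < size s1 then onth s1 i else onth s2 (i - size s1).
  by elim: s1 i => [|a s1 IH] [|i] //=; rewrite ?subn0 // IH.
exists u; split.
- by move=> c Hc; rewrite -[c]/(0 * W + c) uE //; rewrite /t_height; lia.
- by move=> c /andP [Hc _]; rewrite /u ltnNge Hc.
- have -> : t_cells.-1 = Tm.+2 * W + W.-1.
    by rewrite /t_cells /t_height addn3 mulnC -/W (mulSn Tm.+2) addnC -subn1 -addnBA // subn1.
  rewrite uE ?ltn_predL //; last by rewrite /t_height addn3.
  rewrite /row; have [E _] := edge_r _ (leqnn Tm).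
  congr (Some (Some (_, _))); rewrite [LHS]surjective_pairing E; congr pair.
  rewrite /fcell /= fcrun_far; last by rewrite pos_r; lia.
  rewrite pos_r (_ : _ + _ = Posz (Tm + (size pre + yb)))%R //=.
  have : size w <= Tm + (size pre + yb) by lia.
  by rewrite -/w; elim: (w) (Tm + _) => [|a s IH] [|i] //=; exact: IH.
move=> c Hc; have Ec := divn_eq c W; move: Hc; rewrite Ec.
set r := c %/ W; set p := c %% W => Hc.
have Hp : p < W by rewrite ltn_mod.
have Hr : r < t_height.
  rewrite ltnNge; apply/negP => H.
  have : t_height * W <= r * W by rewrite leq_mul2r H orbT.
  by move: Hc; rewrite /t_cells (mulnC t_width) -/W; move: (_ * W) (r * W) => ? ?; lia.
rewrite -addnA (addnC p) addnA -mulSnr.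
rewrite (uE r p) //; case Er : r Hr => [|[|t]] Hr.
- rewrite uE ?mul1n //; last by rewrite /t_height; lia.
  rewrite /row f0 /t_init /local; case: ltnP => H1; first by rewrite wl // (ltn_eqF H1) eqxx.
  rewrite preE // onth_cat.
  case: ltnP => H2.
    by rewrite subn_eq0 (_ : (p <= t_off) = (p == t_off)) ?eqxx // eqn_leq H1 andbT.
  have -> : (p == t_off) = false by lia.
  case: ltnP => H4 //.
  apply/eqP; do 2!congr (Some _); congr (_, (_, _)).
  have : size y <= p - t_off - size pre by lia.
  by elim: (y) (_ - size pre) => [|a s IH] [|i] //=; exact: IH.
- rewrite (uE 2 p) //; last by rewrite /t_height; lia.
  rewrite -[row 1 p]/(Un (fcell (fc y 0) (pos p))) -[row 2 p]/(Cf (fcell (fc y 0) (pos p))).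
  rewrite /local f0 eqxx andTb; case Ep: p Hp => [|q] Hp.
    have -> : 1 * W + 0 = W.-1.+1 by rewrite addn0 mul1n prednK.
    rewrite [prev _ _]/= (_ : u W.-1 = t_init W.-1); last first.
      by rewrite -[W.-1]/(0 * W + W.-1) uE ?ltn_predL //; rewrite /t_height; lia.
    by rewrite /t_init; do !case: ifP => // _.
  rewrite addnS [prev _ _]/= uE ?(ltnW Hp) // /row f0.
  apply/negP => /andP [/andP [/eqP [E1 E2] E3] /negP []].
  case: (ltnP q.+1 t_off) E3 => H1; first by rewrite /= wl.
  case: (q.+1 =P t_off) => //= H2 _; rewrite preE //; move: E2; rewrite preE; last lia.
  rewrite (_ : q.+1 - t_off = (q - t_off).+1); last lia.
  by elim: (w) (q - t_off) => [|a s IH] [|i] //=; exact: IH.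
have tT : t <= Tm by move: Hr; rewrite /t_height; lia.
rewrite -[row t.+2 p]/(Cf (fcell (fc y t) (pos p))).
have Epv : mv_right (prev u (t.+2 * W + p)) = mv_right (Cf (fcell (fc y t) (pos p - 1)%R)).
  case Ep: p Hp => [|q] Hp.
    rewrite (proj1 (mv_none (proj2 (edge_l _ tT)))).
    have -> : t.+2 * W + 0 = (t.+1 * W + W.-1).+1 by rewrite last1.
    rewrite [prev _ _]/= uE ?ltn_predL ?(ltnW Hr) //.
    case: (t) tT => [|t'] tT' //; rewrite -[row _ _]/(Cf (fcell (fc y t') (pos W.-1))).
    by rewrite (proj1 (mv_none (proj1 (edge_r _ (ltnW tT'))))).
  by rewrite addnS [prev _ _]/= uE ?(ltnW Hp) // posS addrK.
have Enx : mv_left (u (t.+2 * W + p).+1) = mv_left (Cf (fcell (fc y t) (pos p + 1)%R)).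
  case: (ltnP p.+1 W) => H1; first by rewrite -addnS uE // -posS.
  have {1 2}-> : p = W.-1 by lia.
  rewrite (proj2 (mv_none (proj2 (edge_r _ tT)))) last1.
  case: (ltnP t.+3 t_height) => H2; last first.
    by rewrite /u ltnNge addn0 /t_cells mulnC leq_mul2r H2 orbT.
  rewrite uE // -[row _ _]/(Cf (fcell (fc y t.+1) (pos 0))).
  have tT' : t.+1 <= Tm by move: H2; rewrite /t_height; lia.
  by rewrite (proj2 (mv_none (proj1 (edge_l _ tT')))).
rewrite /local; apply/andP; split.
  case: (ltnP t.+3 t_height) => H2; last first.
    rewrite /u (_ : (_ < t_cells) = false) ?eqxx ?orbT //; apply/negP/negP; rewrite -leqNgt.
    by apply: leq_trans (leq_addr _ _); rewrite /t_cells mulnC leq_mul2r H2 orbT.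
  rewrite uE // -[row _ _]/(Cf (fcell (fc y t.+1) (pos p))).
  rewrite (_ : fcell (fc y t.+1) (pos p) =
    upd (prev u (t.+2 * W + p)) (fcell (fc y t) (pos p)) (u (t.+2 * W + p).+1)) ?eqxx //.
  by rewrite /fc {1}/fcrun iterS fcell_step /upd -Epv -Enx.
rewrite /ok_halt {1}/fcell /=; case: eqP => // Eh.
case Ed: (tm_delta _ _) => [a|] //=.
have [t1 [t1T h1 o1]] := FM Hy.
have ht : halted (run t (init M w)).
  have [E [E2 _ _]] := fcrun_rep w t; rewrite /halted E E2.
  by move: Ed; rewrite Eh /fc -/w => ->.
have E1 : fcrun w t1 = fcrun w t.
  case/orP: (leq_total t t1) => H; [exact: halt_step|apply/esym; exact: halt_step].
have [] := (out_true w t1).1; first by rewrite o1.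
rewrite E1 Eh /fc -/w => -> Hb; rewrite eqxx /=.
have p1 : p.+1 < W.
  move: (fcrun_head w t) pos_r (Eh); rewrite /pos /fc -/w; move: (fcrun w t).2 => h; lia.
by rewrite -addnS uE // /row posS /fcell /is_bit /= Eh /fc -/w; case: (_.1.2 _) Hb.
Qed.
End Tableau.

(** * Tableaux as choices of tiles *)

Lemma t_width_gt0 pre yb Tm : 0 < t_width pre yb Tm.
Proof. by rewrite /t_width /t_off; lia. Qed.

Lemma t_width_cells pre yb Tm : t_width pre yb Tm < t_cells pre yb Tm.
Proof. by rewrite /t_cells /t_height addn3 -[X in X < _]muln1 ltn_pmul2l ?t_width_gt0. Qed.

Lemma t_cells_gt0 pre yb Tm : 0 < t_cells pre yb Tm.
Proof. exact: ltn_trans (t_width_gt0 _ _ _) (t_width_cells _ _ _). Qed.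

Section Tiles.
Variables (M : TM) (pre : seq bool) (yb Tm : nat).
Let T := tsym M.
Local Notation W := (t_width pre yb Tm).
Local Notation k := (t_cells pre yb Tm).

Definition code_bound : nat := #|{: tsym M * tsym M}| + #|tsym M|.
Let C := code_bound.
Let code2 (a b : T) : nat := enum_rank (a, b).
Let code1 (a : T) : nat := enum_rank a.

Let code2C a b : code2 a b <= C.
Proof. by apply: ltnW; apply: (leq_trans (ltn_ord _)); apply: leq_addr. Qed.

Let code1C a : code1 a <= C.
Proof. by apply: ltnW; apply: (leq_trans (ltn_ord _)); apply: leq_addl. Qed.

Let code2_inj a b a' b' : code2 a b = code2 a' b' -> a = a' /\ b = b'.
Proof. by move/val_inj/enum_rank_inj => [-> ->]. Qed.

Let code1_inj a a' : code1 a = code1 a' -> a = a'.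
Proof. by move/val_inj/enum_rank_inj. Qed.

(** Complements turn agreement into a sum. The shared digit adds C - code(left, cell) from a cell
    and code(cell, right) from its predecessor, and the total is C exactly when the two pairs
    coincide; the vertical link works in the same way with single symbols. *)
Definition tile_of (e : T * T * (T * T)) : tile :=
  ((C - code2 e.1.1 e.1.2, C - code1 e.1.2), (code2 e.1.2 e.2.1, code1 e.2.2)).

Definition tiles : seq tile :=
  [seq tile_of e | e <- enum {: T * T * (T * T)} & local e.1.1 e.1.2 e.2.1 e.2.2].

(** C wherever two cells meet. At the two ends only one contribution is present and is prescribed: a
    blank stands before cell 0, and the last cell is blank with [Done] after it. *)
Definition targ1 (c : nat) : nat :=
  if c == 0 then C - code2 (Some (Some (Some true, (None, None)))) (t_init M pre yb Tm 0)
  else if c < k then C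
  else if c == k then code2 (Some (Some (Some true, (None, None)))) None else 0.

(** The first row receives nothing from below, so its symbols are prescribed; past the last row only
    [Done] is received. *)
Definition targ2 (c : nat) : nat :=
  if c < W then C - code1 (t_init M pre yb Tm c)
  else if c < k then C else if c < k + W then code1 None else 0.

Let subC_inj m n : m <= C -> n <= C -> C - m = C - n -> m = n.
Proof. by move: C => D; lia. Qed.

Let subC_add m n : m <= C -> C - m + n = C -> m = n.
Proof. by move: C => D; lia. Qed.

Lemma tiles_uniq : uniq tiles.
Proof.
rewrite /tiles map_inj_in_uniq; first by apply: filter_uniq; apply: enum_uniq.
move=> -[[a b] [c d]] [[a' b'] [c' d']] _ _ [].
move=> /= H1 _ /code2_inj [Eb Ec] /code1_inj Ed; subst b' c' d'.
suff /code2_inj [<- _] : code2 a b = code2 a' b by [].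
exact: subC_inj (code2C _ _) (code2C _ _) H1.
Qed.

Lemma tiles_bound e : e \in tiles -> [/\ e.1.1 <= C, e.1.2 <= C, e.2.1 <= C & e.2.2 <= C].
Proof. by case/mapP => e' _ -> /=; split; rewrite ?leq_subr ?code2C ?code1C. Qed.

Lemma targ1_bound c : targ1 c <= C.
Proof. by rewrite /targ1; do !case: ifP => // _; rewrite ?leq_subr ?code2C. Qed.

Lemma targ2_bound c : targ2 c <= C.
Proof. by rewrite /targ2; do !case: ifP => // _; rewrite ?leq_subr ?code1C. Qed.

(** The tableau consists of the second components of the tiles, continued by [Done]. The digit
    equations say that each tile knows its neighbours correctly, and membership in [tiles] is the
    local constraint. *)
Lemma tiles_tableau :
  (exists f : nat -> tile, (forall c, c < k -> f c \in tiles) /\ fits k W targ1 targ2 f) <->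
  exists u, t_valid (M := M) pre yb Tm u.
Proof.
have W0 := t_width_gt0 pre yb Tm; have Wk := t_width_cells pre yb Tm.
split=> [[f [Hf fit]]|[u [Hi Hd He Hl]]].
- have /all_sig [g Hg] c : {e : T * T * (T * T) | c < k -> f c = tile_of e /\ local e.1.1 e.1.2 e.2.1 e.2.2}.
    case: (ltnP c k) => Hc; last by exists ((None, None), (None, None)).
    apply: cid; have /mapP [e] := Hf _ Hc; rewrite mem_filter => /andP [He _] E.
    by exists e.
  have fitc c (Hc : c < k) := conj (fit c (ltn_addr _ Hc)) (Hg c Hc).
  exists (fun c => if c < k then (g c).1.2 else None).
  have link c : c < k -> prev (fun c => if c < k then (g c).1.2 else None) c = (g c).1.1 /\
      (0 < c -> (g c).1.2 = (g c.-1).2.1).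
    move=> Hc; have [[F1 _] [E1 _]] := fitc _ Hc; move: F1; rewrite E1 Hc mul1n (ltnW Hc) andbT.
    case: c Hc E1 => [|c] Hc E1 /=; rewrite /targ1 /= ?Hc.
      rewrite mul0n addn0 => H; split => //.
      suff /code2_inj [-> _] : code2 (g 0).1.1 (g 0).1.2 =
          code2 (Some (Some (Some true, (None, None)))) (t_init M pre yb Tm 0) by [].
      exact: subC_inj (code2C _ _) (code2C _ _) H.
    have [_ [-> _]] := fitc _ (ltnW Hc); rewrite mul1n /= (ltnW Hc) => H.
    suff /code2_inj [-> ->] : code2 (g c.+1).1.1 (g c.+1).1.2 = code2 (g c).1.2 (g c).2.1 by [].
    exact: subC_add (code2C _ _) H.
  have kS : k.-1.+1 = k by rewrite prednK // t_cells_gt0.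
  have lastk : (g k.-1).1.2 = Some (Some (Some true, (None, None))) /\ (g k.-1).2.1 = None.
    have kW : k < k + W by rewrite -[X in X < _]addn0 ltn_add2l W0.
    have [F1 _] := fit k kW.
    have k1 : k.-1 < k by rewrite kS.
    have [_ [E1 _]] := fitc _ k1.
    move: F1; rewrite ltnn leqnn t_cells_gt0 mul0n mul1n add0n E1 /= /targ1 ltnn eqxx.
    by rewrite (gtn_eqF (t_cells_gt0 _ _ _)) => /code2_inj.
  have rowt c : c < W -> (g c).1.2 = t_init M pre yb Tm c.
    move=> Hc; have [[_ F2] [E1 _]] := fitc _ (ltn_trans Hc Wk); move: F2.
    rewrite E1 (ltn_trans Hc Wk) leqNgt Hc mul1n mul0n addn0 /= /targ2 Hc => H; apply: code1_inj.
    exact: subC_inj (code1C _) (code1C _) H.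
  have up c : c < k -> (g c).2.2 = if c + W < k then (g (c + W)).1.2 else None.
    move=> Hc; have [E1 _] := Hg c Hc; apply: code1_inj.
    have cW : c + W < k + W by rewrite ltn_add2r.
    have [_ F2] := fit _ cW.
    move: F2; rewrite leq_addl addnK E1 mul1n /= /targ2 (ltnNge (c + W) W) leq_addl /=.
    case: ltnP => H; last by rewrite mul0n add0n cW.
    have [E2 _] := Hg _ H; rewrite E2 mul1n /= => {}H.
    exact: esym (subC_add (code1C _) H).
  split.
  + by move=> c Hc; rewrite (ltn_trans Hc Wk) rowt.
  + by move=> c /andP [Hc _]; rewrite ltnNge Hc.
  + by rewrite ltn_predL t_cells_gt0; case: lastk.
  move=> c Hc; have [_ Hloc] := Hg c Hc; have [-> _] := link c Hc; rewrite Hc -(up c Hc).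
  suff -> : (if c.+1 < k then (g c.+1).1.2 else None) = (g c).2.1 by [].
  case: ltnP => H; first by case: (link _ H) => _ ->.
  have -> : c = k.-1 by lia.
  by case: lastk.
exists (fun c => tile_of ((prev u c, u c), (u c.+1, u (c + W)))); split.
  move=> c Hc; apply/mapP; exists ((prev u c, u c), (u c.+1, u (c + W))) => //.
  by rewrite mem_filter /= Hl // mem_enum.
have uk : u k = None by apply: Hd; rewrite leqnn -[X in X < _]addn0 ltn_add2l W0.
move=> c Hc; split; rewrite /tile_of /=.
  rewrite /targ1; case: c Hc => [|c] Hc /=.
    by rewrite t_cells_gt0 mul1n addn0 Hi.
  rewrite eqn_leq; case: ltnP => H.
    by rewrite (ltnW H) !mul1n; rewrite subnK.
  rewrite andbT mul0n add0n; case: ltnP => H1; last by rewrite mul0n.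
  have Ek : c.+1 = k by apply/eqP; rewrite eqn_leq H1.
  by move: He uk; rewrite -Ek /= => -> ->; rewrite mul1n.
rewrite /targ2; case: (ltnP c W) => H1.
  by rewrite (ltn_trans H1 Wk) mul1n mul0n addn0 Hi.
rewrite mul1n subnK //; case: ltnP => H2.
  by rewrite mul1n; rewrite subnK.
by rewrite mul0n Hc Hd // H2.
Qed.
End Tiles.

(** * The reduction *)

Definition shift (j : nat) (v : seq bool) : seq bool := nseq j false ++ v.

Lemma bval_shift j v : bval (shift j v) = 2 ^ j * bval v.
Proof.
have E : bval (nseq j false) = 0 by elim: j => //= j ->.
by rewrite /shift bval_cat E size_nseq.
Qed.

Definition sum_words (l : seq (seq bool)) : seq bool := foldl add [::] l.

Lemma bval_sum_words l : bval (sum_words l) = \sum_(v <- l) bval v.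
Proof.
rewrite /sum_words -[RHS]/(bval [::] + _); elim: l [::] => [|v l IH] a /=.
  by rewrite big_nil addn0.
by rewrite IH bval_add big_cons addnA.
Qed.

Definition tile_word (b W : nat) (e : tile) : seq bool :=
  sum_words [:: [:: true]; shift b (binof e.1.1); shift (b * 2) (binof e.1.2);
    shift (b * 4) (binof e.2.1); shift (b * (3 * W + 2)) (binof e.2.2)].

Lemma bval_tile_word b W e : bval (tile_word b W e) = tile_num W (2 ^ b) e.
Proof.
rewrite bval_sum_words !big_cons big_nil !bval_shift !binofE !bval_bits /tile_num !expnM.
by rewrite /= addn0 muln0 addn0 !addnA
  ![2 ^ b * _]mulnC ![_ * (_ ^ 2)]mulnC ![_ * (_ ^ 4)]mulnC [_ * (_ ^ (_ + _))]mulnC.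
Qed.

Definition pow_word (a : seq bool) (i : nat) : seq bool := trim (iter i (mul a) [:: true]).

Lemma pow_wordE a i : pow_word a i = bits (bval a ^ i).
Proof.
rewrite /pow_word trimE; congr bits; elim: i => //= i IH.
by rewrite bval_mul IH expnS.
Qed.

Section Matrix.
Variables (nums : seq (seq bool)) (K : nat) (target : seq bool).

Definition extra_word (i : nat) : seq bool :=
  if i <= K.-1 then if K.-1 <= i then [:: true] else [::] else target.

Definition matrix_word : seq raw :=
  flatten [seq [seq (false, (pow_word a i, [:: true])) | a <- nums] ++
               [:: (false, (extra_word i, [:: true]))] | i <- iota 0 K.+1].

Definition instance_word : seq bool :=
  word (binof K.+1) (binof (size nums).+1) matrix_word (binof K.+1).

Lemma raw_of_nat n : raw_of (n%:R)%R = (false, (bits n, [:: true])).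
Proof.
have -> : (n%:R : rat)%R = (Posz n)%:~R%R by rewrite pmulrn.
by rewrite /raw_of numq_int denq_int.
Qed.

Lemma instance_wordE : 0 < K -> target = bits (bval target) ->
  instance_word = enc_instance (sum_matrix (map bval nums) K (bval target)) K.+1.
Proof.
move=> K0 Et; rewrite enc_instance_word /instance_word !binofE; congr (word _ (bits _.+1) _ _); first by rewrite size_map.
rewrite /matrix_word /rawlist /allpairs_dep -val_enum_ord -map_comp; congr flatten.
apply: eq_map => i /=.
have E (j : 'I_(size (map bval nums)).+1) : raw_of (sum_matrix (map bval nums) K (bval target) i j) =
    (false, (if j < size nums then pow_word (nth [::] nums j) i else extra_word i, [:: true])).
  rewrite mxE raw_of_nat; congr (_, (_, _)); move: (nat_of_ord j) => j'; rewrite size_map.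
  case: ltnP => Hj; first by rewrite pow_wordE (nth_map [::]).
  rewrite /sum_extra /extra_word; move: (ltn_ord i); move: (nat_of_ord i) => n Hn.
  case: eqP => [->|H1]; first by rewrite leqnn.
  case: eqP => [->|H2]; first by rewrite ifF //; lia.
  have -> : n <= K.-1 by lia.
  by rewrite ifF //; lia.
rewrite (eq_map E).
rewrite (map_comp (fun j =>
  (false, (if j < size nums then pow_word (nth [::] nums j) i else extra_word i, [:: true]))) (@nat_of_ord _)).
rewrite val_enum_ord size_map -[(size nums).+1]addn1 iotaD map_cat /= ltnn; congr cat.
rewrite -{1}(mkseq_nth [::] nums) /mkseq -map_comp; apply/eq_in_map => j.
by rewrite mem_iota /= => ->.
Qed.
End Matrix.

Section Reduction.
Variables (M : TM) (cM cy : nat).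

(** The known part of the input of the verifier: [pair_enc x y] is [r_pre x ++ y]. *)
Definition r_pre (x : seq bool) : seq bool := stuffed x ++ [:: false; false].
Definition r_yb (x : seq bool) : nat := poly_bound cy (size x).
Definition r_T (x : seq bool) : nat := poly_bound cM (size (r_pre x) + r_yb x).
Definition r_W x : nat := t_width (r_pre x) (r_yb x) (r_T x).
Definition r_k x : nat := t_cells (r_pre x) (r_yb x) (r_T x).
(** The base is B = 2^b, so multiplying by its powers is shifting. With b = k + (1 + 4C), B exceeds
    k (1 + 4C), since n < 2^n for both factors. *)
Definition r_b x : nat := r_k x + (1 + 4 * code_bound M).

Definition r_nums x : seq (seq bool) :=
  flatten [seq [seq shift (r_b x * (3 * c)) (tile_word (r_b x) (r_W x) e) | e <- tiles M]
          | c <- iota 0 (r_k x)].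

Definition r_t1 x := targ1 M (r_pre x) (r_yb x) (r_T x).
Definition r_t2 x := targ2 M (r_pre x) (r_yb x) (r_T x).

Definition r_target x : seq bool := trim (sum_words
  [seq shift (r_b x * (3 * c)) (sum_words [:: [:: c.+1 <= r_k x]; shift (r_b x) (binof (r_t1 x c));
     shift (r_b x * 2) (binof (r_t2 x c))]) | c <- iota 0 (r_k x + r_W x)]).

Definition reduction x : seq bool := instance_word (r_nums x) (r_k x) (r_target x).

Lemma bval_r_nums x : map bval (r_nums x) = cell_nums (r_k x) (r_W x) (2 ^ r_b x) (tiles M).
Proof.
rewrite /r_nums /cell_nums map_flatten -map_comp; congr flatten; apply: eq_map => c /=.
rewrite -map_comp; apply: eq_map => e /=.
by rewrite bval_shift bval_tile_word expnM.
Qed.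

Lemma bval_r_target x : bval (r_target x) = target (r_k x) (r_W x) (2 ^ r_b x) (r_t1 x) (r_t2 x).
Proof.
rewrite bval_trim bval_sum_words big_map /target -(big_mkord predT
  (fun c => (2 ^ r_b x) ^ (3 * c) * ((c < r_k x) + r_t1 x c * 2 ^ r_b x + r_t2 x c * (2 ^ r_b x) ^ 2))).
rewrite /index_iota subn0; apply: eq_bigr => c _.
rewrite bval_shift bval_sum_words !big_cons big_nil !bval_shift !binofE !bval_bits !expnM /=.
by rewrite muln0 !addn0 !addnA ![2 ^ r_b x * _]mulnC [_ ^ 2 * _]mulnC.
Qed.

Variable F : seq bool -> seq bool.
Hypothesis FM : forall z, exists t, [/\ t <= poly_bound cM (size z), halted (run t (init M z)) &
  output (run t (init M z)) = F z].

Lemma sum_iff_accepted x :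
  (exists J : {set 'I_(size (map bval (r_nums x)))},
     #|J| = r_k x /\ \sum_(j in J) nth 0 (map bval (r_nums x)) j = bval (r_target x)) <->
  exists y, size y <= poly_bound cy (size x) /\ F (pair_enc x y) = [:: true].
Proof.
have FM' y : size y <= r_yb x -> exists t, [/\ t <= r_T x, halted (run t (init M (r_pre x ++ y))) &
    output (run t (init M (r_pre x ++ y))) = F (r_pre x ++ y)].
  move=> Hy; have [t [H1 H2 H3]] := FM (r_pre x ++ y); exists t; split => //.
  by apply: leq_trans H1 _; rewrite leq_add2r leq_mul2l leq_expl ?orbT // size_cat leq_add2l.
have preE y : r_pre x ++ y = pair_enc x y by rewrite pair_encE -catA.
have pre0 : 0 < size (r_pre x) by rewrite size_cat addnS.
have W0 := t_width_gt0 (r_pre x) (r_yb x) (r_T x).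
have k0 := t_cells_gt0 (r_pre x) (r_yb x) (r_T x).
have BC : r_k x * (1 + 4 * code_bound M) < 2 ^ r_b x.
  by rewrite expnD ltn_mul // ltn_expl.
rewrite bval_r_target bval_r_nums.
have CS := choice_sum k0 W0 BC (tiles_uniq M) (@tiles_bound M)
  (@targ1_bound M (r_pre x) (r_yb x) (r_T x))
  (@targ2_bound M (r_pre x) (r_yb x) (r_T x)).
rewrite CS tiles_tableau; split.
  by case=> u /(tableau_sound pre0 FM') [y [Hy Hf]]; exists y; rewrite -preE.
by case=> y [Hy]; rewrite -preE => Hf; have := tableau_complete pre0 FM' Hy Hf.
Qed.

(** The sparsity is k + 1: the k chosen numbers and the extra column. *)
Lemma reduction_correct (R : realType) x :
  NSP_language R (reduction x) <->
  ~ exists y, size y <= poly_bound cy (size x) /\ F (pair_enc x y) = [:: true].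
Proof.
have W0 := t_width_gt0 (r_pre x) (r_yb x) (r_T x).
have k0 := t_cells_gt0 (r_pre x) (r_yb x) (r_T x).
have BC : r_k x * (1 + 4 * code_bound M) < 2 ^ r_b x.
  by rewrite expnD ltn_mul // ltn_expl.
have us : uniq (map bval (r_nums x)).
  rewrite bval_r_nums.
  exact: (cell_nums_uniq id id k0 W0 BC (tiles_uniq M) (@tiles_bound M)).
rewrite -sum_iff_accepted /reduction instance_wordE //; last by rewrite bval_trim -trimE.
set A := sum_matrix _ _ _.
have HA : sparse_kernel A (r_k x).+1 <-> exists J : {set 'I_(size (map bval (r_nums x)))},
     #|J| = r_k x /\ \sum_(j in J) nth 0 (map bval (r_nums x)) j = bval (r_target x).
  split=> [|[J [cJ sJ]]]; first exact: sum_of_sparse_kernel.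
  exact: sparse_kernel_of_sum cJ sJ.
rewrite -HA; split=> [HN Hs|Hs].
  by have [y [_ Hc]] := check_of_sparse Hs; apply: check_sound Hc HN.
exists _, _, A, (r_k x).+1; split => //; split => //.
exact: NSP_of_not_sparse_kernel.
Qed.
End Reduction.

(** * The reduction runs in polynomial time *)

Section ReductionPF.
Context {X : Type} {eX : encodable X}.

Lemma pf_pair_enc (f g : X -> seq bool) : pf f -> pf g -> pf (fun x => pair_enc (f x) (g x)).
Proof.
move=> Hf Hg; rewrite /pair_enc; apply: pf_cat; last by pf_auto.
by apply: pf_flatten; apply: (pf_map (h := fun _ b => [:: true; b])); pf_auto.
Qed.

Lemma pf_shift (j : X -> nat) (v : X -> seq bool) : pf j -> pf v -> pf (fun x => shift (j x) (v x)).
Proof. by move=> Hj Hv; rewrite /shift; pf_auto. Qed.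

Lemma pf_sum_words (l : X -> seq (seq bool)) : pf l -> pf (fun x => sum_words (l x)).
Proof.
move=> Hl; rewrite /sum_words.
apply: (pf_foldl_grow (k := 1) (d := fun=> 6)); [by pf_auto|by pf_auto|by []|exact: pbd_const|].
by move=> x a b; rewrite !esize_bits size_add; lia.
Qed.

Lemma pf_pow_word (a : X -> seq bool) (i : X -> nat) : pf a -> pf i -> pf (fun x => pow_word (a x) (i x)).
Proof.
move=> Ha Hi; rewrite /pow_word; apply: pf_trim.
apply: (pf_iter (bnd := fun x => 6 * (2 * (i x * size (a x)) + 1) + 1)).
- by apply: pf_mul; [apply: (pf_comp Ha)|]; pf_auto.
- by [].
- exact: pf_const.
- apply: (pbd_add _ (pbd_const 1)); apply: (pbd_mul (pbd_const 6)).
  apply: (pbd_add _ (pbd_const 1)); apply: (pbd_mul (pbd_const 2)); apply: pbd_mul.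
    by apply: pbd_le (pf_size Hi) _ => x; rewrite esize_unary; lia.
  exact: pbd_size.
- move=> x j Hj; rewrite esize_bits.
  have : size (iter j (mul (a x)) [:: true]) <= 2 * (j * size (a x)) + 1.
    elim: j {Hj} => //= j IH; apply: leq_trans (size_mul _ _) _; rewrite mulSn; lia.
  have : j * size (a x) <= i x * size (a x) by rewrite leq_mul2r Hj orbT.
  lia.
Qed.

Lemma pf_eqn (f g : X -> nat) : pf f -> pf g -> pf (fun x => f x == g x).
Proof.
move=> Hf Hg; apply: (pf_ext (f := fun x => (f x <= g x) && (g x <= f x))); first by pf_auto.
by move=> x; rewrite -eqn_leq.
Qed.
End ReductionPF.

Ltac pf_hook4 := first
  [ simple apply pf_pair_enc | simple apply pf_shift | simple apply pf_sum_words
  | simple apply pf_pow_word | simple apply pf_eqn ].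

Ltac pf_hook ::= first [ pf_hook4 | pf_hook3 | pf_hook2 | pf_hook1 ].

Section InstancePF.
Context {X : Type} {eX : encodable X}.

Lemma pf_tile_word (b W : X -> nat) (e : X -> tile) :
  pf b -> pf W -> pf e -> pf (fun x => tile_word (b x) (W x) (e x)).
Proof. by move=> Hb HW He; rewrite /tile_word; pf_auto. Qed.

Lemma pf_rats_word (rs : X -> seq raw) (t : X -> seq bool) :
  pf rs -> pf t -> pf (fun x => rats_word (rs x) (t x)).
Proof.
move=> Hr Ht; apply: (pf_ext (f := fun x =>
  flatten [seq q.1 :: pair_enc q.2.1 [::] ++ pair_enc q.2.2 [::] | q <- rs x] ++ t x)).
  by apply: pf_cat => //; apply: pf_flatten; apply: (pf_map (h := fun _ q => _)); pf_auto.
move=> x; elim: (rs x) => //= q l ->.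
by rewrite !pair_encE -!catA /=.
Qed.

Lemma pf_instance_word (nums : X -> seq (seq bool)) (K : X -> nat) (target : X -> seq bool) :
  pf nums -> pf K -> pf target -> pf (fun x => instance_word (nums x) (K x) (target x)).
Proof.
move=> Hn HK Ht; rewrite /instance_word /word.
apply: pf_pair_enc; first by pf_auto.
apply: pf_pair_enc; first by pf_auto.
apply: pf_rats_word; last by pf_auto.
rewrite /matrix_word; apply: pf_flatten.
apply: (pf_map (h := fun x i => [seq (false, (pow_word a i, [:: true])) | a <- nums x] ++
   [:: (false, (extra_word (K x) (target x) i, [:: true]))])); last by pf_auto.
have Hp : pf (fun p : X * nat => p.1) by pf_auto.
have Hn' := pf_comp Hn Hp; have HK' := pf_comp HK Hp; have Ht' := pf_comp Ht Hp.
apply: pf_cat.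
  by apply: (pf_map (h := fun p a => (false, (pow_word a p.2, [:: true])))); pf_auto.
have HK1 : pf (fun p : X * nat => (K p.1).-1).
  by apply: (pf_ext (f := fun p => K p.1 - 1)); [pf_auto|move=> p; rewrite subn1].
by rewrite /extra_word; pf_auto.
Qed.

Lemma pf_poly_bound c (n : X -> nat) : pf n -> pf (fun x => poly_bound c (n x)).
Proof. by move=> Hn; rewrite /poly_bound; pf_auto. Qed.

Section Targets.
Variables (M : TM) (pre : X -> seq bool) (yb Tm c : X -> nat).
Hypotheses (Hpre : pf pre) (Hyb : pf yb) (HTm : pf Tm) (Hc : pf c).

Lemma pf_t_width : pf (fun x => t_width (pre x) (yb x) (Tm x)).
Proof. by rewrite /t_width /t_off; pf_auto. Qed.

Lemma pf_t_cells : pf (fun x => t_cells (pre x) (yb x) (Tm x)).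
Proof. by rewrite /t_cells /t_height; apply: pf_muln; [exact: pf_t_width|pf_auto]. Qed.

Let HW := pf_t_width.
Let Hk := pf_t_cells.

Lemma pf_targ1 : pf (fun x => targ1 M (pre x) (yb x) (Tm x) (c x)).
Proof.
rewrite /targ1; apply: pf_if; first by pf_auto.
  (* Cell 0 lies in the left margin, so its initial symbol is a blank for every input and this
     branch is a constant. *)
  pose blank : tsym M := Some (Some (Some true, (None, None))).
  pose fixed : tsym M := Some (Some (None, (None, None))).
  exact: (pf_const (code_bound M - enum_rank (blank, fixed))).
by pf_auto.
Qed.

(** The code of a symbol is a constant of the machine M, so a case distinction over the possible
    initial symbols leaves only constants and unary comparisons. *)
Lemma pf_targ2 : pf (fun x => targ2 M (pre x) (yb x) (Tm x) (c x)).
Proof.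
pose d (a : tsym M) : nat := code_bound M - enum_rank a.
pose Fx z : tsym M := Some (Some (None, z)).
have Hi : pf (fun x => d (t_init M (pre x) (yb x) (Tm x) (c x))).
  pose b x := head false (drop (c x - (Tm x).+1) (pre x)).
  apply: (pf_ext (f := fun x => if c x < (Tm x).+1 then d (Fx (None, None)) else
    if c x - (Tm x).+1 < size (pre x) then
      if c x - (Tm x).+1 == 0 then
        if b x then d (Fx (Some ord0, Some true)) else d (Fx (Some ord0, Some false))
      else if b x then d (Fx (None, Some true)) else d (Fx (None, Some false))
    else if c x - (Tm x).+1 < size (pre x) + yb x then d (Some None) else d (Fx (None, None)))).
    by rewrite /b; pf_auto.
  move=> x; rewrite /t_init /t_off; case: ifP => // _; case: ltnP => H; last by case: ifP.
  have -> : onth (pre x) (c x - (Tm x).+1) = Some (b x).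
    by rewrite /b; elim: (pre x) (c x - _) H => [|a s IH] [|i] //= H; apply: IH.
  by case: (_ == 0); case: (b x).
by rewrite /targ2; apply: pf_if; pf_auto.
Qed.
End Targets.
End InstancePF.

(** The list [tiles M] depends on the machine alone and enters the program as a constant. *)
Lemma pf_reduction (M : TM) cM cy : pf (reduction M cM cy).
Proof.
have Hpre : pf r_pre.
  rewrite /r_pre /stuffed; apply: pf_cat; last by pf_auto.
  by apply: pf_flatten; apply: (pf_map (h := fun _ b => [:: true; b])); pf_auto.
have Hyb : pf (r_yb cy) by apply: pf_poly_bound; pf_auto.
have HT : pf (r_T cM cy) by apply: pf_poly_bound; pf_auto.
have HW : pf (r_W cM cy) by apply: pf_t_width.
have Hk : pf (r_k cM cy) by apply: pf_t_cells.
have Hb : pf (r_b M cM cy) by rewrite /r_b; pf_auto.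
rewrite /reduction; apply: pf_instance_word => //.
  rewrite /r_nums; apply: pf_flatten.
  apply: (pf_map (h := fun x c => [seq shift (r_b M cM cy x * (3 * c))
    (tile_word (r_b M cM cy x) (r_W cM cy x) e) | e <- tiles M])); last by pf_auto.
  apply: (pf_map (h := fun p e => shift (r_b M cM cy p.1 * (3 * p.2))
    (tile_word (r_b M cM cy p.1) (r_W cM cy p.1) e))); last exact: pf_const.
  have Hp : pf (fun p : seq bool * nat * tile => p.1.1) by pf_auto.
  have Hb' := pf_comp Hb Hp; have HW' := pf_comp HW Hp.
  by apply: pf_shift; [pf_auto|apply: pf_tile_word; pf_auto].
rewrite /r_target; apply: pf_trim; apply: pf_sum_words.
apply: (pf_map (h := fun x c => shift (r_b M cM cy x * (3 * c))
  (sum_words [:: [:: c < r_k cM cy x]; shift (r_b M cM cy x) (binof (r_t1 M cM cy x c));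
    shift (r_b M cM cy x * 2) (binof (r_t2 M cM cy x c))]))); last by pf_auto.
have Hp : pf (fun p : seq bool * nat => p.1) by pf_auto.
have Hb' := pf_comp Hb Hp; have Hk' := pf_comp Hk Hp; have Hpre' := pf_comp Hpre Hp.
have Hyb' := pf_comp Hyb Hp; have HT' := pf_comp HT Hp.
have Ht1 : pf (fun p => r_t1 M cM cy p.1 p.2) by apply: pf_targ1; pf_auto.
have Ht2 : pf (fun p => r_t2 M cM cy p.1 p.2) by apply: pf_targ2; pf_auto.
by pf_auto.
Qed.

Theorem theorem5 (R : realType) : coNP_complete (NSP_language R).
Proof.
split; first exact: NSP_inCoNP.
move=> L [V [[F [[M [cM HM]] HV]] [cy HL]]].
have FM z : exists t, [/\ t <= poly_bound cM (size z), halted (run t (init M z)) &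
    output (run t (init M z)) = F z].
  by have [t [H1 [H2 H3]]] := HM z; exists t.
exists (reduction M cM cy); split; first exact: pf_FP (pf_reduction M cM cy).
move=> x; rewrite (reduction_correct cy FM).
have -> : (exists y, size y <= poly_bound cy (size x) /\ F (pair_enc x y) = [:: true]) <-> ~ L x.
  by rewrite HL; split=> -[y [Hy /HV]]; exists y.
by split=> [HLx /(_ HLx)|/contrapT].
Qed.
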